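(* Let $n\ge1$, $c$ a positive integer, and let $k_1\ge k_2\ge\cdots\ge k_{n+1}\ge0$, $m_1,\dots,m_n\ge0$, $a\ge0$ be integers; put $a_1=a$, $a_2=\cdots=a_n=0$. For $s=1,\dots,n+1$ let $z^{(s)}=(z^{(s)}_1,\dots,z^{(s)}_{k_s})$ be variables and $z=(z^{(1)},\dots,z^{(n)})$. For $1\le s\le n$, $1\le j\le m_s$, let $\lambda^{(s,j)}$ be partitions and $f_{\lambda^{(s,j)}}\in\Lambda_{\mathbb{Q}}$ homogeneous of degree $|\lambda^{(s,j)}|$ with $\sum_{j=1}^{m_s}|\lambda^{(s,j)}|\le k_s-k_{s+1}$ for every $s$. Let $X^{(s)}_j,Y^{(s)}_j$ be alphabets independent of $z$ and $A^{(s,j)}=(z^{(s)}_1+\cdots+z^{(s)}_{k_s})Y^{(s)}_j+X^{(s)}_j$. Then \[ \mathrm{CT}_{z}\prod_{s=1}^n\prod_{j=1}^{m_s}f_{\lambda^{(s,j)}}\big[A^{(s,j)}\big]\prod_{s=1}^n\frac{\prod_{i=1}^{k_s}(1/z_i^{(s)})_{a_s}(qz_i^{(s)})_{c-1}\prod_{1\le i<j\le k_s}(z_i^{(s)}/z_j^{(s)})_c(qz_j^{(s)}/z_i^{(s)})_c}{\prod_{j=1}^{k_{s+1}}\prod_{i=1}^{k_s}(z_i^{(s)}/z_j^{(s+1)})_c} \] \[ =\prod_{s=1}^n\prod_{j=1}^{m_s}f_{\lambda^{(s,j)}}\Big[\frac{q^a-1}{1-q^c}Y^{(s)}_j+X^{(s)}_j\Big]\prod_{s=1}^nM_{k_s}(a,c-1,c)\prod_{j=1}^{k_{n+1}}(1/z^{(n+1)}_j)_a.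 \]
   Context: $q$ is an indeterminate; $(y)_m=(1-y)(1-yq)\cdots(1-yq^{m-1})$, $(y)_0=1$. $\mathrm{CT}_z$ is the constant term in all variables of $z$; each inverse factor $(1-d\,z_i^{(s)}/z_j^{(s+1)})^{-1}$, $d\in\mathbb{Q}(q)$, is expanded as $\sum_{m\ge0}(d\,z_i^{(s)}/z_j^{(s+1)})^m$. $M_k(A,B,c)=\prod_{i=0}^{k-1}\frac{(q)_{A+B+ic}(q)_{(i+1)c}}{(q)_{A+ic}(q)_{B+ic}(q)_c}$. $\Lambda_{\mathbb{Q}}$ is the ring of symmetric functions over $\mathbb{Q}$ with power sums $p_r$. Plethysm: for an expression $A$ (rational function/formal series in variables such as $q$, the $z$'s and letters of alphabets, rational coefficients), $p_r[A]$ replaces every variable $v$ in $A$ by $v^r$; $f[A]$ substitutes $p_r\mapsto p_r[A]$ in $f$ written as a polynomial in the $p_r$. An alphabet is a formal sum $x_1+x_2+\cdots$ of variables; products of alphabets are sums of products of letters. *)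

(* Defs.v *)
From HB Require Import structures.
From mathcomp Require Import all_boot all_order all_algebra.
From mathcomp Require Import generic_quotient fraction.
From mathcomp Require Import boolp classical_sets cardinality fsbigop.
From mathcomp Require Import freeg mpoly.

Set Implicit Arguments.
Unset Strict Implicit.
Unset Printing Implicit Defensive.

Import Order.TTheory GRing.Theory Num.Theory.
Local Open Scope ring_scope.

Definition Qq : fieldType := {fraction {poly rat}}.
Definition tfrac (p : {poly rat}) : Qq := FracField.tofrac p.
Definition qvar : Qq := tfrac 'X.
Definition ratq (x : rat) : Qq := tfrac x%:P.

(* q |-> q ^ r *)
Definition qadams (r : nat) (x : Qq) : Qq :=
  tfrac (\n_(repr x) \Po 'X^r) / tfrac (\d_(repr x) \Po 'X^r).

Lemma qadams0 r : qadams r 0 = 0.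
Proof.
have n0 : \n_(repr (0 : Qq)) = 0.
  rewrite -[0 in LHS]/(FracField.tofrac 0); unlock FracField.tofrac.
  have /eqP := FracField.equivf_l (Ratio (0 : {poly rat}) 1).
  by rewrite !numden_Ratio ?oner_eq0 // mulr1 mulr0 => /eqP.
by rewrite /qadams n0 comp_poly0 /tfrac tofrac0 mul0r.
Qed.

Section Series.

Context (F : fieldType) (n : nat) (k : 'I_n.+1 -> nat) (L : countType).

(* z^(s)_i is the pair of s : 'I_n.+1 and i : 'I_(k s). *)
Definition zvar : finType := {s : 'I_n.+1 & 'I_(k s)}.

(* A monomial is given by its exponents: integers for the z-variables, and a
   finitely supported function on the letters L of the alphabets. *)
Definition expo : Type := ({ffun zvar -> int} * {freeg L / int})%type.
HB.instance Definition _ := GRing.Zmodule.on expo.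

Definition zwt (e : expo) : int :=
  \sum_(v : zvar) (n - tag v)%:Z * e.1 v.

(* The support condition defining the ring of formal series. The weight of
   z^(s)_i / z^(s+1)_j is 1, so that this ratio is admissible for N = 0; the
   Laurent monomials in z and the monomials in the letters are admissible for
   N large. For given N, N' and e only finitely many pairs of exponents
   d + d' = e are admissible, so all the sums in a product are finite. *)
Definition admissible (N : nat) (e : expo) : Prop :=
  (forall v, `|e.1 v| <= zwt e + N%:Z) /\ (forall l, 0 <= coeff l e.2).

Lemma zwtD d e : zwt (d + e) = zwt d + zwt e.
Proof.
by rewrite /zwt -big_split; apply: eq_bigr => v _; rewrite /= ffunE mulrDr.
Qed.

Lemma zwt0 : zwt 0 = 0.
Proof. by rewrite /zwt big1 // => v _; rewrite /= ffunE mulr0. Qed.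

Lemma admissibleD N M d e :
  admissible N d -> admissible M e -> admissible (N + M) (d + e).
Proof.
move=> [d1 d2] [e1 e2]; split=> [v|l]; last first.
  by rewrite /= coeffD addr_ge0.
rewrite zwtD PoszD addrACA /= ffunE.
exact: le_trans (ler_normD _ _) (lerD (d1 v) (e1 v)).
Qed.

Lemma admissible0 : admissible 0 0.
Proof.
split=> [v|l]; first by rewrite zwt0 /= ffunE normr0.
by rewrite coeff0.
Qed.

Lemma admissibleW N M e : (N <= M)%N -> admissible N e -> admissible M e.
Proof.
move=> NM [e1 e2]; split=> // v; apply: le_trans (e1 v) _.
by rewrite lerD2l lez_nat.
Qed.

Lemma admissible_finite N M e : exists X : seq expo, uniq X /\
  forall d, admissible N d -> admissible M (e - d) -> d \in X.
Proof.
pose B := (`|zwt e| + (N + M) + \sum_(l <- dom e.2) `|coeff l e.2|)%N.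
pose T := ({ffun zvar -> 'I_(B.*2.+1)} *
           {ffun 'I_(size (dom e.2)) -> 'I_(B.+1)})%type.
pose g (t : T) : expo :=
  ([ffun v => (t.1 v)%:Z - B%:Z],
   \sum_(i < size (dom e.2)) << (t.2 i)%:Z *g tnth (in_tuple (dom e.2)) i >>).
exists (undup [seq g t | t : T]); split=> [|d [d1 d2] [f1 f2]].
  exact: undup_uniq.
rewrite mem_undup; apply/mapP.
have zwtB : zwt (e - d) = zwt e - zwt d.
  by apply/eqP; rewrite eq_sym subr_eq -zwtD subrK.
have d2E l : 0 <= coeff l d.2 <= coeff l e.2.
  by rewrite d2 /=; have := f2 l; rewrite /= coeffB subr_ge0.
have d1B v : (`|d.1 v| <= B%:Z).
  have wd : zwt d <= zwt e + M%:Z.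
    have := le_trans (normr_ge0 _) (f1 v).
    by rewrite zwtB addrAC subr_ge0.
  apply: le_trans (d1 v) _; apply: le_trans (lerD wd (lexx _)) _.
  rewrite /B -addrA !PoszD -[leRHS]addrA [N%:Z + _]addrC.
  by rewrite lerD ?abszE ?ler_norm // lerDl.
have d2B (i : 'I_(size (dom e.2))) :
    (`|coeff (tnth (in_tuple (dom e.2)) i) d.2| < B.+1)%N.
  set l := tnth _ _; have ld : l \in dom e.2 by exact: mem_tnth.
  have /andP [c0 cE] := d2E l.
  rewrite ltnS /B (bigD1_seq l) ?uniq_dom //=.
  have : (`|coeff l d.2| <= `|coeff l e.2|)%N.
    by rewrite -lez_nat !gez0_abs // (le_trans c0).
  by move=> H; rewrite addnA; apply: leq_trans H _; rewrite -addnA addnCA leq_addr.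
have d1b v : (absz (d.1 v + B%:Z)%R < B.*2.+1)%N.
  have := d1B v; rewrite ler_norml => /andP[H1 H2].
  rewrite ltnS -lez_nat gez0_abs; last by rewrite -lerBlDr sub0r.
  by rewrite -addnn PoszD lerD2r.
exists ([ffun v => Ordinal (d1b v)], [ffun i => Ordinal (d2B i)]).
  by rewrite mem_enum.
case: d d1 d2 f1 f2 zwtB d2E d1B d2B d1b => da db /= d1 d2 f1 f2 zwtB d2E d1B d2B d1b.
rewrite /g /=; congr pair.
  apply/ffunP=> v; rewrite !ffunE /= gez0_abs ?addrK //.
  by have := d1B v; rewrite ler_norml => /andP[H1 _]; rewrite -lerBlDr sub0r.
apply/eqP/freeg_eqP => l; rewrite raddf_sum /=.
under eq_bigr => i _ do
  rewrite coeffU ffunE /= gez0_abs ?(andP (d2E _)).1 //.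
have -> : \sum_(i < size (dom e.2)) coeff (tnth (in_tuple (dom e.2)) i) db *
    (tnth (in_tuple (dom e.2)) i == l)%:R =
    \sum_(x <- dom e.2) coeff x db * (x == l)%:R.
  by rewrite [RHS]big_tnth.
have [le|le] := boolP (l \in dom e.2).
  rewrite (bigD1_seq l) ?uniq_dom //= eqxx mulr1 big1 ?addr0 // => x /negPf->.
  by rewrite mulr0.
rewrite big_seq big1 => [|x xe]; last first.
  by case: eqP xe le => [->->|] //; rewrite mulr0.
have := d2E l; rewrite (coeff_outdom le) => H.
by apply/eqP; rewrite eq_le andbC.
Qed.

Record series := Series {
  scoef :> expo -> F;
  _ : exists N, forall e, scoef e != 0 -> admissible N e }.

HB.instance Definition _ := gen_eqMixin series.
HB.instance Definition _ := gen_choiceMixin series.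

Lemma seriesP (f g : series) : f =1 g -> f = g.
Proof.
case: f g => [f pf] [g pg] /= /funext fg; rewrite -{}fg in pg *.
by rewrite (Prop_irrelevance pf pg).
Qed.

Lemma admP (f : series) : exists N, forall e, f e != 0 -> admissible N e.
Proof. by case: f. Qed.

Definition conv (f g : expo -> F) (e : expo) : F :=
  \sum_(d \in [set: expo]) f d * g (e - d).

Lemma convE (X : seq expo) f g e : uniq X ->
  (forall d, f d != 0 -> g (e - d) != 0 -> d \in X) ->
  conv f g e = \sum_(d <- X) f d * g (e - d).
Proof.
move=> uX HX; rewrite /conv (fsbigE X) //.
  by apply: eq_bigl => d; rewrite in_setT.
move=> d _; have [->|fd] := eqVneq (f d) 0; first by rewrite mul0r.
have [->|gd] := eqVneq (g (e - d)) 0; first by rewrite mulr0.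
by rewrite HX.
Qed.

Lemma series_finite (f g : series) e : exists X : seq expo, uniq X /\
  forall d, f d != 0 -> g (e - d) != 0 -> d \in X.
Proof.
have [N Nf] := admP f; have [M Mg] := admP g.
have [X [uX HX]] := admissible_finite N M e.
by exists X; split=> // d /Nf ? /Mg; exact: HX.
Qed.

Lemma conv_neq0 f g e : conv f g e != 0 ->
  exists d, f d != 0 /\ g (e - d) != 0.
Proof.
apply: contra_neqP => H; apply: fsbig1 => d _.
have [->|fd] := eqVneq (f d) 0; first by rewrite mul0r.
have [->|gd] := eqVneq (g (e - d)) 0; first by rewrite mulr0.
by case: H; exists d.
Qed.

Fact adm0 : exists N, forall e : expo, (0 : F) != 0 -> admissible N e.
Proof. by exists 0%N => e; rewrite eqxx. Qed.
Definition szero := Series adm0.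

Fact admD (f g : series) :
  exists N, forall e, f e + g e != 0 -> admissible N e.
Proof.
have [N Nf] := admP f; have [M Mg] := admP g.
exists (maxn N M) => e; case: (eqVneq (f e) 0) => [->|fe _].
  by rewrite add0r => /Mg; apply: admissibleW; exact: leq_maxr.
by apply: admissibleW (Nf _ fe); exact: leq_maxl.
Qed.
Definition sadd f g := Series (admD f g).

Fact admN (f : series) : exists N, forall e, - f e != 0 -> admissible N e.
Proof. by have [N Nf] := admP f; exists N => e; rewrite oppr_eq0 => /Nf. Qed.
Definition sopp f := Series (admN f).

Fact admM (f g : series) :
  exists N, forall e, conv f g e != 0 -> admissible N e.
Proof.
have [N Nf] := admP f; have [M Mg] := admP g.
exists (N + M)%N => e /conv_neq0 [d [/Nf fd /Mg gd]].
by rewrite -[e](subrK d) addrC; exact: admissibleD.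
Qed.
Definition smul f g := Series (admM f g).

Fact adm_cst (c : F) :
  exists N, forall e : expo, (if e == 0 then c else 0) != 0 -> admissible N e.
Proof.
exists 0%N => e; case: ifP => [/eqP -> _|_]; first exact: admissible0.
by rewrite eqxx.
Qed.
Definition scst c := Series (adm_cst c).

Lemma saddA : associative sadd.
Proof. by move=> f g h; apply: seriesP => e; exact: addrA. Qed.
Lemma saddC : commutative sadd.
Proof. by move=> f g; apply: seriesP => e; exact: addrC. Qed.
Lemma sadd0 : left_id szero sadd.
Proof. by move=> f; apply: seriesP => e; exact: add0r. Qed.
Lemma saddN : left_inverse szero sopp sadd.
Proof. by move=> f; apply: seriesP => e; exact: addNr. Qed.

HB.instance Definition _ := GRing.isZmodule.Build series saddA saddC sadd0 saddN.

Lemma smulC : commutative smul.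
Proof.
move=> f g; apply: seriesP => e /=.
have [X [uX HX]] := series_finite f g e.
rewrite (convE uX HX) (@convE [seq e - d | d <- X]).
- by rewrite big_map; apply: eq_bigr => d _; rewrite mulrC subKr.
- by rewrite map_inj_uniq //; exact: can_inj (subKr e).
move=> d gd fd; rewrite -[d](subKr e); apply: map_f.
by apply: HX => //; rewrite subKr.
Qed.

Lemma smulA : associative smul.
Proof.
move=> f g h; apply: seriesP => e /=.
have [Nf Hf] := admP f; have [Ng Hg] := admP g; have [Nh Hh] := admP h.
have [X' [uX' HX']] := admissible_finite (Nf + Ng) Nh e.
have [Y' [uY' HY']] := admissible_finite Nf (Ng + Nh) e.
have -> : conv (conv f g) h e = \sum_(d <- X') conv f g d * h (e - d).
  apply: convE => // d /conv_neq0 [d' [/Hf fd /Hg gd]] /Hh; apply: HX'.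
  by rewrite -[d](subrK d') addrC; exact: admissibleD.
have -> : conv f (conv g h) e = \sum_(d <- Y') f d * conv g h (e - d).
  apply: convE => // d /Hf fd /conv_neq0 [d' [/Hg gd /Hh hd]]; apply: HY' => //.
  by rewrite -[e - d](subrK d') addrC; exact: admissibleD.
transitivity (\sum_(d' <- Y') \sum_(d <- X') f d' * (g (d - d') * h (e - d))).
  apply: eq_bigr => d' _; have [->|fd'] := eqVneq (f d') 0.
    by rewrite mul0r big1 // => d _; rewrite mul0r.
  rewrite -mulr_sumr; congr (_ * _).
  rewrite (@convE [seq d - d' | d <- X']).
  - by rewrite big_map; apply: eq_bigr => d _; rewrite opprB addrA addrNK addrC.
  - by rewrite map_inj_uniq //; exact: addIr.
  move=> d gd hd; rewrite -[d](addrK d'); apply: map_f; apply: HX'.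
    by rewrite addrC; apply: admissibleD; [exact: Hf | exact: Hg].
  by rewrite opprD addrA addrAC; exact: Hh.
rewrite exchange_big; apply: eq_bigr => d _ /=.
have [->|hd] := eqVneq (h (e - d)) 0.
  by rewrite mulr0 big1 // => d' _; rewrite !mulr0.
rewrite (@convE Y') // ?mulr_suml; first by apply: eq_bigr => d' _; rewrite mulrA.
move=> d' fd' gd'; apply: HY'; first exact: Hf.
have -> : e - d' = (d - d') + (e - d) by rewrite [RHS]addrC addrA addrNK.
by apply: admissibleD; [exact: Hg | exact: Hh].
Qed.

Lemma smul1 : left_id (scst 1) smul.
Proof.
move=> f; apply: seriesP => e /=; rewrite (@convE [:: 0]) //.
  by rewrite big_seq1 /= eqxx mul1r subr0.
by move=> d /=; case: ifP => [/eqP ->|]; rewrite ?inE ?eqxx.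
Qed.

Lemma smulDl : left_distributive smul sadd.
Proof.
move=> f g h; apply: seriesP => e /=.
have [N Nf] := admP f; have [M Mg] := admP g; have [K Kh] := admP h.
have [X [uX HX]] := admissible_finite (maxn N M) K e.
rewrite !(@convE X) //.
- by rewrite -big_split; apply: eq_bigr => d _; exact: mulrDl.
- move=> d /Mg gd /Kh; apply: HX; apply: admissibleW gd; exact: leq_maxr.
- move=> d /Nf fd /Kh; apply: HX; apply: admissibleW fd; exact: leq_maxl.
move=> d fgd /Kh; apply: HX; case: (eqVneq (f d) 0) fgd => [->|fd _].
  by rewrite add0r => /Mg; apply: admissibleW; exact: leq_maxr.
by apply: admissibleW (Nf _ fd); exact: leq_maxl.
Qed.

Lemma sone_neq0 : scst 1 != 0.
Proof.
apply/eqP => /(congr1 (fun f : series => f 0)) /=.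
by rewrite eqxx => /eqP; rewrite oner_eq0.
Qed.

HB.instance Definition _ := GRing.Zmodule_isComNzRing.Build series
  smulA smulC smul1 smulDl sone_neq0.

Lemma natr_bool_neq0 (b : bool) : b%:R != 0 :> F -> b.
Proof. by case: b; rewrite ?eqxx. Qed.

Lemma zwtMn d r : zwt (d *+ r) = zwt d *+ r.
Proof. by elim: r => [|r IH]; rewrite ?mulr0n ?zwt0 // !mulrS zwtD IH. Qed.

Lemma admissibleMn N d r : admissible N d -> admissible (N * r) (d *+ r).
Proof.
elim: r => [|r IH] Nd; first by rewrite muln0 mulr0n; exact: admissible0.
by rewrite mulnS mulrS; apply: admissibleD => //; exact: IH.
Qed.

Lemma zwtE (u : {ffun zvar -> int}) (x : {freeg L / int}) :
  zwt (u, x) = \sum_(v : zvar) (n - tag v)%:Z * u v.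
Proof. by []. Qed.

Fact adm_zmono (u : {ffun zvar -> int}) : exists N, forall e : expo,
  (e == (u, 0))%:R != 0 :> F -> admissible N e.
Proof.
exists (\sum_v absz (u v) + absz (zwt (u, 0)%R))%N => e.
move=> /natr_bool_neq0/eqP ->.
split=> [v|l] /=; last by rewrite coeff0.
rewrite PoszD [X in _ <= _ + X]addrC addrA -[leLHS]add0r; apply: lerD.
  by rewrite -lerBlDl sub0r abszE -normrN ler_norm.
by rewrite -abszE lez_nat (bigD1 v) //= leq_addr.
Qed.
Definition zmono u : series := Series (adm_zmono u).

Definition zexp (s : 'I_n.+1) (i : 'I_(k s)) : {ffun zvar -> int} :=
  [ffun v => (v == Tagged (fun t => 'I_(k t)) i)%:Z].

Definition zv s (i : 'I_(k s)) : series := zmono (zexp i).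
Definition zinv s (i : 'I_(k s)) : series := zmono (- zexp i).

Lemma zwt_zexp s (i : 'I_(k s)) : zwt (zexp i, 0) = (n - s)%:Z.
Proof.
rewrite zwtE (bigD1 (Tagged (fun t => 'I_(k t)) i)) //= ffunE eqxx mulr1.
by rewrite big1 ?addr0 // => v /negPf H; rewrite ffunE H mulr0.
Qed.

(* The 0-based indices of the levels s and s + 1. *)
Definition cur (s : 'I_n) : 'I_n.+1 := widen_ord (leqnSn n) s.
Definition nxt (s : 'I_n) : 'I_n.+1 := fintype.lift ord0 s.

Lemma admissible_ratio s (i : 'I_(k (cur s))) (j : 'I_(k (nxt s))) :
  admissible 0 (zexp i - zexp j, 0).
Proof.
have wt1 : zwt (zexp i - zexp j, 0) = 1.
  have : zwt ((zexp i - zexp j, 0) + (zexp j, 0)) = (n - s)%:Z.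
    by rewrite -[s : nat]/(cur s : nat) -(zwt_zexp i); congr (zwt (_, _));
       rewrite ?subrK ?addr0.
  rewrite zwtD zwt_zexp lift0 => /(canRL (addrK _)) ->.
  by rewrite -(subnSK (ltn_ord s)) -addn1 PoszD addrAC subrr add0r.
split=> [v|l] /=; last by rewrite coeff0.
by rewrite wt1 !ffunE; case: eqP => _; case: eqP.
Qed.

Lemma ratio_pow_adm s (i : 'I_(k (cur s))) (j : 'I_(k (nxt s))) c m e :
  ((scst c * (zv i * zinv j)) ^+ m) e != 0 -> admissible 0 e.
Proof.
elim: m e => [|m IH] e.
  rewrite expr0 -[1]/(scst 1) /=; case: ifP => [/eqP-> _|_].
    exact: admissible0.
  by rewrite eqxx.
rewrite exprS => /conv_neq0[d [xd /IH ed]].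
have {xd} /conv_neq0[d1 [+ /conv_neq0[d2 []]]] := xd.
rewrite /=; case: ifP => [/eqP-> _|_]; last by rewrite eqxx.
move=> /natr_bool_neq0/eqP ->; rewrite subr0 => /natr_bool_neq0/eqP dE.
rewrite -[e](subrK d) -[0%N]addn0; apply: admissibleD => //.
have -> : d = (zexp i - zexp j, 0); last exact: admissible_ratio.
rewrite -[d](subrK (zexp i, 0)) dE; congr pair; last by rewrite addr0.
by rewrite addrC.
Qed.

Fact adm_geom s (i : 'I_(k (cur s))) (j : 'I_(k (nxt s))) c :
  exists N, forall e,
    \sum_(m \in [set: nat]) ((scst c * (zv i * zinv j)) ^+ m) e != 0 ->
    admissible N e.
Proof.
exists 0%N => e H.
have [m _] := @fsbigN1 _ _ _ _ _ _ (fun e m => ((scst c * (zv i * zinv j)) ^+ m) e) e H.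
exact: ratio_pow_adm.
Qed.

(* The expansion \sum_(m >= 0) (c * z^(s)_i / z^(s+1)_j) ^ m
   of (1 - c * z^(s)_i / z^(s+1)_j) ^ -1. *)
Definition geom s i j c : series := Series (@adm_geom s i j c).

Lemma adm_letter (l : L) (e : expo) :
  (e == (0, << l >>))%:R != 0 :> F -> admissible 0 e.
Proof.
move=> /natr_bool_neq0/eqP ->.
split=> [v|l'] /=; last by rewrite coeffU mul1r; case: eqP.
by rewrite ffunE normr0 zwtE big1 // => w _; rewrite ffunE mulr0.
Qed.
Definition letter (l : L) : series :=
  Series (ex_intro _ 0%N (adm_letter (l := l))).

Fact adm_alph (X : pred L) : exists N, forall e : expo,
  \sum_(l \in [set l | X l]) letter l e != 0 -> admissible N e.
Proof.
exists 0%N => e H.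
have [l _] := @fsbigN1 _ _ _ _ _ _ (fun e l => letter l e) e H.
exact: adm_letter.
Qed.

(* The formal sum of the letters satisfying X. *)
Definition alph (X : pred L) : series := Series (adm_alph X).

Fact adm_ct (f : series) : exists N, forall e : expo,
  (if [forall v : zvar, (tag v < n)%N ==> (e.1 v == 0)] then f e else 0) != 0 ->
  admissible N e.
Proof.
have [N Nf] := admP f; exists N => e; case: ifP => _; first exact: Nf.
by rewrite eqxx.
Qed.

(* The constant term in z^(1), ..., z^(n), but not in z^(n+1). *)
Definition ct f : series := Series (adm_ct f).

Fact adm_raise (phi : F -> F) (phi0 : phi 0 = 0) (r : nat) (f : series) :
  exists N, forall e,
    \sum_(d \in [set d | d *+ r = e]) phi (f d) != 0 -> admissible N e.
Proof.
have [N Nf] := admP f; exists (N * r)%N => e H.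
have [d /= <- fd] := @fsbigN1 _ _ _ _ _ _ (fun (_ : unit) d => phi (f d)) tt H.
by apply/admissibleMn/Nf; apply: contra_neq fd => ->.
Qed.

(* z |-> z ^ r for all the z-variables and the letters, phi on coefficients. *)
Definition raise_vars phi (phi0 : phi 0 = 0) r f : series :=
  Series (adm_raise phi0 r f).

End Series.

(* The plethysm p_r[A]. *)
Definition padams n (k : 'I_n.+1 -> nat) (L : countType) (r : nat)
    (A : series Qq k L) : series Qq k L :=
  raise_vars (qadams0 r) r A.

(* x_N := 0 *)
Definition restrict N (p : {mpoly rat[N.+1]}) : {mpoly rat[N]} :=
  p \mPo [tuple oapp (fun j : 'I_N => 'X_j) 0 (unlift ord_max i) | i < N.+1].

(* The ring of symmetric functions over the rationals, as the inverse limit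
   (with bounded degrees) of the rings of symmetric polynomials in
   x_0, ..., x_(N-1). *)
Record symfun := SymFun {
  sf_poly :> forall N, {mpoly rat[N]};
  sf_sym : forall N, sf_poly N \is symmetric;
  sf_restrict : forall N, restrict (sf_poly N.+1) = sf_poly N;
  sf_bounded : exists D : nat, forall N, (msize (sf_poly N) <= D)%N }.

Definition sf_homog (d : nat) (f : symfun) : Prop :=
  forall N, f N \is d.-homog.

Definition psum N (r : nat) : {mpoly rat[N]} := \sum_(i < N) 'X_i ^+ r.

(* f = P(p_1, ..., p_b) *)
Definition in_psums (f : symfun) (P : {b : nat & {mpoly rat[b]}}) : Prop :=
  forall N, f N = tagged P \mPo [tuple psum N i.+1 | i < tag P].

(* As the power sums freely generate the ring of symmetric functions over the
   rationals, such a P exists, and is unique up to the choice of b. *)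
Definition to_psums (f : symfun) : {b : nat & {mpoly rat[b]}} :=
  xget (existT (fun b => {mpoly rat[b]}) 0%N 0) [set P | in_psums f P].

Definition pleth n (k : 'I_n.+1 -> nat) (L : countType)
    (f : symfun) (A : series Qq k L) : series Qq k L :=
  mmap (fun x : rat => scst k L (ratq x)) (fun i => padams i.+1 A)
    (tagged (to_psums f)).

(* (y)_m, with respect to q *)
Definition qpoch (R : comNzRingType) (q y : R) (m : nat) : R :=
  \prod_(l < m) (1 - y * q ^+ l).

Definition qfact (m : nat) : Qq := qpoch qvar qvar m.

Definition Morris (k A B c : nat) : Qq :=
  \prod_(i < k)
    (qfact (A + B + i * c) * qfact (i.+1 * c)
     / (qfact (A + i * c) * qfact (B + i * c) * qfact c)).

Section Integrand.

Context (n : nat) (k : 'I_n.+1 -> nat) (L : countType).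

Notation S := (series Qq k L).
Notation qS := (scst k L qvar).
Notation z := (@zv Qq n k L _).
Notation z' := (@zinv Qq n k L _).

Definition zsum (s : 'I_n.+1) : S := \sum_(i < k s) z i.

(* 1 / (z^(s)_i / z^(s+1)_j)_c, expanded factor by factor *)
Definition inv_poch (s : 'I_n) (i : 'I_(k (cur s))) (j : 'I_(k (nxt s)))
    (c : nat) : S :=
  \prod_(l < c) geom L i j (qvar ^+ l).

Definition morris_kernel (a c : nat) (s : 'I_n) : S :=
  (\prod_(i < k (cur s))
     (qpoch qS (z' i) (if s == 0%N :> nat then a else 0%N)
      * qpoch qS (qS * z i) c.-1))
  * (\prod_(i < k (cur s)) \prod_(j < k (cur s) | (i < j)%N)
       (qpoch qS (z i * z' j) c
        * qpoch qS (qS * (z j * z' i)) c))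
  * (\prod_(j < k (nxt s)) \prod_(i < k (cur s)) inv_poch i j c).

End Integrand.

Definition is_partition (la : seq nat) : bool :=
  sorted geq la && (0%N \notin la).

(* Main.v *)
Require Import Defs.
From HB Require Import structures.
From mathcomp Require Import all_boot all_order all_algebra.
From mathcomp Require Import generic_quotient fraction.
From mathcomp Require Import boolp classical_sets fsbigop.
From mathcomp Require Import freeg mpoly.
From mathcomp Require Import ring zify.

(* Idea. Put t = q^c, and let g_r(x) = h_r[X (1 - t) / (1 - q)] be the modified
   complete symmetric functions, with generating function
   prod_i 1 / (y x_i)_c. The denominators of the integrand are such generating
   functions at y = 1 / z^(s+1)_j, so that everything reduces, one level at a
   time, to the constant terms of products of functions g_r against the
   integrand of Morris' q-integral in k variables.

   The constant term of the integrand of Morris' integral times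
   prod_(j <= m) sum_r y_j^r g_r is a sum of residues at the points whose
   coordinates are taken in the grid 1 / (y_j q^l), l < c. If m < k, two
   coordinates are in the same progression, and the integrand vanishes. For
   m = k, the substitution y -> u y gives a polynomial of degree at most k a in
   u; when u y_j = q^(-e) with e < a, the one-variable factors of the integrand
   cancel the poles in the progression of y_j, so that only k - 1 progressions
   remain and the sum vanishes again. Hence the polynomial is prod_j (u y_j)_a
   up to the constant term of the integrand itself. Comparing coefficients in y, the product of the g_(r_j)
   is evaluated multiplicatively as long as it has at most k factors. Evaluating
   the residues at y_j = q t^(j-1), where only one of them survives, gives
   Morris' identity.

   By Newton's identities, a power sum p_r is a combination of g_r and of
   products p_i g_(r-i), so multiplying by p_r costs at most r of the k factors
   and acts as the substitution p_r -> (q^(a r) - 1) / (1 - q^(c r)). Together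
   with the k_(s+1) factors coming from the denominators, the degree hypothesis
   is exactly what is needed. The constant term at level s leaves
   prod_j (1 / z^(s+1)_j)_a, which is the missing factor at level s + 1. *)

Set Implicit Arguments.
Unset Strict Implicit.
Unset Printing Implicit Defensive.

Import Order.TTheory GRing.Theory Num.Theory.
Local Open Scope ring_scope.

(** * Complete symmetric functions *)

Lemma big_iota0 T (idx : T) (op : T -> T -> T) c (G : nat -> T) :
  \big[op/idx]_(l <- iota 0 c) G l = \big[op/idx]_(l < c) G l.
Proof. by rewrite -(big_mkord xpredT) /index_iota subn0. Qed.

(** Both sides count the indices other than [v], since each of them forms exactly one ordered pair
    with [v]. The count controls the degree of the Dyson product in each variable. *)
Lemma count_pairs k (v : 'I_k) :
  (\sum_(i < k) \sum_(j < k | (i < j)%N) ((i == v) + (j == v)))%N = k.-1.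
Proof.
transitivity (\sum_(i < k) ((i != v) : nat))%N; last first.
  rewrite -[k in RHS]card_ord -(cardC1 v) -sum1_card [RHS]big_mkcond.
  by apply: eq_bigr => i _; rewrite !inE; case: eqP.
under eq_bigr => i _ do rewrite big_split.
rewrite big_split /= (bigD1 v) //= [X in (_ + X + _)%N]big1 ?addn0; last first.
  by move=> i /negPf iv; rewrite big1 // => j _; rewrite iv.
rewrite [X in (_ + X)%N](exchange_big_dep xpredT) //= [X in (_ + X)%N](bigD1 v) //=.
rewrite [X in (_ + (_ + X))%N]big1 ?addn0; last first.
  by move=> j /negPf jv; rewrite big1 // => i _; rewrite jv.
rewrite eqxx [X in (X + _)%N]big_mkcond [X in (_ + X)%N]big_mkcond.
rewrite -big_split /=; apply: eq_bigr => i _.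
by rewrite -val_eqE /=; case: ltngtP.
Qed.

Lemma prod_pairs_expr (R : comNzRingType) k (u : 'I_k -> R) :
  \prod_(i < k) \prod_(j < k | (i < j)%N) (u i * u j) = \prod_(i < k) u i ^+ k.-1.
Proof.
have prod_delta i : \prod_(v < k) u v ^+ (i == v) = u i.
  by rewrite (bigD1 i) //= eqxx big1 ?mulr1 // => v; rewrite eq_sym => /negPf ->.
transitivity (\prod_(v < k) \prod_(i < k) \prod_(j < k | (i < j)%N)
    u v ^+ ((i == v) + (j == v))).
  rewrite exchange_big; apply: eq_bigr => i _; rewrite exchange_big /=.
  apply: eq_bigr => j _; under [RHS]eq_bigr => v _ do rewrite exprD.
  by rewrite big_split /= !prod_delta.
apply: eq_bigr => v _; rewrite -(count_pairs v) expr_sum.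
by apply: eq_bigr => i _; rewrite expr_sum.
Qed.

Section CompleteSymmetric.

Context (R : comNzRingType).
Implicit Types (x y : R) (s : seq R).

Fixpoint hsym s (r : nat) : R :=
  if s is x :: s' then \sum_(i < r.+1) x ^+ i * hsym s' (r - i)
  else (r == 0%N)%:R.

(** The signed elementary symmetric function [(-1)^r e_r], that is, [h_r] of the formal negative of
    the alphabet. *)
Fixpoint esym_alt s (r : nat) : R :=
  if s is x :: s' then
    esym_alt s' r - (if r is r'.+1 then x * esym_alt s' r' else 0)
  else (r == 0%N)%:R.

Arguments esym_alt : simpl never.

Definition power_sum s (r : nat) : R := \sum_(x <- s) x ^+ r.

Lemma hsym0 s : hsym s 0 = 1.
Proof. by elim: s => //= x s IH; rewrite big_ord1 IH mulr1. Qed.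

Lemma hsym_consS x s r : hsym (x :: s) r.+1 = hsym s r.+1 + x * hsym (x :: s) r.
Proof.
rewrite /= big_ord_recl expr0 mul1r subn0 mulr_sumr; congr (_ + _).
by apply: eq_bigr => i _; rewrite lift0 exprS mulrA subSS.
Qed.

Arguments hsym : simpl never.

Lemma hsym_nil r : hsym [::] r = (r == 0%N)%:R.
Proof. by []. Qed.

Lemma hsym_cons x s r :
  hsym (x :: s) r = \sum_(i < r.+1) x ^+ i * hsym s (r - i).
Proof. by []. Qed.

Lemma hsym_scale y s r : hsym [seq y * x | x <- s] r = y ^+ r * hsym s r.
Proof.
elim: s r => [|x s IH] r.
  by rewrite hsym_nil; case: r => [|r]; rewrite ?mulr1 ?mulr0.
rewrite !hsym_cons mulr_sumr; apply: eq_bigr => -[i ir] _ /=.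
have -> : y ^+ r = y ^+ i * y ^+ (r - i) by rewrite -exprD subnKC.
by rewrite IH exprMn; ring.
Qed.

(** Induction on the alphabet, then on [r], both driven by the recursion [hsym_consS]. *)
Lemma newton_hsym s r :
  r%:R * hsym s r = \sum_(i < r) power_sum s i.+1 * hsym s (r - i.+1).
Proof.
elim: s r => [|x s IH] r.
  rewrite big1 => [|i _]; last by rewrite /power_sum big_nil mul0r.
  by rewrite hsym_nil; case: r => [|r]; rewrite ?mul0r ?mulr0.
elim: r => [|r IHr]; first by rewrite big_ord0 mul0r.
have -> : \sum_(i < r.+1) power_sum (x :: s) i.+1 * hsym (x :: s) (r.+1 - i.+1) =
    x * (\sum_(i < r) power_sum (x :: s) i.+1 * hsym (x :: s) (r - i.+1)) +
    \sum_(i < r.+1) power_sum (x :: s) i.+1 * hsym s (r.+1 - i.+1).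
  rewrite !big_ord_recr /= !subnn !hsym0 mulr_sumr addrA -big_split /=.
  congr (_ + _); apply: eq_bigr => i _; rewrite subSS -(subnSK (ltn_ord i)).
  by rewrite hsym_consS; ring.
have -> : \sum_(i < r.+1) power_sum (x :: s) i.+1 * hsym s (r.+1 - i.+1) =
    r.+1%:R * hsym s r.+1 + x * hsym (x :: s) r.
  rewrite IH hsym_cons mulr_sumr -big_split; apply: eq_bigr => i _ /=.
  by rewrite /power_sum big_cons subSS exprS; ring.
by rewrite -IHr hsym_consS -[r.+1]addn1 natrD; ring.
Qed.

Lemma esym_alt_nil r : esym_alt [::] r = (r == 0%N)%:R.
Proof. by []. Qed.

Lemma esym_alt0 s : esym_alt s 0 = 1.
Proof. by elim: s => //= x s; rewrite /esym_alt subr0. Qed.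

Lemma esym_alt_consS x s r :
  esym_alt (x :: s) r.+1 = esym_alt s r.+1 - x * esym_alt s r.
Proof. by []. Qed.

(** This is [newton_hsym] for the negative alphabet: [h_r] becomes [esym_alt] and [p_r] changes
    sign. The two recursions are matched term by term when power sums are evaluated. *)
Lemma newton_esym_alt s r :
  r%:R * esym_alt s r = - \sum_(i < r) power_sum s i.+1 * esym_alt s (r - i.+1).
Proof.
elim: s r => [|x s IH] r.
  rewrite big1 => [|i _]; last by rewrite /power_sum big_nil mul0r.
  by rewrite oppr0 esym_alt_nil; case: r => [|r]; rewrite ?mul0r ?mulr0.
case: r => [|r]; first by rewrite big_ord0 mul0r oppr0.
have -> : \sum_(i < r.+1) power_sum (x :: s) i.+1 * esym_alt (x :: s) (r.+1 - i.+1)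
  = \sum_(i < r.+1) power_sum s i.+1 * esym_alt s (r.+1 - i.+1)
    - x * (\sum_(i < r) power_sum s i.+1 * esym_alt s (r - i.+1))
    + \sum_(i < r.+1) x ^+ i.+1 * esym_alt (x :: s) (r.+1 - i.+1).
  rewrite mulr_sumr !big_ord_recr subnn !esym_alt0 /power_sum !big_cons.
  set A := \sum_(i < r) _; set B := \sum_(i < r) _; set C := \sum_(i < r) _.
  set D := \sum_(i < r) _.
  rewrite [LHS]/= [RHS]/=; suff -> : A = B - C + D by ring.
  rewrite /A /B /C /D -sumrB -big_split; apply: eq_bigr => i _ /=.
  by rewrite subSS -(subnSK (ltn_ord i)) esym_alt_consS big_cons; ring.
(* In generating functions, multiplying by [x / (1 - x y)] cancels the factor [1 - x y] contributed
   by the letter [x]. *)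
have -> : \sum_(i < r.+1) x ^+ i.+1 * esym_alt (x :: s) (r.+1 - i.+1) =
    x * esym_alt s r.
  elim: r => [|r IHr]; first by rewrite big_ord1 subnn !esym_alt0 expr1.
  rewrite big_ord_recl subSS subn0 esym_alt_consS expr1.
  have -> : \sum_(i < r.+1) x ^+ (fintype.lift ord0 i).+1 *
      esym_alt (x :: s) (r.+2 - (fintype.lift ord0 i).+1) = x * (x * esym_alt s r).
    by rewrite -IHr mulr_sumr; apply: eq_bigr => i _; rewrite lift0 !subSS mulrA -exprS.
  by ring.
have IH' m : \sum_(i < m) power_sum s i.+1 * esym_alt s (m - i.+1) =
    - (m%:R * esym_alt s m) by rewrite IH opprK.
by rewrite !IH' esym_alt_consS -[r.+1]addn1 natrD; ring.
Qed.

Lemma prod_esym_alt s y N : (size s < N)%N ->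
  \prod_(x <- s) (1 - x * y) = \sum_(r < N) esym_alt s r * y ^+ r.
Proof.
elim: s N => [|x s IH] [|N] //= sN.
  rewrite big_nil big_ord_recl big1 ?addr0 ?mulr1 // => i _.
  by rewrite esym_alt_nil mul0r.
rewrite big_cons mulrBl mul1r {1}(IH N.+1) ?(ltnW sN) // (IH N) // mulr_sumr.
rewrite !(big_ord_recl N) !esym_alt0 -addrA; congr (_ + _).
rewrite -sumrB; apply: eq_bigr => i _.
by rewrite lift0 esym_alt_consS exprS; ring.
Qed.

End CompleteSymmetric.

Arguments hsym {R} s r : simpl never.
Arguments esym_alt {R} s r : simpl never.

Lemma rmorph_hsym (R S : comNzRingType) (f : {rmorphism R -> S}) s r :
  f (hsym s r) = hsym (map f s) r.
Proof.
elim: s r => [|x s IH] r /=; first by rewrite rmorph_nat.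
by rewrite rmorph_sum; apply: eq_bigr => i _; rewrite rmorphM rmorphXn /= IH.
Qed.

Lemma rmorph_esym_alt (R S : comNzRingType) (f : {rmorphism R -> S}) s r :
  f (esym_alt s r) = esym_alt (map f s) r.
Proof.
elim: s r => [|x s IH] r; first by rewrite /= !esym_alt_nil rmorph_nat.
case: r => [|r]; first by rewrite !esym_alt0 rmorph1.
by rewrite /= !esym_alt_consS rmorphB rmorphM !IH.
Qed.

(** * Filtrations and truncated inverses *)

Section Filtration.

Context (R : comNzRingType) (hi : nat -> R -> Prop).

(** [hi n p] is read as [p] having order at least [n]. The two instances are the order of a
    polynomial and the degree of a formal series in the variables of one level. In the second,
    [hi 0] is only a subring, as series may have negative degree. *)
Definition filtration : Prop :=
  [/\ forall n, hi n 0, hi 0 1,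
      forall n p q, hi n p -> hi n q -> hi n (p - q),
      forall m n p q, hi m p -> hi n q -> hi (m + n)%N (p * q)
    & forall m n p, (m <= n)%N -> hi n p -> hi m p].

Hypothesis hiF : filtration.

Lemma filtrationN n p : hi n p -> hi n (- p).
Proof. by case: hiF => h0 _ hB _ _ np; rewrite -sub0r; apply: hB. Qed.

Lemma filtrationD n p q : hi n p -> hi n q -> hi n (p + q).
Proof.
case: hiF => h0 _ hB _ _ np nq; rewrite -[q]opprK; apply: hB => //.
exact: filtrationN.
Qed.

Lemma filtration_sum I (r : seq I) (P : pred I) (G : I -> R) n :
  (forall i, P i -> hi n (G i)) -> hi n (\sum_(i <- r | P i) G i).
Proof.
by move=> nG; apply: (big_ind (hi n)) => //; [case: hiF | apply: filtrationD].
Qed.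

Lemma filtration_prod0 I (r : seq I) (P : pred I) (G : I -> R) :
  (forall i, P i -> hi 0 (G i)) -> hi 0 (\prod_(i <- r | P i) G i).
Proof.
move=> nG; apply: (big_ind (hi 0)) => //; first by case: hiF.
by case: hiF => _ _ _ hM _ x y; apply: hM.
Qed.

Lemma filtration_exp x r : hi 1 x -> hi r (x ^+ r).
Proof.
case: hiF => _ h1 _ hM _ hx; elim: r => [|r IH]; first by rewrite expr0.
by rewrite exprS -add1n; apply: hM.
Qed.

Lemma filtration_hsym s r : {in s, forall x, hi 1 x} -> hi r (hsym s r).
Proof.
case: (hiF) => h0 h1 _ hM _.
elim: s r => [|x s IH] r hs; first by rewrite hsym_nil; case: eqP => [->|].
rewrite hsym_cons.
apply: filtration_sum => -[i ir] _ /=; rewrite -{1}(subnKC (ltnSE ir)).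
apply: hM; first by apply/filtration_exp/hs; rewrite mem_head.
by apply: IH => y ys; apply: hs; rewrite inE ys orbT.
Qed.

(** Removing a letter [x] telescopes: [1 - x] times the truncated sum for [x :: s] is the truncated
    sum for [s], up to a single term of the next order. *)
Lemma hsym_inverse s n : {in s, forall x, hi 1 x} ->
  hi n (\prod_(x <- s) (1 - x) * \sum_(r < n) hsym s r - 1).
Proof.
case: (hiF) => h0 h1 hB hM hW.
case: n => [|n] hs; first by rewrite big_ord0 mulr0; apply: hB.
elim: s hs => [|x s IH] hs.
  rewrite big_nil mul1r big_ord_recl big1 => [|i _]; last by rewrite /= .
  by rewrite /= addr0 subrr.
have hx : hi 1 x by apply: hs; rewrite mem_head.
have hs' : {in s, forall y, hi 1 y} by move=> y ys; apply: hs; rewrite inE ys orbT.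
have -> : \prod_(y <- x :: s) (1 - y) * \sum_(r < n.+1) hsym (x :: s) r - 1 =
   (\prod_(y <- s) (1 - y) * \sum_(r < n.+1) hsym s r - 1)
   - (\prod_(y <- s) (1 - y)) * (x * hsym (x :: s) n).
  rewrite big_cons.
  have -> : \sum_(r < n.+1) hsym s r = (1 - x) * \sum_(r < n.+1) hsym (x :: s) r
      + x * hsym (x :: s) n.
    rewrite mulrBl mul1r [X in _ - x * X + _]big_ord_recr mulrDr opprD addrA addrNK.
    rewrite !(big_ord_recl n) -addrA !hsym0; congr (_ + _).
    rewrite mulr_sumr -sumrB.
    by apply: eq_bigr => i _; rewrite lift0 hsym_consS addrK.
  by ring.
apply: (hB); first exact: IH.
rewrite -[n.+1]add0n; apply: (hM).
  rewrite big_seq; apply: filtration_prod0 => y ys; apply: hB => //.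
  exact: hW (hs' _ ys).
by rewrite -add1n; apply: hM => //; apply: filtration_hsym.
Qed.

Lemma filtration_inverse_prod I (r : seq I) (P : pred I) (G H : I -> R) n :
  (forall i, P i -> hi n (G i * H i - 1)) ->
  hi n ((\prod_(i <- r | P i) G i) * (\prod_(i <- r | P i) H i) - 1).
Proof.
case: (hiF) => h0 h1 hB hM hW GH; rewrite -big_split /=.
apply: (big_ind (fun p => hi n (p - 1))) => //; first by rewrite subrr.
move=> x y hx hy; have -> : x * y - 1 = (x - 1) * y + (y - 1) by ring.
apply: filtrationD => //; rewrite -[n]addn0; apply: (hM) => //.
rewrite -[y](subrK 1); apply: filtrationD => //; exact: hW hy.
Qed.

(** The usual uniqueness of inverses, up to order [n]. It compares different truncations of the same
    inverse. *)
Lemma filtration_inverse_unique n a b b' : hi 0 b -> hi 0 b' ->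
  hi n (a * b - 1) -> hi n (a * b' - 1) -> hi n (b - b').
Proof.
case: (hiF) => h0 h1 hB hM hW hb hb' ab ab'.
have -> : b - b' = (a * b - 1) * b' - (a * b' - 1) * b by ring.
by apply: (hB); rewrite -[n]addn0; apply: (hM).
Qed.

End Filtration.

(** * Lagrange interpolation sums *)

Section Lagrange.

Context (F : fieldType).
Implicit Types (x y : F) (s : seq F).

Definition root_poly s : {poly F} := \prod_(x <- s) ('X - x%:P).

(** For distinct entries, the sum of the residues of [x ^ e / root_poly s] at its finite poles. *)
Definition lagrange_sum s e : F := \sum_(x <- s) x ^+ e / (root_poly s)^`().[x].

Lemma root_poly_root s x : x \in s -> (root_poly s).[x] = 0.
Proof. by rewrite -root_prod_XsubC => /rootP. Qed.

Lemma deriv_root_poly_cons x y s : y \in s ->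
  (root_poly (x :: s))^`().[y] = (y - x) * (root_poly s)^`().[y].
Proof.
move=> ys; rewrite /root_poly big_cons -/(root_poly s) derivM derivXsubC mul1r.
by rewrite hornerD hornerM hornerXsubC root_poly_root ?add0r.
Qed.

Lemma perm_lagrange_sum s1 s2 e : perm_eq s1 s2 ->
  lagrange_sum s1 e = lagrange_sum s2 e.
Proof.
move=> s12; rewrite /lagrange_sum (perm_big _ s12).
by rewrite /root_poly (perm_big _ s12).
Qed.

Lemma lagrange_sum_consS x s e : x \notin s ->
  lagrange_sum (x :: s) e.+1 = x * lagrange_sum (x :: s) e + lagrange_sum s e.
Proof.
move=> xs; rewrite /lagrange_sum !big_cons mulrDr !mulr_sumr mulrA -exprS -addrA.
congr (_ + _); rewrite -big_split /= !big_seq; apply: eq_bigr => y ys.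
have yx : y - x != 0.
  by rewrite subr_eq0; apply: contra xs => /eqP <-.
rewrite deriv_root_poly_cons // exprS invfM.
by rewrite -[X in _ = _ + X]mulr1 -(mulfV yx); ring.
Qed.

Lemma lagrange_sum0 s : uniq s -> lagrange_sum s 0 = (size s == 1%N)%:R.
Proof.
have [n sn] := ubnP (size s); elim: n s sn => // n IH [|x [|y s]] sn us.
- by rewrite /lagrange_sum big_nil.
- rewrite /lagrange_sum big_seq1 /root_poly big_seq1 derivXsubC.
  by rewrite hornerC expr0 divr1.
have xy : x != y by move: us; rewrite /= inE negb_or -andbA => /andP[].
have pxy : perm_eq (y :: x :: s) (x :: y :: s).
  by rewrite -[y :: x :: s]/([:: y] ++ [:: x] ++ s) perm_catCA.
have := us; rewrite -(perm_uniq pxy) => /= /andP[yxs /andP[xs us']].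
have := us => /= /andP[xys /andP[ys _]].
(* The sum for exponent [1] is computed by removing [x] and by removing [y]. By induction the
   shorter sums are equal, as they depend only on the size, so [x - y] times the sum for exponent
   [0] vanishes. *)
have := lagrange_sum_consS 0 yxs; rewrite !(perm_lagrange_sum _ pxy).
rewrite (lagrange_sum_consS 0 xys) (IH (x :: s)) ?(IH (y :: s)) ?[uniq _]/= ?ys ?xs //.
rewrite [size _]/= [size _]/= => /addIr /eqP; rewrite -subr_eq0 -mulrBl mulf_eq0 subr_eq0.
by rewrite (negPf xy) => /eqP.
Qed.

(** Up to sign, the value is the residue at infinity. The exponent is lowered by
    [lagrange_sum_consS], which parallels the recursion [hsym_consS]. *)
Lemma lagrange_sumE s e : uniq s ->
  lagrange_sum s e =
    if (e.+1 < size s)%N then 0 else hsym s (e.+1 - size s).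
Proof.
have lagrange_nil m : lagrange_sum [::] m = 0 by rewrite /lagrange_sum big_nil.
elim: e s => [|e IH] [|x s] us; try by rewrite lagrange_nil hsym_nil.
  rewrite (lagrange_sum0 us) eqSS ltnS subSS sub0n hsym0 lt0n.
  by case: eqP.
have /andP[xs us'] := us; rewrite lagrange_sum_consS // !IH // {IH}.
rewrite [size (_ :: _)]/= !ltnS !subSS; case: (ltngtP e.+1 (size s)) => se.
- by rewrite mulr0 addr0.
- by rewrite subSn // hsym_consS addrC.
by rewrite -se subnn !hsym0 mulr0 add0r.
Qed.

End Lagrange.

(** * Iterated residues *)

Section MpolyOrder.

Context (F : comNzRingType) (k : nat).
Implicit Types (p : {mpoly F[k]}) (m : 'X_{1..k}).

Definition mord_ge n p : Prop := forall m, (mdeg m < n)%N -> p@_m = 0.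

Lemma mord_ge0 p : mord_ge 0 p.
Proof. by []. Qed.

Lemma mord_ge_filtration : filtration mord_ge.
Proof.
split=> [n m _|//|n p q hp hq m mn|i j p q hp hq m mij|i j p ij hp m mi].
- exact: mcoeff0.
- by rewrite mcoeffB hp // hq // subrr.
- rewrite mcoeffM big1 // => -[m1 m2] /= /eqP mE.
  have [/hp->|m1i] := ltnP (mdeg m1) i; first by rewrite mul0r.
  rewrite hq ?mulr0 //; have := mdegD m1 m2; rewrite -mE; lia.
exact: hp (leq_trans mi ij).
Qed.

Lemma mord_geX (i : 'I_k) : mord_ge 1 'X_i.
Proof.
move=> m; rewrite ltnS leqn0 mdeg_eq0 => /eqP ->.
by rewrite mcoeffX mnm1_eq0.
Qed.

Lemma mord_geZ n c p : mord_ge n p -> mord_ge n (c *: p).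
Proof. by move=> hp m mn; rewrite mcoeffZ hp // mulr0. Qed.

Lemma mord_ge_prod I (r : seq I) (P : pred I) (d : I -> nat)
    (G : I -> {mpoly F[k]}) :
  (forall i, P i -> mord_ge (d i) (G i)) ->
  mord_ge (\sum_(i <- r | P i) d i)%N (\prod_(i <- r | P i) G i).
Proof.
case: mord_ge_filtration => _ _ _ hM _ hG.
by apply: (big_ind2 (fun x y => mord_ge x y)) => // n p m q hp hq; apply: hM.
Qed.

Lemma mord_ge_homog d p : p \is d.-homog -> mord_ge d p.
Proof. by move=> hp m md; apply: dhomog_nemf_coeff hp _; rewrite neq_ltn md. Qed.

Definition exp_le (b : 'I_k -> nat) p : Prop :=
  forall m, m \in msupp p -> forall i, (m i <= b i)%N.

Lemma exp_leW b b' p : (forall i, b i <= b' i)%N -> exp_le b p -> exp_le b' p.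
Proof. by move=> bb hp m mp i; apply: leq_trans (hp _ mp i) (bb i). Qed.

Lemma exp_le1 b : exp_le b 1.
Proof. by move=> m; rewrite msupp1 inE => /eqP -> i; rewrite mnm0E. Qed.

Lemma exp_leZ b c p : exp_le b p -> exp_le b (c *: p).
Proof. by move=> hp m /msuppZ_le; apply: hp. Qed.

Lemma exp_leX (i : 'I_k) : exp_le (fun j => (i == j) : nat) 'X_i.
Proof. by move=> m; rewrite msuppX inE => /eqP -> j; rewrite mnm1E. Qed.

Lemma exp_leB b p q : exp_le b p -> exp_le b q -> exp_le b (p - q).
Proof. by move=> hp hq m /msuppB_le; rewrite mem_cat => /orP[/hp|/hq]. Qed.

Lemma exp_leM b b' p q :
  exp_le b p -> exp_le b' q -> exp_le (fun i => b i + b' i)%N (p * q).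
Proof.
move=> hp hq m /msuppM_le /allpairsP[[m1 m2] /= [m1p m2q ->]] i.
by rewrite mnmDE leq_add ?hp ?hq.
Qed.

Lemma exp_le_prod I (r : seq I) (P : pred I) (b : I -> 'I_k -> nat)
    (G : I -> {mpoly F[k]}) :
  (forall i, P i -> exp_le (b i) (G i)) ->
  exp_le (fun j => \sum_(i <- r | P i) b i j)%N (\prod_(i <- r | P i) G i).
Proof.
move=> hG; elim: r => [|i r IH]; first by rewrite big_nil; apply: exp_le1.
rewrite big_cons; case: ifP => Pi.
  apply: exp_leW (exp_leM (hG _ Pi) IH) => j.
  by rewrite big_cons Pi.
by apply: exp_leW IH => j; rewrite big_cons Pi.
Qed.

Lemma mcoeffXM_notle m p m' : ~~ (m <= m')%MM -> ('X_[m] * p)@_m' = 0.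
Proof.
move=> mm'; rewrite mcoeffM big1 // => -[m1 m2] /= /eqP m'E.
rewrite mcoeffX; case: eqP => [mE|]; last by rewrite mul0r.
by case/negP: mm'; rewrite [X in (_ <= X)%MM]m'E mE lem_addr.
Qed.

Lemma mcoeff_prod_univariate (h : nat -> F) R m : (forall i, m i < R)%N ->
  (\prod_(i < k) \sum_(e < R) h e *: 'X_i ^+ e)@_m = \prod_(i < k) h (m i).
Proof.
move=> mR; rewrite bigA_distr_bigA /= raddf_sum /=.
pose f0 : {ffun 'I_k -> 'I_R} := [ffun i => Ordinal (mR i)].
have fE (f : {ffun 'I_k -> 'I_R}) :
    (\prod_(i < k) (h (f i) *: 'X_i ^+ f i) : {mpoly F[k]}) =
    (\prod_(i < k) h (f i)) *: 'X_[[multinom (f i : nat) | i < k]].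
  rewrite scaler_prod mpolyXE_id; congr (_ *: _).
  by apply: eq_bigr => i _; rewrite mnmE.
rewrite (bigD1 f0) //= fE mcoeffZ mcoeffX.
have -> : [multinom (f0 i : nat) | i < k] = m.
  by apply/mnmP => i; rewrite mnmE ffunE.
rewrite eqxx mulr1 [X in _ + X]big1 ?addr0.
  by apply: eq_bigr => i _; rewrite ffunE.
move=> f ff0; rewrite fE mcoeffZ mcoeffX; case: eqP => [fm|]; last by rewrite mulr0.
case/eqP: ff0; apply/ffunP => i; apply/val_inj.
by rewrite ffunE /= -fm mnmE.
Qed.

(** The coefficient at this monomial is the constant term after division by the [M]-th power of the
    product of all variables. *)
Definition const_mnm M : 'X_{1..k} := [multinom M | _ < k].

Lemma mdeg_const_mnm M : mdeg (const_mnm M) = (k * M)%N.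
Proof.
by rewrite mdegE (eq_bigr (fun=> M)) => [|i _]; rewrite ?mnmE // sum_nat_const card_ord.
Qed.

Lemma mcoeff_mul_prod_univariate (h : nat -> F) R M p : (M < R)%N ->
  (p * \prod_(i < k) \sum_(e < R) h e *: 'X_i ^+ e)@_(const_mnm M) =
  \sum_(m <- msupp p) p@_m *
     \prod_(i < k) (if (m i <= M)%N then h (M - m i)%N else 0).
Proof.
move=> MR; rewrite {1}[p]mpolyE mulr_suml raddf_sum /=; apply: eq_bigr => m _.
rewrite -scalerAl mcoeffZ; congr (_ * _).
have [mM|mM] := boolP (m <= const_mnm M)%MM.
  rewrite -[const_mnm M](submK mM) [(_ + m)%MM]addmC mulrC mcoeffMX.
  rewrite mcoeff_prod_univariate => [|i]; last first.
    by rewrite mnmBE mnmE; apply: leq_ltn_trans MR; exact: leq_subr.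
  apply: eq_bigr => i _; move/mnm_lepP: mM => /(_ i); rewrite mnmBE mnmE => ->.
  by [].
rewrite mcoeffXM_notle //; have [i miM] : exists i, ~~ (m i <= M)%N.
  apply/existsP; apply: contraR mM => /existsPn mM; apply/mnm_lepP => i.
  by rewrite mnmE; have := mM i; rewrite negbK.
by rewrite (bigD1 i) //= (negPf miM) mul0r.
Qed.

End MpolyOrder.

(** * The residue formula on a grid of poles *)

Section Residues.

Context (F : fieldType) (k : nat).
Implicit Types (p : {mpoly F[k]}) (s ys : seq F).

(* The sum is over the finite poles of an iterated residue in the variables
   [1 / 'X_i]; the bound on the exponents of [p] excludes a pole at infinity. *)
Lemma residue_formula s p M R : uniq s -> 0 \notin s -> (M < R)%N ->
  exp_le (fun=> (M + size s).-1) p -> (0 < M + size s)%N ->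
  (p * \prod_(i < k) \sum_(e < R) hsym s e *: 'X_i ^+ e)@_(const_mnm k M) =
  \sum_(v : {ffun 'I_k -> 'I_(size s)}) p.@[fun i => (s`_(v i))^-1] *
    \prod_(i < k) (s`_(v i) ^+ (M + size s).-1 / (root_poly s)^`().[s`_(v i)]).
Proof.
move=> us s0 MR pb MN; rewrite mcoeff_mul_prod_univariate //.
under [RHS]eq_bigr => v _ do rewrite mevalE mulr_suml.
rewrite exchange_big /= big_seq [RHS]big_seq; apply: eq_bigr => m mp.
under [RHS]eq_bigr => v _ do rewrite -mulrA -big_split /=.
rewrite -mulr_sumr; congr (_ * _).
rewrite -(bigA_distr_bigA (fun (i : 'I_k) (x : 'I_(size s)) =>
  (s`_x)^-1 ^+ m i * (s`_x ^+ (M + size s).-1 / (root_poly s)^`().[s`_x]))) /=.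
apply: eq_bigr => i _; have miM := pb m mp i.
(* The bound [pb] makes this a true subtraction. By [lagrange_sumE] the sum is [h_(M - m i)] if
   [m i <= M] and [0] otherwise. *)
transitivity (lagrange_sum s ((M + size s).-1 - m i)).
  rewrite lagrange_sumE // -subSn // prednK //.
  case: leqP => miM'.
    have -> : (m i <= M)%N by lia.
    by congr hsym; lia.
  by have -> : (m i <= M)%N = false by lia.
rewrite /lagrange_sum (big_nth 0) big_mkord; apply: eq_bigr => j _.
have sj : s`_j != 0 by apply: contraNneq s0 => <-; apply: mem_nth.
by rewrite mulrA exprVn [s`_j ^- _ * _]mulrC -exprB ?unitfE.
Qed.

Context (q : F) (c : nat).

(** The poles, in the variable [1 / 'X_i], of the product of the [1 / (y 'X_i)_c] for [y] in
    [ys]. *)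
Definition grid ys : seq F := [seq y * q ^+ l | y <- ys, l <- iota 0 c].

Lemma size_grid ys : size (grid ys) = (size ys * c)%N.
Proof. by rewrite size_allpairs size_iota. Qed.

Definition letters : seq {mpoly F[k]} :=
  [seq q ^+ l *: 'X_i | i <- enum 'I_k, l <- iota 0 c].

(* The modified complete symmetric function
   [g_r(x; q, t) = h_r[X (1 - t) / (1 - q)]], for [t = q ^ c]. *)
Definition gfun r : {mpoly F[k]} := hsym letters r.

Definition gser R y : {mpoly F[k]} := \sum_(r < R) y ^+ r *: gfun r.

Lemma gfun0 : gfun 0 = 1.
Proof. exact: hsym0. Qed.

Lemma gser_inverse R y :
  mord_ge R ((\prod_(i < k) \prod_(l < c) (1 - (y * q ^+ l) *: 'X_i))
             * gser R y - 1).
Proof.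
have := hsym_inverse (s := [seq y%:MP * x | x <- letters]) (@mord_ge_filtration F k) R.
have -> : \prod_(x <- [seq y%:MP * x | x <- letters]) (1 - x) =
    \prod_(i < k) \prod_(l < c) (1 - (y * q ^+ l) *: 'X_i).
  rewrite big_map big_allpairs_dep big_enum /=; apply: eq_bigr => i _.
  rewrite big_iota0; apply: eq_bigr => l _.
  by rewrite mul_mpolyC scalerA.
have -> : \sum_(r < R) hsym [seq y%:MP * x | x <- letters] r = gser R y.
  by apply: eq_bigr => r _; rewrite hsym_scale -rmorphXn mul_mpolyC.
apply=> _ /mapP[_ /allpairsP[[i l] /= [_ _ ->]] ->].
by rewrite mul_mpolyC; do 2!apply: mord_geZ; apply: mord_geX.
Qed.

(** Both products invert the same triple product up to order [R], grouped by [y] on one side and by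
    variables on the other. *)
Lemma gser_prodE R ys :
  mord_ge R (\prod_(y <- ys) gser R y -
    \prod_(i < k) \sum_(e < R) hsym (grid ys) e *: 'X_i ^+ e).
Proof.
apply: (filtration_inverse_unique (mord_ge_filtration F k)
  (a := \prod_(y <- ys) \prod_(i < k) \prod_(l < c) (1 - (y * q ^+ l) *: 'X_i))) => //.
  apply: (filtration_inverse_prod (mord_ge_filtration F k)) => y _.
  exact: gser_inverse.
rewrite exchange_big /=; apply: (filtration_inverse_prod (mord_ge_filtration F k)) => i _.
have := hsym_inverse (s := [seq 'X_i * x | x <- map (@mpolyC k F) (grid ys)])
  (@mord_ge_filtration F k) R.
have -> : \prod_(x <- [seq 'X_i * x | x <- map (@mpolyC k F) (grid ys)]) (1 - x) =
    \prod_(y <- ys) \prod_(l < c) (1 - (y * q ^+ l) *: 'X_i).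
  rewrite big_map big_map big_allpairs_dep /=; apply: eq_bigr => y _.
  rewrite big_iota0; apply: eq_bigr => l _.
  by rewrite mulrC mul_mpolyC.
have -> : \sum_(e < R) hsym [seq 'X_i * x | x <- map (@mpolyC k F) (grid ys)] e =
    \sum_(e < R) hsym (grid ys) e *: 'X_i ^+ e.
  apply: eq_bigr => e _.
  by rewrite hsym_scale -rmorph_hsym mulrC mul_mpolyC.
apply=> _ /mapP[_ /mapP[x _ ->] ->].
by rewrite mulrC mul_mpolyC; apply: mord_geZ; apply: mord_geX.
Qed.

(** The monomial has degree [k * M < R], so the error in [gser_prodE] does not reach its coefficient
    and [residue_formula] applies. *)
Lemma gser_residues ys p M R : uniq (grid ys) -> 0 \notin grid ys ->
  (M < R)%N -> (k * M < R)%N ->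
  exp_le (fun=> (M + size ys * c).-1) p -> (0 < M + size ys * c)%N ->
  (p * \prod_(y <- ys) gser R y)@_(const_mnm k M) =
  \sum_(v : {ffun 'I_k -> 'I_(size (grid ys))})
    p.@[fun i => ((grid ys)`_(v i))^-1] *
    \prod_(i < k) ((grid ys)`_(v i) ^+ (M + size ys * c).-1 /
                    (root_poly (grid ys))^`().[(grid ys)`_(v i)]).
Proof.
move=> us s0 MR kMR pb MN; rewrite -size_grid -(residue_formula us s0 MR) ?size_grid //.
apply/eqP; rewrite -subr_eq0 -mcoeffB -mulrBr; apply/eqP.
case: (mord_ge_filtration F k) => _ _ _ hM _.
have := hM _ _ p _ (@mord_ge0 _ _ p) (@gser_prodE R ys).
by rewrite add0n; apply; rewrite mdeg_const_mnm.
Qed.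

End Residues.

(** * Products of modified complete symmetric functions *)

Section Kernel.

Context (F : fieldType) (q : F) (q_neq0 : q != 0).
Hypothesis q_expr_neq1 : forall i, (0 < i)%N -> q ^+ i != 1.

Lemma expr_inj : injective (fun i => q ^+ i).
Proof.
suff expr_lt i j : (i < j)%N -> q ^+ i != q ^+ j.
  by move=> i j qij; case: (ltngtP i j) => // /expr_lt; rewrite qij eqxx.
move=> ij; rewrite -(subnKC (ltnW ij)) exprD eq_sym -subr_eq0 -{2}[q ^+ i]mulr1.
by rewrite -mulrBr mulf_neq0 ?expf_neq0 // subr_eq0 q_expr_neq1 // subn_gt0.
Qed.

(** The powers of [q] are distinct, so the field is infinite. Multiplying [p] by the factors
    ['X - x] with [x] in [s] makes every point a root. *)
Lemma poly_eq0_outside (p : {poly F}) (s : seq F) :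
  (forall y, y \notin s -> p.[y] = 0) -> p = 0.
Proof.
move=> ps; pose r := p * \prod_(x <- s) ('X - x%:P).
have r0 y : root r y.
  rewrite rootM root_prod_XsubC; have [ys|/ps py] := boolP (y \in s).
    by apply/orP; right.
  by rewrite /root py eqxx.
apply/eqP/negPn/negP => p0.
have rn0 : r != 0 by apply: mulf_neq0 => //; apply/monic_neq0/monic_prod_XsubC.
have uq : uniq [seq q ^+ i | i <- iota 0 (size r)].
  by rewrite map_inj_uniq ?iota_uniq //; apply: expr_inj.
have := max_poly_roots rn0 (introT allP (fun y _ => r0 y)) uq.
by rewrite size_map size_iota ltnn.
Qed.

Context (c a : nat) (c_gt0 : (0 < c)%N) (k : nat).
Implicit Types (p : {mpoly F[k]}) (ys : seq F).

(** The product of the [(z_i / z_j)_c (q z_j / z_i)_c] over [i < j], with each pair multiplied by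
    [(z_i z_j)^c] to clear denominators. *)
Definition dyson_poly : {mpoly F[k]} :=
  \prod_(i < k) \prod_(j < k | (i < j)%N) \prod_(l < c)
    (('X_j - q ^+ l *: 'X_i) * ('X_i - q ^+ l.+1 *: 'X_j)).

(** [(1 / z_i)_a (q z_i)_(c-1)], multiplied by [z_i ^ a]. *)
Definition morris_factor (i : 'I_k) : {mpoly F[k]} :=
  (\prod_(l < a) ('X_i - (q ^+ l)%:MP)) *
  \prod_(l < c.-1) (1 - q ^+ l.+1 *: 'X_i).

Definition morris_poly : {mpoly F[k]} :=
  (\prod_(i < k) morris_factor i) * dyson_poly.

Definition morris_exp : nat := (a + c * k.-1)%N.

(* The constant term of [p] times the integrand of Morris' identity; the
   negative powers of the variables in that integrand are moved to
   [morris_exp]. *)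
Definition morris_ct p : F := (p * morris_poly)@_(const_mnm k morris_exp).

Lemma morris_ct_sum I (r : seq I) (P : pred I) (G : I -> {mpoly F[k]}) :
  morris_ct (\sum_(i <- r | P i) G i) = \sum_(i <- r | P i) morris_ct (G i).
Proof. by rewrite /morris_ct mulr_suml raddf_sum. Qed.

Lemma morris_ctZ x p : morris_ct (x *: p) = x * morris_ct p.
Proof. by rewrite /morris_ct -scalerAl mcoeffZ. Qed.

Lemma sum_pairs : (\sum_(i < k) \sum_(j < k | (i < j)%N) (2 * c))%N = (k * (c * k.-1))%N.
Proof.
transitivity (\sum_(v < k) c * k.-1)%N; last by rewrite sum_nat_const card_ord.
under [RHS]eq_bigr => v _ do rewrite -(count_pairs v) big_distrr /=.
rewrite exchange_big /=; apply: eq_bigr => i _.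
under [RHS]eq_bigr => v _ do rewrite big_distrr /=.
rewrite exchange_big /=; apply: eq_bigr => j ij.
rewrite -big_distrr big_split /= mulnC; congr (_ * _)%N.
rewrite -[2%N]/(1 + 1)%N; congr (_ + _)%N.
  by rewrite (bigD1 i) //= eqxx big1 // => v; rewrite eq_sym => /negPf ->.
by rewrite (bigD1 j) //= eqxx big1 // => v; rewrite eq_sym => /negPf ->.
Qed.

Lemma exp_le_dyson : exp_le (fun=> 2 * (c * k.-1))%N dyson_poly.
Proof.
pose b (i j v : 'I_k) := (c * (2 * ((i == v) + (j == v))))%N.
have pair_le (i j : 'I_k) : exp_le (b i j) (\prod_(l < c)
    (('X_j - q ^+ l *: 'X_i) * ('X_i - q ^+ l.+1 *: 'X_j)) : {mpoly F[k]}).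
  apply: (exp_leW (b := fun v => \sum_(l < c) (2 * ((i == v) + (j == v))))%N).
    by move=> v; rewrite sum_nat_const card_ord.
  apply: exp_le_prod => l _.
  apply: (exp_leW (b := fun v => ((i == v) + (j == v)) + ((i == v) + (j == v))))%N.
    by move=> v; rewrite mul2n addnn.
  have le_i : exp_le (fun v => (i == v) + (j == v))%N ('X_i : {mpoly F[k]}).
    by apply: exp_leW (@exp_leX _ _ i) => v; rewrite leq_addr.
  have le_j : exp_le (fun v => (i == v) + (j == v))%N ('X_j : {mpoly F[k]}).
    by apply: exp_leW (@exp_leX _ _ j) => v; rewrite leq_addl.
  by apply: exp_leM; apply: exp_leB => //; apply: exp_leZ.
apply: (exp_leW (b := fun v => \sum_(i < k) \sum_(j < k | (i < j)%N) b i j v))%N.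
  move=> v; rewrite /b; under eq_bigr => i _ do rewrite -big_distrr -big_distrr.
  by rewrite -big_distrr -big_distrr /= count_pairs mulnCA.
by apply: exp_le_prod => i _; apply: exp_le_prod.
Qed.

Lemma mord_ge_dyson : mord_ge (k * (c * k.-1)) dyson_poly.
Proof.
case: (mord_ge_filtration F k) => _ _ hB hM _.
rewrite -sum_pairs; apply: mord_ge_prod => i _; apply: mord_ge_prod => j _.
rewrite mulnC -[(c * 2)%N]/(muln c 2) -[c in (c * 2)%N]card_ord -sum_nat_const.
apply: mord_ge_prod => l _; rewrite -[2%N]addn1.
by apply: hM; apply: hB; try apply: mord_geZ; apply: mord_geX.
Qed.

Lemma dyson_poly_eq0 (u : 'I_k -> F) (i j : 'I_k) l : (i < j)%N -> (l < c)%N ->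
  u j = q ^+ l * u i \/ u i = q ^+ l.+1 * u j -> dyson_poly.@[u] = 0.
Proof.
move=> ij lc uij.
rewrite /dyson_poly rmorph_prod (bigD1 i) //= rmorph_prod (bigD1 j) //=.
rewrite rmorph_prod (bigD1 (Ordinal lc)) //= mevalM !mevalB !mevalZ !mevalXU.
by case: uij => ->; rewrite subrr ?mulr0 ?mul0r.
Qed.

(** For [i < j], the factors ['X_j - q^e 'X_i] cover [l' <= l], and the factors
    ['X_i - q^(e+1) 'X_j] cover [l < l']. *)
Lemma dyson_poly_root (u : 'I_k -> F) (i j : 'I_k) y l l' :
  (l < c)%N -> (l' < c)%N -> i != j ->
  u i = (y * q ^+ l)^-1 -> u j = (y * q ^+ l')^-1 -> dyson_poly.@[u] = 0.
Proof.
wlog ij : i j l l' / (i < j)%N.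
  move=> W lc lc' ij ui uj; case: (ltngtP i j) => ij'.
  - exact: (W i j l l').
  - by apply: (W j i l' l) => //; rewrite eq_sym.
  - by case/eqP: ij; apply: val_inj.
move=> lc lc' _ ui uj.
have quot m m' : (m <= m')%N -> (y * q ^+ m)^-1 = q ^+ (m' - m) * (y * q ^+ m')^-1.
  move=> mm'; rewrite !invfM mulrCA; congr (_ * _).
  by rewrite -{2}(subnK mm') exprD invfM mulrA mulfV ?mul1r // expf_neq0.
have [l'l|ll'] := leqP l' l.
  apply: (@dyson_poly_eq0 u i j (l - l')) => //; first by lia.
  by left; rewrite ui uj; apply: quot.
apply: (@dyson_poly_eq0 u i j (l' - l.+1)) => //; first by lia.
by right; rewrite subnSK // ui uj; apply: quot; apply: ltnW.
Qed.

(* Two of the [k] coordinates lie in the same geometric progression. *)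
Lemma dyson_poly_pigeonhole ys (v : 'I_k -> 'I_(size (grid q c ys))) :
  (size ys < k)%N ->
  dyson_poly.@[fun i => ((grid q c ys)`_(v i))^-1] = 0.
Proof.
move=> ysk.
have /fin_all_exists[f fP] (i : 'I_k) : exists yl : F * nat,
    [/\ yl.1 \in ys, (yl.2 < c)%N & (grid q c ys)`_(v i) = yl.1 * q ^+ yl.2].
  have /allpairsP[[y l] /= [yys lc ->]] := mem_nth 0 (ltn_ord (v i)).
  by exists (y, l); split=> //; rewrite mem_iota in lc.
have : ~~ injectiveb (fun i => (f i).1).
  apply/negP => /injectiveP f_inj; move: ysk; rewrite ltnNge; case/negP.
  rewrite -[leqLHS](size_enum_ord k) -(size_map (fun i => (f i).1)).
  apply: uniq_leq_size; first by rewrite map_inj_uniq ?enum_uniq.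
  by move=> _ /mapP[i _ ->]; case: (fP i).
case/injectivePn => i [j ji fij].
have [yys li ui] := fP i; have [_ lj uj] := fP j.
apply: (@dyson_poly_root _ i j (f i).1 (f i).2 (f j).2) => //.
- by rewrite ui.
- by rewrite uj fij.
Qed.

(** Up to a constant, [morris_factor] is the product of the [1 - q^j 'X_i] for [-a < j < c]. The
    window of [c] consecutive exponents starting at [-m] lies in this range because [m < a]. *)
Lemma morris_factor_split m : (m < a)%N -> exists h : 'I_k -> {mpoly F[k]},
  (forall i, exp_le (fun v => (i == v) * a.-1)%N (h i)) /\
  forall i, morris_factor i =
    (\prod_(l < c) (1 - ((q ^+ m)^-1 * q ^+ l) *: 'X_i)) * h i.
Proof.
move=> ma; pose w := (q ^+ a.-1)^-1.
have qn0 i : q ^+ i != 0 by rewrite expf_neq0.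
pose G i e : {mpoly F[k]} := 1 - (w * q ^+ e) *: 'X_i.
pose K : F := \prod_(l < a) (- q ^+ l).
exists (fun i => K *: ((\prod_(0 <= e < a.-1 - m) G i e) *
   \prod_(a.-1 - m + c <= e < a + c.-1) G i e)); split=> i.
  apply: exp_leZ.
  have G_le e : exp_le (fun v => (i == v) : nat) (G i e).
    apply: exp_leB; first exact: exp_le1.
    by apply: exp_leZ; apply: exp_leX.
  have GP_le e1 e2 : exp_le (fun v => (i == v) * (e2 - e1))%N
      (\prod_(e1 <= e < e2) G i e).
    apply: exp_leW (exp_le_prod (b := fun _ v => (i == v) : nat) _) => [v|e _ //].
    by rewrite sum_nat_const_nat mulnC.
  apply: exp_leW (exp_leM (GP_le _ _) (GP_le _ _)) => v.
  by rewrite -mulnDr leq_mul2l; apply/orP; right; lia.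
have -> : morris_factor i = K *: \prod_(0 <= e < a + c.-1) G i e.
  rewrite /morris_factor (big_cat_nat (n := a)) ?leq_addr //=.
  rewrite scalerAl; congr (_ * _); last first.
    rewrite -{1}[a]add0n big_addn addKn big_mkord; apply: eq_bigr => l _.
    congr (1 - _ *: _); rewrite /w; have -> : (l + a = l.+1 + a.-1)%N by lia.
    by rewrite exprD mulrCA mulVf ?mulr1.
  rewrite big_nat_rev /= add0n big_mkord /K -scaler_prod; apply: eq_bigr => l _.
  rewrite scalerBr scalerA; have -> : w * q ^+ (a - l.+1) = (q ^+ l)^-1.
    rewrite /w; have -> : a.-1 = (l + (a - l.+1))%N by have := ltn_ord l; lia.
    by rewrite exprD invfM -mulrA mulVf ?mulr1.
  by rewrite mulNr mulfV // scaleN1r opprK addrC scaleNr -alg_mpolyC.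
rewrite (big_cat_nat (n := a.-1 - m)) //=; last by lia.
rewrite (big_cat_nat (m := a.-1 - m) (n := a.-1 - m + c)) ?leq_addr //=; last by lia.
have -> : \prod_(a.-1 - m <= e < a.-1 - m + c) G i e =
    \prod_(l < c) (1 - ((q ^+ m)^-1 * q ^+ l) *: 'X_i).
  rewrite -{1}[(a.-1 - m)%N]add0n big_addn addKn big_mkord; apply: eq_bigr => l _.
  congr (1 - _ *: _); rewrite /w exprD mulrCA mulrC; congr (_ * _).
  have {1}-> : a.-1 = (m + (a.-1 - m))%N by lia.
  by rewrite exprD invfM -mulrA mulVf ?mulr1.
by rewrite -scalerAr; congr (_ *: _); rewrite mulrCA.
Qed.

(** Once the poles of the progression of [q^(-m)] are cancelled, every residue has [k] coordinates
    in [k.-1] progressions, and the Dyson product vanishes there. *)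
Lemma morris_ct_vanish m ys R : (m < a)%N -> (size ys).+1 = k ->
  uniq (grid q c ys) -> 0 \notin ys -> (k * morris_exp < R)%N ->
  morris_ct (gser k q c R (q ^+ m)^-1 * \prod_(y <- ys) gser k q c R y) = 0.
Proof.
move=> ma ysk us ys0 kR; have [h [h_le hE]] := morris_factor_split ma.
set g := gser _ _ _ _ _; set G := \prod_(y <- ys) _.
pose A : {mpoly F[k]} := \prod_(i < k) \prod_(l < c) (1 - ((q ^+ m)^-1 * q ^+ l) *: 'X_i).
pose P := (\prod_i h i) * dyson_poly.
(* The window [A] is split off the integrand; [A * g] is [1] up to order [R], beyond the coefficient
   extracted. *)
have -> : morris_ct (g * G) =
    (P * G)@_(const_mnm k morris_exp) + ((A * g - 1) * (P * G))@_(const_mnm k morris_exp).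
  rewrite -mcoeffD /morris_ct /morris_poly (eq_bigr _ (fun i _ => hE i)) big_split /=.
  by congr mcoeff; rewrite -/A /P; ring.
have [_ _ _ hM _] := mord_ge_filtration F k.
have s0 : 0 \notin grid q c ys.
  apply/negP => /allpairsP[[y l] /= [yys _ /esym/eqP]].
  rewrite mulf_eq0 (negPf (expf_neq0 _ q_neq0)) orbF => /eqP y0.
  by rewrite -y0 yys in ys0.
have := hM _ _ _ _ (@gser_inverse F k q c R (q ^+ m)^-1) (@mord_ge0 _ _ (P * G)).
rewrite addn0 => -> ; last by rewrite mdeg_const_mnm.
rewrite addr0 /G gser_residues //.
- rewrite big1 // => v _; rewrite mevalM dyson_poly_pigeonhole ?mulr0 ?mul0r //.
  by rewrite -ysk.
- rewrite -ysk mulSn in kR; lia.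
(* The degree in each variable is at most [a.-1 + 2 * (c * k.-1)], which is exactly the limit
   allowed by the residue formula with [k.-1] progressions. *)
- apply: exp_leW (exp_leM (exp_le_prod (fun i _ => h_le i)) exp_le_dyson) => v.
  rewrite (bigD1 v) //= eqxx mul1n [X in (_ + X + _)%N]big1 ?addn0; last first.
    by move=> i /negPf ->.
  by rewrite /morris_exp -ysk /=; lia.
- rewrite /morris_exp; lia.
Qed.

Lemma hsym_homog (s : seq {mpoly F[k]}) r :
  {in s, forall x, x \is 1.-homog} -> hsym s r \is r.-homog.
Proof.
elim: s r => [|x s IH] r hs.
  by rewrite hsym_nil; case: eqP => [->|_]; rewrite ?dhomog1 ?dhomog0.
rewrite hsym_cons; apply: rpred_sum => -[i ir] _ /=.
rewrite -{2}(subnKC (ltnSE ir)); apply: dhomogM.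
  by rewrite -[X in X.-homog]mul1n; apply/dhomogMn/hs/mem_head.
by apply: IH => y ys; apply: hs; rewrite inE ys orbT.
Qed.

Lemma gfun_homog r : gfun k q c r \is r.-homog.
Proof.
apply: hsym_homog => _ /allpairsP[[i l] /= [_ _ ->]].
by apply: dhomogZ; rewrite dhomogX; apply/eqP/mdeg1.
Qed.

(** The Dyson product already has order [k * (c * k.-1)], which leaves only degree [k * a] of the
    extracted monomial. *)
Lemma morris_ct_high d p : p \is d.-homog -> (k * a < d)%N -> morris_ct p = 0.
Proof.
move=> pd kad; have [_ _ _ hM _] := mord_ge_filtration F k.
have := hM _ _ _ _ (mord_ge_homog pd)
  (hM _ _ _ _ (@mord_ge0 _ _ (\prod_(i < k) morris_factor i)) mord_ge_dyson).
by apply; rewrite mdeg_const_mnm /morris_exp mulnDr add0n ltn_add2r.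
Qed.

(** The progressions of length [B] starting at the entries are disjoint. With [B = maxn a c] this
    serves both for the poles, in progressions of length [c], and for the zeros, in progressions of
    length [a]. *)
Definition separated B ys : Prop :=
  [/\ uniq ys, 0 \notin ys & {in ys &, forall y y' l l', (l < B)%N -> (l' < B)%N ->
      y * q ^+ l = y' * q ^+ l' -> y = y'}].

Lemma uniq_grid B b ys : (b <= B)%N -> separated B ys -> uniq (grid q b ys).
Proof.
move=> bB [uys ys0 ysq]; apply: allpairs_uniq => //; first exact: iota_uniq.
move=> _ _ /allpairsP[[y l] /= [yys + ->]] /allpairsP[[y' l'] /= [yys' + ->]].
rewrite !mem_iota !add0n /= => lb lb' yq.
have yy' : y = y' by apply: ysq yq => //; apply: leq_trans bB.
rewrite -{}yy' in yq *; congr (_, _); apply: expr_inj; apply: mulfI yq.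
by apply: contraNneq ys0 => <-.
Qed.

Lemma separated_scale B t ys : t != 0 -> separated B ys ->
  separated B [seq t * y | y <- ys].
Proof.
move=> t0 [uys ys0 ysq]; split.
- by rewrite map_inj_uniq //; apply: mulfI.
- apply/negP => /mapP[y yys /esym/eqP]; rewrite mulf_eq0 (negPf t0) /=.
  by move=> /eqP y0; rewrite -y0 yys in ys0.
move=> _ _ /mapP[y yys ->] /mapP[y' yys' ->] l l' lB lB'.
by rewrite -!mulrA => /(mulfI t0) /(ysq _ _ yys yys' _ _ lB lB') ->.
Qed.

Lemma separated_rem B y ys : separated B ys -> separated B (rem y ys).
Proof.
move=> [uys ys0 ysq]; split; first exact: rem_uniq.
  by apply: contra ys0; apply: mem_rem.
by move=> x x' /mem_rem xys /mem_rem xys'; apply: ysq.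
Qed.

Lemma size_prod_1BX (s : seq F) :
  (size (\prod_(x <- s) (1 - x *: 'X) : {poly F})%R <= (size s).+1)%N.
Proof.
elim: s => [|x s IH]; first by rewrite big_nil size_poly1.
rewrite big_cons; apply: leq_trans (size_polyMleq _ _) _.
have : (size (1 - x *: 'X : {poly F})%R <= 2)%N.
  rewrite (leq_trans (size_polyD _ _)) // size_polyN geq_max size_poly1 /=.
  by apply: leq_trans (size_scale_leq _ _) _; rewrite size_polyX.
by rewrite [size (x :: s)]/=; lia.
Qed.

(** The coefficient of [y^r] in [(y)_a], which is the value of [g_r] at the alphabet
    [(q^a - 1) / (1 - q^c)]. *)
Definition qpoch_coef r : F := esym_alt [seq q ^+ m | m <- iota 0 a] r.

Lemma qpoch_coefE y R : (a < R)%N ->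
  \prod_(m < a) (1 - q ^+ m * y) = \sum_(r < R) qpoch_coef r * y ^+ r.
Proof.
move=> aR; rewrite -prod_esym_alt ?size_map ?size_iota //.
by rewrite big_map big_iota0.
Qed.

Lemma gser0 R : (0 < R)%N -> gser k q c R 0 = 1.
Proof.
case: R => // R _; rewrite /gser big_ord_recl expr0 scale1r gfun0.
by rewrite big1 ?addr0 // => i _; rewrite expr0n scale0r.
Qed.

(* As polynomials of degree at most [k * a] in [t], both sides evaluated at
   [t * ys] agree for [t = 0] and for the [k * a] zeros of the right-hand side. *)
Lemma morris_ct_separated ys R : size ys = k -> separated (maxn a c) ys ->
  (k * morris_exp < R)%N ->
  morris_ct (\prod_(y <- ys) gser k q c R y) =
  morris_ct 1 * \prod_(y <- ys) \prod_(m < a) (1 - q ^+ m * y).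
Proof.
move=> sys sep kR.
have R0 : (0 < R)%N by apply: leq_ltn_trans kR.
(* The polynomial variable records the degree: its coefficient of index [d] is homogeneous of degree
   [d], so [morris_ct_high] bounds the degree of [p]. *)
pose W : {poly {mpoly F[k]}} :=
  \prod_(y <- ys) \poly_(r < R) (y ^+ r *: gfun k q c r).
have W_homog d : W`_d \is d.-homog.
  rewrite /W; elim: (ys) d => [|y s IH] d.
    by rewrite big_nil coef1; case: eqP => [->|_]; rewrite ?dhomog1 ?dhomog0.
  rewrite big_cons coefM; apply: rpred_sum => -[i id] _ /=.
  rewrite -{2}(subnKC (ltnSE id)); apply: dhomogM => //.
  by rewrite coef_poly; case: ifP => _; rewrite ?dhomog0 // dhomogZ ?gfun_homog.
pose p := \poly_(d < (k * a).+1) morris_ct W`_d.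
have pE t : p.[t] = morris_ct (\prod_(y <- ys) gser k q c R (t * y)).
  have tX r : t%:MP_[k] ^+ r = (t ^+ r)%:MP by rewrite rmorphXn.
  have -> : \prod_(y <- ys) gser k q c R (t * y) = W.[t%:MP].
    rewrite /W horner_prod; apply: eq_bigr => y _; rewrite horner_poly.
    apply: eq_bigr => r _; rewrite tX [RHS]mulrC mul_mpolyC scalerA.
    by rewrite exprMn.
  rewrite (horner_coef_wide _ (leq_maxl (size W) (k * a).+1)) morris_ct_sum.
  rewrite (@horner_coef_wide _ (maxn (size W) (k * a).+1) p); last first.
    by rewrite leq_max size_poly orbT.
  apply: eq_bigr => d _; rewrite tX [W`_d * _]mulrC mul_mpolyC morris_ctZ.
  rewrite mulrC coef_poly; case: ltnP => // kad; congr (_ * _).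
  by rewrite (morris_ct_high (W_homog d)).
pose Q : {poly F} := morris_ct 1 *: \prod_(x <- grid q a ys) (1 - x *: 'X).
have QE t : Q.[t] = morris_ct 1 * \prod_(y <- ys) \prod_(m < a) (1 - q ^+ m * (t * y)).
  rewrite /Q hornerZ horner_prod /grid big_allpairs_dep /=; congr (_ * _).
  apply: eq_bigr => y _; rewrite big_iota0; apply: eq_bigr => m _.
  by rewrite hornerD hornerN hornerZ hornerX -polyC1 hornerC [y * _]mulrC -mulrA [y * t]mulrC.
suff pQ : p = Q.
  have := QE 1; rewrite -pQ pE.
  under eq_bigr => y _ do rewrite mul1r.
  by move=> ->; congr (_ * _); under eq_bigr => y _ do under eq_bigr => m _ do rewrite mul1r.
apply/eqP; rewrite -subr_eq0; apply/negPn/negP => pQ0.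
have [_ ys0 _] := sep.
have grid0 : 0 \notin grid q a ys.
  apply/negP => /allpairsP[[y l] /= [yys _ /esym/eqP]].
  rewrite mulf_eq0 (negPf (expf_neq0 _ q_neq0)) orbF => /eqP y0.
  by rewrite -y0 yys in ys0.
pose rs := 0 :: [seq x^-1 | x <- grid q a ys].
have rs_uniq : uniq rs.
  rewrite /= map_inj_uniq ?(uniq_grid (leq_maxl a c)) //; last exact: invr_inj.
  rewrite andbT; apply: contra grid0 => /mapP[x xs /eqP].
  by rewrite eq_sym invr_eq0 => /eqP <-.
have rs_root : all (root (p - Q)) rs.
  rewrite /= /root hornerD hornerN pE QE.
  under eq_bigr => y _ do rewrite mul0r (gser0 R0).
  rewrite big1_eq; under [X in _ - _ * X]eq_bigr => y _ do
    under eq_bigr => m _ do rewrite mul0r mulr0 subr0.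
  under [X in _ - _ * X]eq_bigr => y _ do rewrite big1_eq.
  rewrite big1_eq mulr1 subrr eqxx /=; apply/allP => _ /mapP[_ /allpairsP[[y m] /= [yys + ->]] ->].
  rewrite mem_iota add0n => ma.
  have y0 : y != 0 by apply: contraNneq ys0 => <-.
  (* At this [t] the entry [y] becomes [q^(-m)], and [morris_ct_vanish] applies with the [k.-1]
     other entries. *)
  set t := (y * q ^+ m)^-1.
  have t0 : t != 0 by rewrite invr_eq0 mulf_neq0 // expf_neq0.
  have ty : t * y = (q ^+ m)^-1 by rewrite /t invfM mulrAC mulVf ?mul1r.
  rewrite /root hornerD hornerN pE QE !(big_rem y yys) /= ty.
  rewrite (bigD1 (Ordinal ma)) //= mulfV ?expf_neq0 // subrr !mul0r mulr0 subr0.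
  rewrite -(big_map (fun y => t * y) xpredT (gser k q c R)).
  have sep' := separated_scale t0 (separated_rem y sep).
  apply/eqP; apply: morris_ct_vanish => //.
  - by rewrite size_map size_rem // prednK // lt0n size_eq0; case: (ys) yys.
  - by apply: uniq_grid sep'; apply: leq_maxr.
  - by case: sep'.
have := max_poly_roots pQ0 rs_root rs_uniq.
rewrite /= size_map size_grid sys ltnNge => /negP; apply.
apply: leq_trans (size_polyD _ _) _; rewrite size_polyN geq_max size_poly /=.
apply: leq_trans (size_scale_leq _ _) _.
by apply: leq_trans (size_prod_1BX _) _; rewrite size_grid sys.
Qed.

(** Only finitely many values of [y] are excluded, so [poly_eq0_outside] can be used in the variable
    [y]. *)
Lemma separated_cons B y ys : (0 < B)%N -> separated B ys ->
  y \notin 0 :: [seq x / q ^+ l | x <- grid q B ys, l <- iota 0 B] ->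
  separated B (y :: ys).
Proof.
move=> B0 [uys ys0 ysq]; rewrite inE negb_or => /andP[y0 yP].
have yyq y' l l' : y' \in ys -> (l < B)%N -> (l' < B)%N ->
    y * q ^+ l = y' * q ^+ l' -> False.
  move=> yys lB lB' yq; case/negP: yP; apply/allpairsP.
  exists (y' * q ^+ l', l); split=> /=; last first.
  - by rewrite -yq mulfK // expf_neq0.
  - by rewrite mem_iota.
  by apply/allpairsP; exists (y', l'); rewrite mem_iota.
split=> /=.
- by rewrite uys andbT; apply/negP => /(yyq y 0%N 0%N); apply.
- by rewrite inE negb_or eq_sym y0.
move=> x x'; rewrite !inE => /predU1P[->|xys] /predU1P[->|xys'] l l' lB lB' //.
- by move/(yyq _ _ _ xys' lB lB').
- by move/esym/(yyq _ _ _ xys lB' lB).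
exact: ysq.
Qed.

(** Induction on [rs]: a new parameter [y] replaces the first [g_r]. Both sides are polynomials in
    [y] that agree outside a finite set, so their coefficients of [y^r] agree. *)
Lemma morris_ct_gfun_separated R rs ys : (a < R)%N -> (k * morris_exp < R)%N ->
  all (fun r => r < R)%N rs -> (size rs + size ys)%N = k ->
  separated (maxn a c) ys ->
  morris_ct ((\prod_(r <- rs) gfun k q c r) * \prod_(y <- ys) gser k q c R y) =
  morris_ct 1 * (\prod_(r <- rs) qpoch_coef r) *
    \prod_(y <- ys) \prod_(m < a) (1 - q ^+ m * y).
Proof.
move=> aR kR; elim: rs ys => [|r rs IH] ys /= rsR sk sep.
  by rewrite !big_nil mul1r mulr1 morris_ct_separated.
have /andP[rR rsR'] := rsR.
set G := \prod_(y <- ys) gser _ _ _ _ _; set H := \prod_(y <- ys) _.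
pose p : {poly F} :=
  \poly_(e < R) morris_ct (gfun k q c e * ((\prod_(r <- rs) gfun k q c r) * G)) -
  (morris_ct 1 * (\prod_(r <- rs) qpoch_coef r) * H) *: \poly_(e < R) qpoch_coef e.
have p0 : p = 0.
  apply: poly_eq0_outside => y /(separated_cons _ sep) sep'.
  have {}sep' : separated (maxn a c) (y :: ys).
    by apply: sep'; rewrite leq_max c_gt0 orbT.
  have := IH (y :: ys) rsR' _ sep'; rewrite /= addnS -addSn => /(_ sk).
  rewrite !big_cons -/G -/H (qpoch_coefE y aR) => e1.
  rewrite hornerD hornerN hornerZ !horner_poly; apply/eqP; rewrite subr_eq0; apply/eqP.
  transitivity (morris_ct (\prod_(r <- rs) gfun k q c r * (gser k q c R y * G))).
    rewrite /gser mulr_suml mulr_sumr morris_ct_sum; apply: eq_bigr => e _.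
    by rewrite mulrC -morris_ctZ -!scalerAl -scalerAr; congr (morris_ct (_ *: _)); ring.
  by rewrite e1; ring.
have /eqP := congr1 (fun p : {poly F} => p`_r) p0.
rewrite coefB coefZ !coef_poly rR coef0 subr_eq0 !big_cons => /eqP e1.
by rewrite -mulrA e1; ring.
Qed.

(** The list is padded with zeros to length [k], as [g_0 = 1]; no parameter [y] is left. *)
Theorem morris_ct_gfun rs : (size rs <= k)%N ->
  morris_ct (\prod_(r <- rs) gfun k q c r) =
  morris_ct 1 * \prod_(r <- rs) qpoch_coef r.
Proof.
move=> rsk; pose rs' := rs ++ nseq (k - size rs) 0%N.
pose R := (a + k * morris_exp + \sum_(r <- rs) r.+1).+1.
have rsR : all (fun r => r < R)%N rs'.
  rewrite all_cat all_nseq orbT andbT; apply/allP => r rrs.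
  by rewrite /R ltnS; rewrite (big_rem r rrs) /=; lia.
have sk : (size rs' + size (Nil F))%N = k by rewrite size_cat size_nseq addn0 subnKC.
have sep : separated (maxn a c) [::] by [].
have := morris_ct_gfun_separated _ _ rsR sk sep.
rewrite !big_nil !mulr1 !big_cat /= !big_nseq gfun0.
have -> : qpoch_coef 0 = 1 by rewrite /qpoch_coef esym_alt0.
by rewrite !iter_fix ?mulr1 //; apply; rewrite /R; lia.
Qed.

(** Expanding back in powers of each [y] removes the separation condition, which the points used for
    Morris' identity need not meet when [c < a]. *)
Lemma morris_ct_gser ys R : size ys = k -> (a < R)%N ->
  morris_ct (\prod_(y <- ys) gser k q c R y) =
  morris_ct 1 * \prod_(y <- ys) \prod_(m < a) (1 - q ^+ m * y).
Proof.
move=> sk aR.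
suff H rs : (size rs + size ys)%N = k ->
  morris_ct ((\prod_(r <- rs) gfun k q c r) * \prod_(y <- ys) gser k q c R y) =
  morris_ct 1 * (\prod_(r <- rs) qpoch_coef r) *
    \prod_(y <- ys) \prod_(m < a) (1 - q ^+ m * y).
  by have := H [::]; rewrite !big_nil mul1r mulr1; apply.
elim: ys rs {sk} => [|y ys IH] rs /= sk.
  by rewrite !big_nil !mulr1 morris_ct_gfun // -sk addn0.
rewrite !big_cons (qpoch_coefE y aR) /gser !mulr_suml !mulr_sumr morris_ct_sum.
apply: eq_bigr => r _; have := IH (nat_of_ord r :: rs).
rewrite /= addSn -addnS => /(_ sk); rewrite !big_cons => e1.
rewrite -scalerAl -scalerAr morris_ctZ mulrCA mulrA e1.
by ring.
Qed.

End Kernel.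

(** * Morris' identity *)

Section MorrisValue.

Context (F : fieldType) (q : F) (q_neq0 : q != 0).
Hypothesis q_expr_neq1 : forall i, (0 < i)%N -> q ^+ i != 1.

Definition qfac m : F := \prod_(l < m) (1 - q ^+ l.+1).

Definition qfac_inv m : F := \prod_(l < m) (1 - (q ^+ l.+1)^-1).

Lemma qfac_neq0 m : qfac m != 0.
Proof.
by apply/prodf_neq0 => l _; rewrite subr_eq0 eq_sym; apply: q_expr_neq1.
Qed.

Lemma qfac_inv_neq0 m : qfac_inv m != 0.
Proof.
apply/prodf_neq0 => l _; rewrite subr_eq0 eq_sym invr_eq1; exact: q_expr_neq1.
Qed.

Lemma qfacD m n : qfac (m + n) = qfac m * \prod_(l < n) (1 - q ^+ (m + l).+1).
Proof. by rewrite /qfac big_split_ord. Qed.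

Lemma qfac_invD m n :
  qfac_inv (m + n) = qfac_inv m * \prod_(l < n) (1 - (q ^+ (m + l).+1)^-1).
Proof. by rewrite /qfac_inv big_split_ord. Qed.

Definition morris_value k a c : F :=
  \prod_(i < k) (qfac (a + c.-1 + i * c) * qfac (i.+1 * c)
     / (qfac (a + i * c) * qfac (c.-1 + i * c) * qfac c)).

(* In increasing order, values in [c, k * c] at mutual distance at least [c]
   are [c, 2 * c, ..., k * c]; the distance between consecutive ones being
   exactly [c], their order is the reverse of that of the indices. *)
Lemma spaced_values c k (n : 'I_k -> nat) : (0 < c)%N ->
  (forall i, c <= n i <= k * c)%N ->
  (forall i j : 'I_k, (i < j)%N -> (n j + c <= n i)%N \/ (n i + c < n j)%N) ->
  forall i : 'I_k, n i = ((k - i) * c)%N.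
Proof.
move=> c0 n_le n_sep.
case: k n n_le n_sep => [|k] n n_le n_sep; first by case.
have fl (i : 'I_k.+1) : (n i %/ c - 1 < k.+1)%N.
  have /andP[cn nk] := n_le i.
  have := leq_div2r c nk; rewrite mulnK //.
  have : (0 < n i %/ c)%N by rewrite divn_gt0.
  lia.
have nE i : n i = (n i %/ c * c + n i %% c)%N by apply: divn_eq.
have rlt i : (n i %% c < c)%N by rewrite ltn_pmod.
(* The spacing makes the quotients by [c] distinct, so [f] is a bijection, with inverse [g]. *)
pose f i : 'I_k.+1 := Ordinal (fl i).
have f1 i : (n i %/ c = (f i).+1)%N.
  have /andP[cn nk] := n_le i.
  have : (0 < n i %/ c)%N by rewrite divn_gt0.
  by rewrite /f /=; lia.
have f_inj : injective f.
  move=> i j fij; apply/eqP/negPn/negP => ij.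
  have := nE i; have := nE j; rewrite !f1 fij.
  have := rlt i; have := rlt j => r1 r2 e1 e2.
  case: (ltngtP i j) => ij'.
  - by case: (n_sep _ _ ij'); lia.
  - by case: (n_sep _ _ ij'); lia.
  - by case/eqP: ij; apply: val_inj.
pose g x := invF f_inj (inord x).
have fg x : (x < k.+1)%N -> f (g x) = x :> nat.
  by move=> xk; rewrite f_invF inordK.
have ng x : (x < k.+1)%N -> n (g x) = (x.+1 * c + n (g x) %% c)%N.
  by move=> xk; rewrite {1}nE f1 fg.
have step x : (x.+1 < k.+1)%N -> (n (g x) %% c <= n (g x.+1) %% c)%N /\
    ((n (g x.+1) %% c)%N = 0%N -> (g x.+1 < g x)%N).
  move=> xk; have := ng _ xk; have := ng _ (ltnW xk); rewrite mulSn.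
  have := rlt (g x.+1); have := rlt (g x).
  move: (x.+1 * c)%N (n (g x) %% c)%N (n (g x.+1) %% c)%N => X r r' r1 r2 e1 e2.
  case: (ltngtP (g x) (g x.+1)) => gx.
  - by case: (n_sep _ _ gx) => h; split; lia.
  - by case: (n_sep _ _ gx) => h; split=> //; lia.
  - have gg : g x = g x.+1 by apply: val_inj.
    by move: e2; rewrite -gg e1; split; lia.
(* The upper bound forces the remainder of the largest value to be [0]. Remainders do not decrease
   with the quotient, so all vanish, and [step] then reverses the order of the indices. *)
have down d : (d < k.+1)%N -> (d <= g (k - d))%N /\ (n (g (k - d)) %% c)%N = 0%N.
  elim: d => [|d IH] dk.
    split=> //; rewrite subn0.
    have := ng k (ltnSn k); have /andP[_ nk] := n_le (g k).
    by move: nk (n (g k) %% c)%N => + r; lia.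
  have [s1 s2] := IH (ltnW dk).
  have kd : (k - d = (k - d.+1).+1)%N by lia.
  have [] := step (k - d.+1)%N; first by lia.
  rewrite -kd s2 leqn0 => /eqP t1 /(_ erefl) t2; split=> //.
  exact: leq_ltn_trans s1 t2.
have up x : (x < k.+1)%N -> (g x + x <= k)%N.
  elim: x => [|x IH] xk; first by rewrite addn0 -ltnS.
  have [_ s1] := step x xk; have := IH (ltnW xk).
  have dk : (k - x.+1 < k.+1)%N by lia.
  by have [_] := down _ dk; rewrite subKn // => /s1; lia.
move=> i; have ik := ltn_ord i.
have gi : g (k - i)%N = i.
  apply: val_inj => /=; have [d1 _] := down i ik.
  by have := up (k - i)%N; lia.
have [_ e0] := down i ik; have := ng (k - i)%N.
by rewrite e0 gi addn0 => ->; rewrite ?subSn //; lia.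
Qed.

Lemma prod_pairs_diff (G : nat -> F) k :
  \prod_(i < k) \prod_(j < k | (i < j)%N) G (j - i)%N =
  \prod_(d < k) \prod_(e < d) G e.+1.
Proof.
elim: k => [|k IH]; first by rewrite !big_ord0.
rewrite big_ord_recl big_ord_recr /= mulrC -IH; congr (_ * _).
  apply: eq_bigr => i _; rewrite big_mkcond big_ord_recl /= mul1r [RHS]big_mkcond.
  by apply: eq_bigr => j _; rewrite /bump !add1n ltnS subSS.
rewrite big_mkcond big_ord_recl /= mul1r; apply: eq_bigr => j _.
by rewrite /bump add1n subn0.
Qed.

Lemma telescope_prod_diff (H : nat -> F) k : (forall i, H i != 0) ->
  \prod_(d < k) \prod_(e < d) (H e.+1 / H e) = (\prod_(d < k) H d) / H 0%N ^+ k.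
Proof.
move=> H0; have tel d : \prod_(e < d) (H e.+1 / H e) = H d / H 0%N.
  elim: d => [|d IH]; first by rewrite big_ord0 divff.
  by rewrite big_ord_recr /= IH mulrC mulrA mulfVK.
under eq_bigr => d _ do rewrite tel.
by rewrite big_split /= prodr_const card_ord exprVn.
Qed.

Definition qpowers N : seq F := [seq q ^+ p.+1 | p <- iota 0 N].

Lemma nth_qpowers N p : (p < N)%N -> (qpowers N)`_p = q ^+ p.+1.
Proof. by move=> pN; rewrite (nth_map 0%N) ?size_iota // nth_iota. Qed.

(** The [k] progressions of length [c] follow one another and form a single progression. *)
Lemma grid_qpowers c k :
  grid q c [seq q ^+ (j * c).+1 | j <- iota 0 k] = qpowers (k * c).
Proof.
elim: k => [|k IH] //.
rewrite -[k.+1]addn1 iotaD map_cat /grid allpairs_cat.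
rewrite -[X in X ++ _]/(grid _ _ _) IH mulnDl mul1n /qpowers iotaD map_cat.
congr (_ ++ _); rewrite /= cats0 !add0n.
have -> : iota (k * c) c = map (addn (k * c)) (iota 0 c) by rewrite -iotaDl addn0.
by rewrite -map_comp; apply: eq_map => l /=; rewrite -exprD addSn.
Qed.

Lemma deriv_root_poly_qpowers N p : (p < N)%N ->
  (root_poly (qpowers N))^`().[q ^+ p.+1] =
    (q ^+ p.+1) ^+ N.-1 * (qfac_inv p * qfac (N - p.+1)).
Proof.
move=> pN; have -> : qpowers N = qpowers p ++ q ^+ p.+1 ::
    [seq q ^+ (p.+1 + e).+1 | e <- iota 0 (N - p.+1)].
  rewrite /qpowers -{1}(subnKC (ltnW pN)) iotaD map_cat; congr (_ ++ _).
  rewrite add0n -subnSK //=; congr (_ :: _).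
  by rewrite -{1}[p.+1]addn0 iotaDl -map_comp.
set x := q ^+ p.+1; set s1 := qpowers p; set s2 := [seq _ | _ <- _].
have x0 : x != 0 by rewrite expf_neq0.
rewrite /root_poly big_cat big_cons /= mulrCA derivM derivXsubC mul1r hornerD.
rewrite [X in _ + X]hornerM hornerXsubC subrr mul0r addr0 hornerM !horner_prod.
have -> : N.-1 = (p + (N - p.+1))%N by lia.
rewrite exprD mulrACA; congr (_ * _).
  rewrite /s1 /qpowers big_map big_iota0 (reindex_inj rev_ord_inj) /=.
  rewrite /qfac_inv -[X in x ^+ X]card_ord -prodr_const -big_split /=.
  apply: eq_bigr => l _; rewrite hornerXsubC mulrBr mulr1; congr (_ - _).
  have -> : x = q ^+ (p - l.+1).+1 * q ^+ l.+1.
    by rewrite -exprD /x; congr (q ^+ _); have := ltn_ord l; lia.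
  by rewrite mulfK // expf_neq0.
rewrite /s2 big_map big_iota0 /qfac -[X in x ^+ X]card_ord -prodr_const -big_split /=.
apply: eq_bigr => l _; rewrite hornerXsubC mulrBr mulr1; congr (_ - _).
by rewrite -exprD addnS.
Qed.

Section Term.

Context (a c k : nat) (c_gt0 : (0 < c)%N).

(* The coordinates of the only residue that contributes to the constant term. *)
Let u (i : 'I_k) : F := (q ^+ ((k - i) * c))^-1.

Lemma meval_morris_factor i :
  (morris_factor q c a i).@[u] = u i ^+ a *
    (qfac ((k - i.+1) * c + c.-1 + a) / qfac ((k - i.+1) * c + c.-1)) *
    (qfac_inv ((k - i.+1) * c + c.-1) / qfac_inv ((k - i.+1) * c)).
Proof.
have nE : ((k - i) * c)%N = ((k - i.+1) * c + c.-1).+1.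
  by rewrite -(subnSK (ltn_ord i)) mulSn; lia.
rewrite /morris_factor rmorphM !rmorph_prod /=; congr (_ * _).
  rewrite qfacD mulrAC divff ?qfac_neq0 // mul1r -[X in u i ^+ X]card_ord.
  rewrite -prodr_const -big_split /=; apply: eq_bigr => l _.
  rewrite mevalB mevalXU mevalC mulrBr mulr1; congr (_ - _).
  by rewrite -addSn -nE exprD /u mulKf // expf_neq0.
rewrite qfac_invD mulrAC divff ?qfac_inv_neq0 // mul1r.
rewrite (reindex_inj rev_ord_inj) /=; apply: eq_bigr => l _.
rewrite mevalB mevalZ mevalXU meval1 /u nE; congr (1 - _).
have -> : (((k - i.+1) * c + c.-1).+1 =
    (c.-1 - l.+1).+1 + ((k - i.+1) * c + l).+1)%N by have := ltn_ord l; lia.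
by rewrite exprD invfM mulrA mulfV ?mul1r // expf_neq0.
Qed.

(** Once [(u i * u j)^c] is extracted, the factor of a pair depends only on [j - i]. It is a
    quotient of consecutive values, so the products telescope. *)
Lemma meval_dyson : (dyson_poly q c k).@[u] =
  (\prod_(i < k) u i ^+ (c * k.-1)) *
  ((\prod_(d < k) qfac_inv (d * c)) * ((\prod_(d < k) qfac (d.+1 * c)) / qfac c ^+ k)).
Proof.
pose G d : F := (qfac_inv (d * c) / qfac_inv (d.-1 * c)) *
  (qfac (d.+1 * c) / qfac (d * c)).
transitivity (\prod_(i < k) \prod_(j < k | (i < j)%N) ((u i * u j) ^+ c * G (j - i)%N)).
  rewrite /dyson_poly rmorph_prod; apply: eq_bigr => i _ /=.
  rewrite rmorph_prod; apply: eq_bigr => j ij /=.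
  have nE : ((k - i) * c = (j - i) * c + (k - j) * c)%N.
    by rewrite -mulnDl; congr muln; have := ltn_ord j; lia.
  have uij : u i = (q ^+ ((j - i) * c))^-1 * u j by rewrite /u nE exprD invfM.
  have uji : u j = q ^+ ((j - i) * c) * u i.
    by rewrite uij mulrA mulfV ?mul1r // expf_neq0.
  have dE : (j - i = (j - i).-1.+1)%N by lia.
  rewrite rmorph_prod /= /G.
  under eq_bigr => l _ do rewrite mevalM !mevalB !mevalZ !mevalXU.
  transitivity (\prod_(l < c) (u j * (1 - q ^+ l / q ^+ ((j - i) * c))) *
                \prod_(l < c) (u i * (1 - q ^+ ((j - i) * c + l).+1))).
    rewrite -big_split; apply: eq_bigr => l _ /=; congr (_ * _).
      by rewrite mulrBr mulr1 uij; congr (_ - _); ring.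
    by rewrite mulrBr mulr1 uji -addnS exprD; congr (_ - _); ring.
  rewrite !big_split /= !prodr_const card_ord mulrACA -exprMn [u j * _]mulrC.
  congr (_ * (_ * _)).
    rewrite {2}dE mulSn addnC qfac_invD mulrAC divff ?qfac_inv_neq0 // mul1r.
    rewrite (reindex_inj rev_ord_inj) /=; apply: eq_bigr => l _.
    congr (1 - _).
    have -> : ((j - i) * c = (c - l.+1) + ((j - i).-1 * c + l).+1)%N.
      by rewrite {1}dE mulSn; have := ltn_ord l; lia.
    by rewrite exprD invfM mulrA mulfV ?mul1r // expf_neq0.
  by rewrite mulSn addnC qfacD mulrAC divff ?qfac_neq0 // mul1r.
under eq_bigr => i _ do rewrite big_split /=.
rewrite big_split /= (prod_pairs_diff G); congr (_ * _).
  under eq_bigr => i _ do rewrite prodrXl.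
  rewrite prodrXl prod_pairs_expr -prodrXl; apply: eq_bigr => i _.
  by rewrite -exprM mulnC.
have -> : \prod_(d < k) \prod_(e < d) G e.+1 =
    (\prod_(d < k) \prod_(e < d) (qfac_inv (e.+1 * c) / qfac_inv (e * c))) *
    \prod_(d < k) \prod_(e < d) (qfac (e.+2 * c) / qfac (e.+1 * c)).
  by rewrite -big_split; apply: eq_bigr => d _; rewrite -big_split.
rewrite (@telescope_prod_diff (fun e => qfac_inv (e * c)) k (fun=> qfac_inv_neq0 _)).
rewrite (@telescope_prod_diff (fun e => qfac (e.+1 * c)) k (fun=> qfac_neq0 _)).
by rewrite mul0n {2}/qfac_inv big_ord0 expr1n divr1 mul1n.
Qed.

Lemma residue_term : (0 < k)%N ->
  (morris_poly q c a k).@[u] * \prod_(i < k)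
    ((u i)^-1 ^+ (morris_exp c a k + k * c).-1 /
     (root_poly (qpowers (k * c)))^`().[(u i)^-1]) =
  morris_value k a c * \prod_(d < k) \prod_(l < a) (1 - q ^+ l * q ^+ (d * c).+1).
Proof.
move=> k0; rewrite /morris_poly mevalM rmorph_prod /= meval_dyson.
have Q0 := qfac_neq0; have QI0 := qfac_inv_neq0.
pose A d : F := qfac (d * c + c.-1 + a) / qfac (d * c + c.-1) *
    (qfac_inv (d * c + c.-1) / qfac_inv (d * c)) / qfac_inv (d * c + c.-1).
transitivity ((\prod_(i < k) (A (k - i.+1)%N / qfac (i * c))) *
  ((\prod_(d < k) qfac_inv (d * c)) * ((\prod_(d < k) qfac (d.+1 * c)) / qfac c ^+ k))).
  have shuffle (x y z w : F) : x * (y * z) * w = x * y * w * z by ring.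
  rewrite shuffle; congr (_ * _); rewrite -2!big_split /=; apply: eq_bigr => i _.
  have ui0 : u i != 0 by rewrite invr_eq0 expf_neq0.
  have nE : ((k - i) * c)%N = ((k - i.+1) * c + c.-1).+1.
    by rewrite -(subnSK (ltn_ord i)) mulSn; lia.
  have nN : ((k - i.+1) * c + c.-1 < k * c)%N.
    by rewrite -ltnS -nE ltnS leq_mul2r leq_subr orbT.
  rewrite meval_morris_factor {3 4}/u invrK nE deriv_root_poly_qpowers // -nE.
  have -> : (k * c - (k - i) * c)%N = (i * c)%N.
    by rewrite -mulnBl; congr muln; have := ltn_ord i; lia.
  (* The three parts of the exponent cancel the powers of [u i] coming from the one-variable factor,
     the Dyson product and the derivative of [root_poly]. *)
  have -> : (morris_exp c a k + k * c).-1 = (a + c * k.-1 + (k * c).-1)%N.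
    have kc0 : (0 < k * c)%N by rewrite muln_gt0 k0.
    by rewrite /morris_exp; move: (c * k.-1)%N (k * c)%N kc0 => x y; lia.
  have -> : q ^+ ((k - i) * c) = (u i)^-1 by rewrite invrK.
  have uV : u i * (u i)^-1 = 1 by rewrite mulfV.
  rewrite [in X in _ * X]exprD exprD /A !invfM.
  set V := (u i)^-1; set x := V ^+ (k * c).-1.
  have x0 : x != 0 by rewrite expf_neq0 // invr_neq0.
  have ua : u i ^+ a * V ^+ a = 1 by rewrite -exprMn uV expr1n.
  have uc : u i ^+ (c * k.-1) * V ^+ (c * k.-1) = 1 by rewrite -exprMn uV expr1n.
  have shuffle2 (p1 p2 b1 b2 r1 r2 y y' m1 m2 : F) :
    p1 * b1 * b2 * r1 * (p2 * r2 * y * (y' * (m1 * m2))) =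
    (p1 * p2) * (r1 * r2) * (y * y') * (b1 * b2 * m1 * m2) by ring.
  by rewrite shuffle2 ua uc divff // !mul1r.
rewrite big_split /= (reindex_inj rev_ord_inj) /=.
have -> : \prod_(i < k) A (k - (k - i.+1).+1)%N = \prod_(i < k) A i.
  by apply: eq_bigr => i _; congr A; have := ltn_ord i; lia.
have -> : (qfac c ^+ k)^-1 = \prod_(i < k) (qfac c)^-1.
  by rewrite prodr_const card_ord exprVn.
rewrite /morris_value -!big_split /=.
apply: eq_bigr => i _.
have -> : \prod_(l < a) (1 - q ^+ l * q ^+ (i * c).+1) = qfac (i * c + a) / qfac (i * c).
  rewrite qfacD mulrAC divff // mul1r; apply: eq_bigr => l _.
  by rewrite -exprD addnC addSn.
rewrite /A [(a + c.-1 + _)%N]addnC [(a + c.-1)%N]addnC addnA [(a + i * c)%N]addnC.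
rewrite [(c.-1 + i * c)%N]addnC.
by field; rewrite !Q0 !QI0.
Qed.

End Term.

(** The factors [(q z_i)_(c-1)] exclude exponents below [c], and the Dyson product excludes
    exponents too close to each other, so [spaced_values] applies. *)
Lemma qpowers_residue_eq0 a c k (v : 'I_k -> 'I_(size (qpowers (k * c)))) :
  (0 < c)%N -> (morris_poly q c a k).@[fun i => ((qpowers (k * c))`_(v i))^-1] != 0 ->
  forall i, (v i).+1 = ((k - i) * c)%N.
Proof.
move=> c0; set w := fun i => _; rewrite /morris_poly mevalM mulf_eq0 negb_or.
move=> /andP[fac dys].
have vN i : (v i < k * c)%N.
  by rewrite (leq_trans (ltn_ord (v i))) // size_map size_iota.
have wE i : w i = (q ^+ (v i).+1)^-1 by rewrite /w nth_qpowers.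
have quot m m' : (m <= m')%N -> (q ^+ m)^-1 = q ^+ (m' - m) * (q ^+ m')^-1.
  move=> mm'; rewrite -{2}(subnK mm') exprD invfM mulrA mulfV ?mul1r //.
  by rewrite expf_neq0.
apply: (spaced_values c0) => [i|i j ij].
  rewrite vN andbT leqNgt; apply: contra fac => vc.
  have vc' : (v i < c.-1)%N by lia.
  rewrite rmorph_prod (bigD1 i) //= /morris_factor mevalM [X in _ * X * _]rmorph_prod.
  rewrite [X in _ * X * _](bigD1 (Ordinal vc')) //= mevalB meval1 mevalZ mevalXU wE.
  by rewrite mulfV ?expf_neq0 // subrr mul0r mulr0 mul0r.
have [|h1] := leqP ((v j).+1 + c) (v i).+1; first by left.
have [|h2] := ltnP ((v i).+1 + c) (v j).+1; first by right.
case/eqP: dys; have [ji|lt] := leqP (v j).+1 (v i).+1.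
  apply: (@dyson_poly_eq0 F q c k w i j ((v i).+1 - (v j).+1)) => //; first by lia.
  by left; rewrite !wE; apply: quot.
apply: (@dyson_poly_eq0 F q c k w i j ((v j).+1 - (v i).+1).-1) => //; first by lia.
right; rewrite !wE prednK ?subn_gt0 //; apply: quot; exact: ltnW.
Qed.

Lemma exp_le_morris a c k :
  exp_le (fun=> a + c.-1 + 2 * (c * k.-1))%N (morris_poly q c a k).
Proof.
rewrite /morris_poly; apply: exp_leM; last exact: exp_le_dyson.
have fac_le (i : 'I_k) : exp_le (fun v => (i == v) * (a + c.-1))%N (morris_factor q c a i).
  have X_le : exp_le (fun v => (i == v) : nat) ('X_i : {mpoly F[k]}) by apply: exp_leX.
  apply: (exp_leW (b := fun v => \sum_(l < a) (i == v) + \sum_(l < c.-1) (i == v)))%N.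
    by move=> v; rewrite !sum_nat_const !card_ord -mulnDl mulnC.
  apply: exp_leM; apply: exp_le_prod => l _; apply: exp_leB => //.
  - rewrite -[_%:MP]alg_mpolyC; apply: exp_leZ; exact: exp_le1.
  - exact: exp_le1.
  - exact: exp_leZ.
apply: exp_leW (exp_le_prod (fun i _ => fac_le i)) => v.
by rewrite (bigD1 v) //= eqxx mul1n big1 ?addn0 // => i /negPf ->.
Qed.

(* The residue formula at [q, q ^+ c.+1, ..., q ^+ (k.-1 * c).+1], where all
   the residues but one vanish. *)
Theorem morris_identity a c k : (0 < c)%N ->
  @morris_ct F q c a k 1 = morris_value k a c.
Proof.
move=> c0; case: (posnP k) => [->|k0].
  rewrite /morris_ct /morris_value /morris_poly /dyson_poly !big_ord0 !mulr1.
  rewrite mcoeff1; case: eqP => // h; case: h; apply/mnmP; by case.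
pose ys := [seq q ^+ (j * c).+1 | j <- iota 0 k].
have sys : size ys = k by rewrite size_map size_iota.
have gE : grid q c ys = qpowers (k * c) := grid_qpowers c k.
have uq : uniq (qpowers (k * c)).
  rewrite map_inj_uniq ?iota_uniq // => m n /(expr_inj q_neq0 q_expr_neq1).
  by case.
have q0 : 0 \notin qpowers (k * c).
  by apply/negP => /mapP[m _ /esym/eqP]; rewrite (negPf (expf_neq0 _ q_neq0)).
set M := morris_exp c a k; pose R := (a + M + k * M).+1.
have kc0 : (0 < k * c)%N by rewrite muln_gt0 k0.
(* The factor given by [morris_ct_gser] at [ys]. All exponents of [q] in it are positive, so it can
   be cancelled. *)
pose Z := \prod_(d < k) \prod_(l < a) (1 - q ^+ l * q ^+ (d * c).+1).
have Z0 : Z != 0.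
  apply/prodf_neq0 => d _; apply/prodf_neq0 => l _; rewrite -exprD subr_eq0 eq_sym.
  by rewrite q_expr_neq1 // addnS.
have aR : (a < R)%N by rewrite /R; lia.
have := morris_ct_gser q_neq0 q_expr_neq1 c0 sys aR.
have -> : \prod_(y <- ys) \prod_(m < a) (1 - q ^+ m * y) = Z.
  by rewrite /ys big_map big_iota0.
rewrite /morris_ct -/M mulrC => e1; apply: (mulIf Z0); rewrite -{}e1.
have := @gser_residues F k q c ys (morris_poly q c a k) M R.
rewrite gE sys => -> //; try by rewrite /R; lia.
  have v0P (i : 'I_k) : (((k - i) * c).-1 < size (qpowers (k * c)))%N.
    rewrite size_map size_iota prednK ?muln_gt0 ?subn_gt0 ?ltn_ord //.
    by rewrite leq_mul2r leq_subr orbT.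
  pose v0 : {ffun 'I_k -> 'I_(size (qpowers (k * c)))} := [ffun i => Ordinal (v0P i)].
  rewrite (bigD1 v0) //= [X in _ + X]big1 ?addr0 => [|v vv0]; last first.
    have [->|h] := eqVneq (morris_poly q c a k).@[fun i => ((qpowers (k * c))`_(v i))^-1] 0.
      by rewrite mul0r.
    case/eqP: vv0; apply/ffunP => i; apply: val_inj; rewrite ffunE /=.
    by rewrite -(qpowers_residue_eq0 c0 h).
  have v0E i : (qpowers (k * c))`_(v0 i) = ((q ^+ ((k - i) * c))^-1)^-1.
    rewrite invrK ffunE nth_qpowers ?prednK ?muln_gt0 ?subn_gt0 ?ltn_ord //.
    by rewrite leq_mul2r leq_subr orbT.
  rewrite -(residue_term a c0 k0); congr (_ * _).
    by apply: meval_eq => i; rewrite v0E invrK.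
  by apply: eq_bigr => i _; rewrite v0E.
(* The degree bound is again attained: both sides are [a + c.-1 + 2 * (c * k.-1)]. *)
move=> m mp i; apply: leq_trans (exp_le_morris mp i) _; rewrite /M /morris_exp.
have -> : (k * c = c + c * k.-1)%N by rewrite -{1}(prednK k0) mulSn mulnC.
by move: (c * k.-1)%N => x; lia.
Qed.

End MorrisValue.

(** * Formal series and constant terms *)

Section SeriesTheory.

Context (F : fieldType) (n : nat) (k : 'I_n.+1 -> nat) (L : countType).
Notation S := (series F k L).
Notation expo := (expo k L).
Implicit Types (f g : S) (e : expo) (x : F) (u : {ffun zvar k -> int}).

Lemma smulE f g e (X : seq expo) : uniq X ->
  (forall d, f d != 0 -> g (e - d) != 0 -> d \in X) ->
  (f * g) e = \sum_(d <- X) f d * g (e - d).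
Proof. exact: convE. Qed.

Lemma smul_neq0 f g e : (f * g) e != 0 -> exists d, f d != 0 /\ g (e - d) != 0.
Proof. exact: conv_neq0. Qed.

Lemma szeroE e : (0 : S) e = 0. Proof. by []. Qed.
Lemma soneE e : (1 : S) e = (e == 0)%:R. Proof. by rewrite /=; case: eqP. Qed.
Lemma saddE f g e : (f + g) e = f e + g e. Proof. by []. Qed.
Lemma soppE f e : (- f) e = - f e. Proof. by []. Qed.

Lemma scst_mulE x f e : (scst k L x * f) e = x * f e.
Proof.
rewrite (@smulE _ _ _ [:: 0]) //.
  by rewrite big_seq1 /= eqxx subr0.
by move=> d /=; case: ifP => [/eqP ->|]; rewrite ?inE ?eqxx.
Qed.

Lemma zmono_mulE u f e :
  (zmono F L u * f) e = f (e - (u, 0)).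
Proof.
rewrite (@smulE _ _ _ [:: (u, 0)]) //.
  by rewrite big_seq1 /= eqxx mul1r.
by move=> d /natr_bool_neq0 /eqP -> _; rewrite inE.
Qed.

Fact scst_is_zmod_morphism : zmod_morphism (@scst F n k L).
Proof.
move=> x y; apply: seriesP => e; rewrite saddE soppE /=.
by case: ifP => // _; rewrite subrr.
Qed.

Fact scst_is_monoid_morphism : monoid_morphism (@scst F n k L).
Proof.
by split=> // x y; apply: seriesP => e; rewrite scst_mulE /=; case: ifP; rewrite ?mulr0.
Qed.

HB.instance Definition _ := GRing.isZmodMorphism.Build F S (@scst F n k L)
  scst_is_zmod_morphism.
HB.instance Definition _ := GRing.isMonoidMorphism.Build F S (@scst F n k L)
  scst_is_monoid_morphism.

Lemma zmonoD u u' : zmono F L (u + u') = zmono F L u * zmono F L u'.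
Proof.
apply: seriesP => e; rewrite zmono_mulE /= subr_eq; congr (_ == _)%:R.
by rewrite addrC; congr pair; rewrite addr0.
Qed.

Lemma zmono0 : zmono F L (0 : {ffun zvar k -> int}) = 1.
Proof. by apply: seriesP => e; rewrite soneE. Qed.

Lemma zmonoMn u m : zmono F L (u *+ m) = zmono F L u ^+ m.
Proof. by elim: m => [|m IH]; rewrite ?zmono0 // mulrS zmonoD IH exprS. Qed.

Lemma zmono_sum I (r : seq I) (P : pred I) (G : I -> {ffun zvar k -> int}) :
  zmono F L (\sum_(i <- r | P i) G i) = \prod_(i <- r | P i) zmono F L (G i).
Proof.
by apply: (big_ind2 (fun u f => zmono F L u = f)) => [|u f v g <- <-|//];
   [exact: zmono0 | exact: zmonoD].
Qed.

Lemma zv_zinv s (i : 'I_(k s)) : zv F L i * zinv F L i = 1.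
Proof. by rewrite /zv /zinv -zmonoD subrr zmono0. Qed.

Definition zfree (A : pred nat) f : Prop :=
  forall e, f e != 0 -> forall v : zvar k, A (tag v) -> e.1 v = 0.

Section Free.

Variable A : pred nat.

Lemma zfree0 : zfree A 0. Proof. by move=> e; rewrite szeroE eqxx. Qed.

Lemma zfree_scst x : zfree A (scst k L x).
Proof.
move=> e /=; case: ifP => [/eqP -> _ v _|_]; last by rewrite eqxx.
by rewrite /= ffunE.
Qed.

Lemma zfree1 : zfree A 1. Proof. exact: zfree_scst. Qed.

Lemma zfreeD f g : zfree A f -> zfree A g -> zfree A (f + g).
Proof.
move=> hf hg e; rewrite saddE; have [->|fe _] := eqVneq (f e) 0.
  by rewrite add0r; apply: hg.
exact: hf.
Qed.

Lemma zfreeN f : zfree A f -> zfree A (- f).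
Proof. by move=> hf e; rewrite soppE oppr_eq0; apply: hf. Qed.

Lemma zfreeM f g : zfree A f -> zfree A g -> zfree A (f * g).
Proof.
move=> hf hg e /smul_neq0[d [/hf fd /hg gd]] v Av.
by rewrite -[e](subrK d) /= ffunE gd // fd // addr0.
Qed.

Lemma zfree_sum I (r : seq I) (P : pred I) (G : I -> S) :
  (forall i, P i -> zfree A (G i)) -> zfree A (\sum_(i <- r | P i) G i).
Proof. by move=> h; apply: big_ind => //; [exact: zfree0 | exact: zfreeD]. Qed.

Lemma zfree_prod I (r : seq I) (P : pred I) (G : I -> S) :
  (forall i, P i -> zfree A (G i)) -> zfree A (\prod_(i <- r | P i) G i).
Proof. by move=> h; apply: big_ind => //; [exact: zfree1 | exact: zfreeM]. Qed.

Lemma zfreeX f m : zfree A f -> zfree A (f ^+ m).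
Proof. by move=> h; rewrite -[m]card_ord -prodr_const; apply: zfree_prod. Qed.

Lemma zfree_zmono u : (forall v : zvar k, A (tag v) -> u v = 0) -> zfree A (zmono F L u).
Proof. by move=> h e /natr_bool_neq0 /eqP -> v /h. Qed.

Lemma zfree_zexp s (i : 'I_(k s)) : ~~ A s ->
  forall v : zvar k, A (tag v) -> zexp i v = 0.
Proof.
by move=> As v Av; rewrite ffunE; case: eqP => // vE; rewrite vE (negPf As) in Av.
Qed.

Lemma zfree_zv s (i : 'I_(k s)) : ~~ A s -> zfree A (zv F L i).
Proof. by move=> As; apply/zfree_zmono/zfree_zexp. Qed.

Lemma zfree_zinv s (i : 'I_(k s)) : ~~ A s -> zfree A (zinv F L i).
Proof.
by move=> As; apply: zfree_zmono => v /(zfree_zexp i As) h; rewrite ffunE h oppr0.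
Qed.

Lemma zfree_alph X : zfree A (alph F k X).
Proof.
move=> e H; have [l _] := @fsbigN1 _ _ _ _ _ _ (fun e l => letter F k l e) e H.
by move=> /natr_bool_neq0 /eqP -> v _; rewrite ffunE.
Qed.

Lemma zfree_geom (s : 'I_n) (i : 'I_(k (cur s))) (j : 'I_(k (nxt s))) x :
  ~~ A s -> ~~ A s.+1 -> zfree A (geom L i j x).
Proof.
move=> As As1 e H.
have [m _] := @fsbigN1 _ _ _ _ _ _
  (fun e m => ((scst k L x * (zv F L i * zinv F L j)) ^+ m) e) e H.
apply/zfreeX/zfreeM; first exact: zfree_scst.
by apply: zfreeM; [apply: zfree_zv | apply: zfree_zinv; rewrite lift0].
Qed.

Lemma zfree_qpoch (x y : S) m : zfree A x -> zfree A y -> zfree A (qpoch x y m).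
Proof.
move=> hx hy; apply: zfree_prod => l _; apply: zfreeD; first exact: zfree1.
by apply/zfreeN/zfreeM => //; apply: zfreeX.
Qed.

Definition on_zero (e : expo) := [forall v : zvar k, A (tag v) ==> (e.1 v == 0)].

Fact adm_ctA f : exists N, forall e,
  (if on_zero e then f e else 0) != 0 -> admissible N e.
Proof.
have [N Nf] := admP f; exists N => e; case: ifP => _; first exact: Nf.
by rewrite eqxx.
Qed.

(** The constant term in the levels of [A]; [ct] is the case of the levels below [n]. A general [A]
    allows the levels to be treated one by one. *)
Definition ctA f : S := Series (adm_ctA f).

Lemma ctAE f e : ctA f e = if on_zero e then f e else 0. Proof. by []. Qed.

Lemma ctAD f g : ctA (f + g) = ctA f + ctA g.
Proof.
by apply: seriesP => e; rewrite saddE !ctAE saddE; case: ifP => // _; rewrite addr0.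
Qed.

Lemma ctA0 : ctA 0 = 0.
Proof. by apply: seriesP => e; rewrite ctAE !szeroE; case: ifP. Qed.

Lemma ctA_sum I (r : seq I) (P : pred I) (G : I -> S) :
  ctA (\sum_(i <- r | P i) G i) = \sum_(i <- r | P i) ctA (G i).
Proof. by apply: (big_morph ctA ctAD ctA0). Qed.

Lemma ctA_mulfree f g : zfree A f -> ctA (f * g) = f * ctA g.
Proof.
move=> hf; apply: seriesP => e; rewrite ctAE.
have [X [uX HX]] := series_finite f g e.
rewrite (smulE uX HX) (smulE uX); last first.
  move=> d fd; rewrite ctAE; case: ifP => _; last by rewrite eqxx.
  exact: HX.
case: ifP => [e0|/negbT e0]; last rewrite big1 // => d _; last first.
  have [->|fd] := eqVneq (f d) 0; first by rewrite mul0r.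
  rewrite ctAE; case: ifP => [/forallP ed|]; last by rewrite mulr0.
  case/negP: e0; apply/forallP => v; apply/implyP => Av.
  have := implyP (ed v) Av; rewrite /= !ffunE (hf _ fd _ Av) subr0.
  by [].
apply: eq_bigr => d _; have [->|fd] := eqVneq (f d) 0; first by rewrite !mul0r.
rewrite ctAE; case: ifP => // /negP[]; apply/forallP => v; apply/implyP => Av.
by rewrite /= !ffunE (hf _ fd _ Av) (eqP (implyP (forallP e0 v) Av)) subr0.
Qed.

End Free.

Lemma ctA_comp (A B C : pred nat) f : (forall i, C i = A i || B i) ->
  ctA A (ctA B f) = ctA C f.
Proof.
move=> CE; apply: seriesP => e; rewrite !ctAE.
have -> : on_zero C e = on_zero A e && on_zero B e.
  apply/forallP/andP => [h|[/forallP hA /forallP hB] v]; last first.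
    by rewrite CE; apply/implyP => /orP[]; apply/implyP.
  by split; apply/forallP => v; apply/implyP => Av; apply: (implyP (h v));
     rewrite CE Av ?orbT.
by case: ifP.
Qed.

Lemma ctA_eq0 (A : pred nat) f : (forall e, f e != 0 -> ~~ on_zero A e) -> ctA A f = 0.
Proof.
move=> h; apply: seriesP => e; rewrite ctAE szeroE; case: ifP => // e0.
by apply/eqP/negPn/negP => /h; rewrite e0.
Qed.

Lemma geom_inverse (s : 'I_n) (i : 'I_(k (cur s))) (j : 'I_(k (nxt s))) x :
  (1 - scst k L x * (zv F L i * zinv F L j)) * geom L i j x = 1.
Proof.
pose D : expo := (zexp i - zexp j, 0).
have DE m : D *+ m = ((zexp i - zexp j) *+ m, 0).
  by elim: m => [//|m IH]; rewrite !mulrS IH /D; congr pair; rewrite addr0.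
have powE m e : ((scst k L x * (zv F L i * zinv F L j)) ^+ m) e =
    x ^+ m * (e == D *+ m)%:R.
  by rewrite /zv /zinv -zmonoD exprMn -zmonoMn -rmorphXn scst_mulE DE.
(* The two variables of the ratio lie at different levels, so the exponent of the first one
   determines [m], and the multiples of [D] are distinct. *)
have Di m : (D *+ m).1 (Tagged (fun t => 'I_(k t)) i) = m%:Z.
  rewrite DE /= ffunMnE !ffunE eqxx; case: eqP => [ij|_]; last first.
    by rewrite subr0 pmulrn intz.
  have := congr1 (fun v : zvar k => nat_of_ord (tag v)) ij.
  by rewrite /= /bump /=; lia.
have geomE m : geom L i j x (D *+ m) = x ^+ m.
  rewrite /= (fsbigE [:: m]) //.
    by rewrite big_seq_cond big_mkcondr /= -big_seq big_seq1 in_setT powE eqxx mulr1.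
  move=> m' _; rewrite powE; case: eqP => [h|_]; last by rewrite mulr0.
  by have := Di m'; rewrite -h Di => -[->]; rewrite inE eqxx.
have geom0 e : (forall m, e != D *+ m) -> geom L i j x e = 0.
  by move=> h /=; apply: fsbig1 => m _; rewrite powE (negPf (h m)) mulr0.
apply: seriesP => e; rewrite mulrBl mul1r saddE soppE soneE.
rewrite -mulrA scst_mulE /zv /zinv -zmonoD zmono_mulE -/D.
have [[m ->]|ne] := pselect (exists m, e = D *+ m).
  rewrite geomE; case: m => [|m].
    rewrite mulr0n eqxx geom0 ?mulr0 ?subr0 // => m.
    apply/eqP => h; have := Di m.+1; rewrite mulrS -h addrC subrK.
    by rewrite /= ffunE.
  rewrite mulrSr addrK geomE exprS subrr.
  case: eqP => // h; have := Di m.+1; rewrite mulrSr h.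
  by rewrite /= ffunE.
rewrite geom0 => [|m]; last by apply/eqP => h; apply: ne; exists m.
rewrite geom0 ?mulr0 ?subr0 => [|m].
  by case: eqP => // h; case: ne; exists 0%N.
by apply/eqP => /(canRL (subrK _)) h; apply: ne; exists m.+1; rewrite mulrSr.
Qed.

Definition zdeg (s : 'I_n.+1) (e : expo) : int :=
  \sum_(i < k s) e.1 (Tagged (fun t => 'I_(k t)) i).

Lemma zdegD s d e : zdeg s (d + e) = zdeg s d + zdeg s e.
Proof. by rewrite /zdeg -big_split; apply: eq_bigr => i _; rewrite /= ffunE. Qed.

Definition zdeg_ge s (N : int) f : Prop := forall e, f e != 0 -> N <= zdeg s e.

Section Degree.

Variable s : 'I_n.+1.

Lemma zdeg_geD N f g : zdeg_ge s N f -> zdeg_ge s N g -> zdeg_ge s N (f + g).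
Proof.
move=> hf hg e; rewrite saddE; have [->|fe _] := eqVneq (f e) 0.
  by rewrite add0r; apply: hg.
exact: hf.
Qed.

Lemma zdeg_geN N f : zdeg_ge s N f -> zdeg_ge s N (- f).
Proof. by move=> hf e; rewrite soppE oppr_eq0; apply: hf. Qed.

Lemma zdeg_geM N M f g :
  zdeg_ge s N f -> zdeg_ge s M g -> zdeg_ge s (N + M) (f * g).
Proof.
move=> hf hg e /smul_neq0[d [/hf fd /hg gd]].
by rewrite -[e](subrK d) zdegD addrC lerD.
Qed.

Lemma zdeg_ge_free f : zfree (pred1 (s : nat)) f -> zdeg_ge s 0 f.
Proof.
move=> hf e fe; rewrite /zdeg big1 // => i _.
by rewrite (hf e fe) //= eqxx.
Qed.

Lemma zdeg_ge_zmono u : zdeg_ge s (zdeg s (u, 0)) (zmono F L u).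
Proof. by move=> e /natr_bool_neq0 /eqP ->. Qed.

Lemma zdeg_zexp (i : 'I_(k s)) : zdeg s (zexp i, 0) = 1.
Proof.
rewrite /zdeg (bigD1 i) //= ffunE eqxx big1 ?addr0 // => j /negPf ji.
by rewrite ffunE eq_Tagged /= ji.
Qed.

Lemma zdeg_filtration : filtration (fun N : nat => zdeg_ge s N).
Proof.
split=> [N e||N f g hf hg|M N f g hf hg|M N f MN hf e fe].
- by rewrite szeroE eqxx.
- exact/zdeg_ge_free/zfree1.
- by apply: zdeg_geD => //; apply: zdeg_geN.
- by rewrite PoszD; apply: zdeg_geM.
by apply: le_trans (hf e fe); rewrite lez_nat.
Qed.

Lemma ctA_zdeg_gt0 N f : 0 < N -> zdeg_ge s N f -> ctA (pred1 (s : nat)) f = 0.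
Proof.
move=> N0 hf; apply: ctA_eq0 => e /hf ze; apply/negP => /forallP e0.
have : zdeg s e = 0.
  by rewrite /zdeg big1 // => i _; apply/eqP/(implyP (e0 _)); rewrite /= eqxx.
by move=> e1; rewrite e1 leNgt N0 in ze.
Qed.

End Degree.

End SeriesTheory.

(** * The constant term at one level *)

Section Level.

Context (F : fieldType) (q : F) (q_neq0 : q != 0).
Hypothesis q_expr_neq1 : forall i, (0 < i)%N -> q ^+ i != 1.
Context (n : nat) (k : 'I_n.+1 -> nat) (L : countType).
Context (a c : nat) (c_gt0 : (0 < c)%N) (s : 'I_n).

Notation S := (series F k L).
Notation ks := (k (cur s)).
Notation ls := (k (nxt s)).
Notation cst := (@scst F n k L).
Notation z i := (@zv F n k L (cur s) i).
Notation z' i := (@zinv F n k L (cur s) i).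
Notation w' j := (@zinv F n k L (nxt s) j).
Notation lvl := (pred1 (s : nat)).

Definition zpoly (p : {mpoly F[ks]}) : S := mmap cst (fun i => z i) p.

Fact zpoly_is_zmod_morphism : zmod_morphism zpoly.
Proof. by move=> p p'; rewrite /zpoly mmapD mmapN. Qed.

Fact zpoly_is_monoid_morphism : monoid_morphism zpoly.
Proof.
split; first by rewrite /zpoly -mpolyC1 mmapC.
by move=> p p'; rewrite /zpoly rmorphM.
Qed.

HB.instance Definition _ := GRing.isZmodMorphism.Build {mpoly F[ks]} S zpoly
  zpoly_is_zmod_morphism.
HB.instance Definition _ := GRing.isMonoidMorphism.Build {mpoly F[ks]} S zpoly
  zpoly_is_monoid_morphism.

Lemma zpolyX i : zpoly 'X_i = z i.
Proof. by rewrite /zpoly mmapX mmap1U. Qed.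

Lemma zpolyC x : zpoly x%:MP = cst x.
Proof. exact: mmapC. Qed.

Lemma zpolyZ x p : zpoly (x *: p) = cst x * zpoly p.
Proof. exact: mmapZ. Qed.

Lemma zpolyM p p' : zpoly (p * p') = zpoly p * zpoly p'.
Proof. exact: rmorphM. Qed.

Lemma zpolyB p p' : zpoly (p - p') = zpoly p - zpoly p'.
Proof. exact: rmorphB. Qed.

Lemma zpoly1 : zpoly 1 = 1.
Proof. exact: rmorph1. Qed.

Lemma zpoly_prod I (r : seq I) (P : pred I) (G : I -> {mpoly F[ks]}) :
  zpoly (\prod_(i <- r | P i) G i) = \prod_(i <- r | P i) zpoly (G i).
Proof. exact: rmorph_prod. Qed.

Lemma zpoly_sum I (r : seq I) (P : pred I) (G : I -> {mpoly F[ks]}) :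
  zpoly (\sum_(i <- r | P i) G i) = \sum_(i <- r | P i) zpoly (G i).
Proof. exact: rmorph_sum. Qed.

Definition zinvs M : S := \prod_(i < ks) z' i ^+ M.

(** The passage from constant terms of formal series to coefficients of polynomials, through which
    [morris_ct] enters. *)
Lemma ct_zinvs_zpoly M p :
  ctA lvl (zinvs M * zpoly p) = cst p@_(const_mnm ks M).
Proof.
pose u (m : 'X_{1..ks}) : {ffun zvar k -> int} :=
  \sum_(i < ks) (- zexp i *+ M + zexp i *+ m i).
have zX m : zinvs M * zpoly 'X_[m] = zmono F L (u m).
  rewrite /zpoly mmapX /zinvs /mmap1 -big_split zmono_sum; apply: eq_bigr => i _.
  by rewrite zmonoD !zmonoMn.
have uE m i : u m (Tagged (fun t => 'I_(k t)) i) = (m i)%:Z - M%:Z.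
  rewrite /u sum_ffunE (bigD1 i) //= big1 ?addr0; last first.
    move=> j ji; rewrite ffunE !ffunMnE !ffunE eq_Tagged /= eq_sym (negPf ji).
    by rewrite oppr0 !mul0rn addr0.
  by rewrite ffunE !ffunMnE !ffunE eqxx mulNrn !pmulrn !intz addrC.
have ctX m : ctA lvl (zinvs M * zpoly 'X_[m]) = cst (m == const_mnm ks M)%:R.
  rewrite zX; case: eqP => [->|mM].
    have -> : u (const_mnm ks M) = 0.
      by rewrite /u big1 // => i _; rewrite mnmE mulNrn addNr.
    rewrite zmono0 -[1 in LHS]mulr1 ctA_mulfree; last exact: zfree1.
    rewrite mul1r rmorph1; apply: seriesP => e; rewrite ctAE soneE; case: ifP => // h.
    case: eqP => // e0; case/negP: h; rewrite e0; apply/forallP => v.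
    by apply/implyP; rewrite ffunE.
  rewrite rmorph0; apply: ctA_eq0 => e /natr_bool_neq0 /eqP ->; apply/negP => /forallP h.
  apply: mM; apply/mnmP => i; rewrite mnmE.
  have := implyP (h (Tagged (fun t => 'I_(k t)) i)); rewrite /= eqxx => /(_ isT).
  by rewrite uE subr_eq0 => /eqP [].
rewrite {1}[p]mpolyE rmorph_sum mulr_sumr ctA_sum [p in RHS]mpolyE raddf_sum /=.
rewrite rmorph_sum; apply: eq_bigr => m _.
rewrite zpolyZ mulrCA ctA_mulfree; last exact: zfree_scst.
by rewrite ctX mcoeffZ mcoeffX rmorphM.
Qed.

Notation M := (morris_exp c a ks).
Notation I1 := (@morris_ct F q c a ks 1).

Definition morris_weight : S := zinvs M * zpoly (morris_poly q c a ks).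

Definition level_ct (f : S) : S := ctA lvl (f * morris_weight).

Lemma level_ctD f g : level_ct (f + g) = level_ct f + level_ct g.
Proof. by rewrite /level_ct mulrDl ctAD. Qed.

Lemma level_ct_free u f : zfree lvl u -> level_ct (u * f) = u * level_ct f.
Proof. by move=> hu; rewrite /level_ct -mulrA ctA_mulfree. Qed.

Lemma level_ct_zpoly p : level_ct (zpoly p) = cst (@morris_ct F q c a ks p).
Proof.
by rewrite /level_ct /morris_weight mulrCA -rmorphM ct_zinvs_zpoly.
Qed.

(* [f] and [fbar] are the values of a symmetric function of degree at most [d]
   at the variables of level [s], and at the alphabet [(q ^ a - 1) / (1 - q ^ c)]. *)
Definition evaluates d (f fbar : S) : Prop :=
  forall rs, (size rs + d <= ks)%N ->
    level_ct (f * zpoly (\prod_(r <- rs) gfun ks q c r)) =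
    fbar * cst ((\prod_(r <- rs) qpoch_coef q a r) * I1).

Lemma evaluates1 : evaluates 0 1 1.
Proof.
move=> rs; rewrite addn0 => rsk; rewrite !mul1r level_ct_zpoly.
by rewrite (morris_ct_gfun q_neq0 q_expr_neq1 a c_gt0) // mulrC.
Qed.

Lemma evaluatesW d d' f fbar : (d <= d')%N -> evaluates d f fbar -> evaluates d' f fbar.
Proof.
by move=> dd' h rs rsk; apply: h; apply: leq_trans rsk; rewrite leq_add2l.
Qed.

Lemma evaluatesD d f fbar g gbar : evaluates d f fbar -> evaluates d g gbar ->
  evaluates d (f + g) (fbar + gbar).
Proof. by move=> hf hg rs rsk; rewrite !mulrDl level_ctD hf ?hg. Qed.

Lemma evaluates0 d : evaluates d 0 0.
Proof.
move=> rs _; rewrite !mul0r /level_ct mul0r.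
exact: ctA0.
Qed.

Lemma evaluates_free d u f fbar : zfree lvl u -> evaluates d f fbar ->
  evaluates d (u * f) (u * fbar).
Proof. by move=> hu hf rs rsk; rewrite -!mulrA level_ct_free // hf. Qed.

Lemma evaluates_scst d x f fbar : evaluates d f fbar ->
  evaluates d (cst x * f) (cst x * fbar).
Proof. by apply: evaluates_free; apply: zfree_scst. Qed.

Lemma evaluates_sum d I (r : seq I) (P : pred I) (f fbar : I -> S) :
  (forall i, P i -> evaluates d (f i) (fbar i)) ->
  evaluates d (\sum_(i <- r | P i) f i) (\sum_(i <- r | P i) fbar i).
Proof.
move=> h; apply: (big_ind2 (evaluates d)) => //; first exact: evaluates0.
by move=> *; apply: evaluatesD.
Qed.

(** The function [g_r] is put at the head of the list [rs], which uses one of the [ks] available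
    factors. *)
Lemma evaluates_gfun d r f fbar : evaluates d f fbar ->
  evaluates d.+1 (f * zpoly (gfun ks q c r)) (fbar * cst (qpoch_coef q a r)).
Proof.
move=> h rs rsk; have := h (r :: rs); rewrite /= addSnnS => /(_ rsk).
by rewrite !big_cons !rmorphM !mulrA.
Qed.

Definition zpsum r : S := \sum_(i < ks) z i ^+ r.

(** [p_r] of the alphabet [(q^a - 1) / (1 - q^c)]. *)
Definition eps r : F := (q ^+ (a * r) - 1) / (1 - q ^+ (c * r)).

(** [p_r] of [(1 - q^c) / (1 - q)], the ratio between the power sums of [letters] and those of the
    variables. *)
Definition kappa r : F := \sum_(l < c) (q ^+ r) ^+ l.

Lemma kappa_mul r : kappa r * (1 - q ^+ r) = 1 - q ^+ (c * r).
Proof. by rewrite /kappa -opprB mulrN mulrC -subrX1 opprB -exprM mulnC. Qed.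

Lemma power_sum_letters r :
  power_sum (letters ks q c) r = kappa r *: \sum_(i < ks) 'X_i ^+ r.
Proof.
rewrite /power_sum /letters big_allpairs_dep big_enum scaler_sumr /=.
apply: eq_bigr => i _; rewrite big_iota0 scaler_suml; apply: eq_bigr => l _.
by rewrite exprZn -!exprM mulnC.
Qed.

(** The product of the two alphabets is [(q^a - 1) / (1 - q)], the negative of
    [1 + q + ... + q^(a-1)]. *)
Lemma kappa_eps r : (0 < r)%N ->
  kappa r * eps r = - power_sum [seq q ^+ m | m <- iota 0 a] r.
Proof.
move=> r0; have qr0 : 1 - q ^+ r != 0 by rewrite subr_eq0 eq_sym q_expr_neq1.
have qcr0 : 1 - q ^+ (c * r) != 0.
  by rewrite subr_eq0 eq_sym q_expr_neq1 // muln_gt0 c_gt0.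
rewrite /power_sum big_map big_iota0; apply: (mulfI qr0).
rewrite mulrA [_ * kappa r]mulrC kappa_mul /eps mulrCA mulfV // mulr1.
rewrite mulrN -mulNr opprB; under eq_bigr => m _ do rewrite exprAC.
by rewrite -subrX1 -exprM mulnC.
Qed.

Lemma kappa_neq0 r : (0 < r)%N -> kappa r != 0.
Proof.
move=> r0; apply/eqP => k0; have := kappa_mul r; rewrite k0 mul0r => /esym/eqP.
by rewrite subr_eq0 eq_sym (negPf (q_expr_neq1 _)) // muln_gt0 c_gt0.
Qed.

(* Newton's identities express [p_r] through [g_r] and products of [p_i] and
   [g_(r - i)] for [i < r], for both evaluations. *)
Lemma evaluates_psum d r f fbar : (0 < r)%N -> evaluates d f fbar ->
  evaluates (d + r) (f * zpsum r) (fbar * cst (eps r)).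
Proof.
elim/ltn_ind: r d f fbar => -[//|r] IH d f fbar _ hf.
have zp m : zpoly (power_sum (letters ks q c) m) = cst (kappa m) * zpsum m.
  rewrite power_sum_letters zpolyZ [zpoly (\sum_(i < ks) _)]rmorph_sum; congr (_ * _); apply: eq_bigr => i _.
  by rewrite rmorphXn /= zpolyX.
have n1 : r.+1%:R * zpoly (gfun ks q c r.+1) =
    \sum_(i < r) cst (kappa i.+1) * zpsum i.+1 * zpoly (gfun ks q c (r.+1 - i.+1)) +
    cst (kappa r.+1) * zpsum r.+1.
  transitivity (zpoly (r.+1%:R * gfun ks q c r.+1)).
    by rewrite zpolyM; congr (_ * _); rewrite [RHS]rmorph_nat.
  rewrite /gfun newton_hsym zpoly_sum big_ord_recr /= subnn hsym0 mulr1 zp.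
  by congr (_ + _); apply: eq_bigr => i _; rewrite zpolyM zp.
(* By [kappa_eps] this is the recursion [n1], with [g_r] replaced by [qpoch_coef] and the power sum
   of the variables by [eps]. *)
have n2 := newton_esym_alt [seq q ^+ m | m <- iota 0 a] r.+1.
rewrite big_ord_recr /= subnn esym_alt0 mulr1 -/(qpoch_coef q a r.+1) in n2.
have -> : f * zpsum r.+1 = cst (kappa r.+1)^-1 *
    (cst r.+1%:R * (f * zpoly (gfun ks q c r.+1)) + \sum_(i < r) cst (- kappa i.+1) *
      ((f * zpsum i.+1) * zpoly (gfun ks q c (r.+1 - i.+1)))).
  have -> : cst r.+1%:R * (f * zpoly (gfun ks q c r.+1)) =
      f * (r.+1%:R * zpoly (gfun ks q c r.+1)) by rewrite rmorph_nat mulrCA.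
  have -> : \sum_(i < r) cst (- kappa i.+1) *
        ((f * zpsum i.+1) * zpoly (gfun ks q c (r.+1 - i.+1))) =
      - (f * \sum_(i < r) cst (kappa i.+1) * zpsum i.+1 *
          zpoly (gfun ks q c (r.+1 - i.+1))).
    by rewrite mulr_sumr -sumrN; apply: eq_bigr => i _; rewrite rmorphN; ring.
  rewrite n1 [f * (_ + _)]mulrDr addrAC subrr add0r [RHS]mulrCA; congr (_ * _).
  by rewrite mulrA -rmorphM mulVf ?kappa_neq0 // rmorph1 mul1r.
have -> : fbar * cst (eps r.+1) = cst (kappa r.+1)^-1 *
    (cst r.+1%:R * (fbar * cst (qpoch_coef q a r.+1)) + \sum_(i < r) cst (- kappa i.+1) *
      ((fbar * cst (eps i.+1)) * cst (qpoch_coef q a (r.+1 - i.+1)))).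
  have eE : eps r.+1 = (kappa r.+1)^-1 * (r.+1%:R * qpoch_coef q a r.+1 +
      \sum_(i < r) - kappa i.+1 * eps i.+1 * qpoch_coef q a (r.+1 - i.+1)).
    rewrite n2; under [X in _ + X]eq_bigr => i _ do rewrite mulNr kappa_eps // opprK.
    by rewrite opprD addrAC addNr add0r -kappa_eps // mulrA mulVf ?kappa_neq0 // mul1r.
  rewrite eE rmorphM rmorphD rmorphM rmorph_sum mulrCA /=; congr (_ * _).
  rewrite mulrDr mulr_sumr; congr (_ + _); first by rewrite mulrCA.
  by apply: eq_bigr => i _; rewrite !rmorphM; ring.
apply/evaluates_scst/evaluatesD.
  by apply/evaluates_scst/(@evaluatesW d.+1); [rewrite addnS ltnS leq_addr | apply: evaluates_gfun].
apply: evaluates_sum => i _; apply: evaluates_scst.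
(* The power sum costs [i.+1] and the function [g] costs one more, at most [r.+1] in total as
   [i < r]. *)
apply: (@evaluatesW (d + i.+1).+1); first by rewrite -addnS leq_add2l; have := ltn_ord i; lia.
by apply: evaluates_gfun; apply: IH => //; rewrite ltnS ltn_ord.
Qed.

Lemma evaluates_linear d r u v f fbar : (0 < r)%N -> zfree lvl u -> zfree lvl v ->
  evaluates d f fbar ->
  evaluates (d + r) (f * (zpsum r * u + v)) (fbar * (cst (eps r) * u + v)).
Proof.
move=> r0 hu hv hf.
have -> : f * (zpsum r * u + v) = u * (f * zpsum r) + v * f by ring.
have -> : fbar * (cst (eps r) * u + v) = u * (fbar * cst (eps r)) + v * fbar by ring.
apply: evaluatesD; first exact/evaluates_free/evaluates_psum.
by apply: evaluates_free => //; apply: evaluatesW hf; apply: leq_addr.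
Qed.

Lemma evaluates_linearX d r u v m f fbar :
  (0 < r)%N -> zfree lvl u -> zfree lvl v -> evaluates d f fbar ->
  evaluates (d + m * r) (f * (zpsum r * u + v) ^+ m) (fbar * (cst (eps r) * u + v) ^+ m).
Proof.
move=> r0 hu hv hf; elim: m => [|m IH]; first by rewrite addn0 !mulr1.
by rewrite mulSn [(r + _)%N]addnC addnA !exprSr !mulrA; apply: evaluates_linear.
Qed.

Lemma zfree_w' j : zfree lvl (w' j).
Proof. by apply: zfree_zinv; rewrite /= /bump /=; lia. Qed.

Lemma zdeg_ge_zv (i : 'I_ks) : zdeg_ge (cur s) 1 (z i).
Proof. by rewrite -(zdeg_zexp L i); apply: zdeg_ge_zmono. Qed.

Lemma zdeg_ge_zinv (i : 'I_ks) : zdeg_ge (cur s) (-1) (z' i).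
Proof.
have -> : -1 = zdeg (cur s) ((- zexp i, 0) : expo k L).
  rewrite -(@zdeg_zexp n k L _ i) /zdeg -sumrN.
  by apply: eq_bigr => j _; rewrite /= [RHS]ffunE.
exact: zdeg_ge_zmono.
Qed.

Lemma zdeg_ge_prod_const I (r : seq I) (P : pred I) (G : I -> S) :
  (forall i, P i -> zdeg_ge (cur s) 0 (G i)) ->
  zdeg_ge (cur s) 0 (\prod_(i <- r | P i) G i).
Proof.
move=> h; apply: big_ind => //; first exact/zdeg_ge_free/zfree1.
by move=> f g hf hg; rewrite -[0]addr0; apply: zdeg_geM.
Qed.

Lemma zdeg_ge_zpoly p : zdeg_ge (cur s) 0 (zpoly p).
Proof.
have [h0 h1 hB hM hW] := zdeg_filtration F k L (cur s).
rewrite /zpoly /mmap; apply: (@filtration_sum _ _ (zdeg_filtration F k L (cur s)) _ _ _ _ 0%N) => m _.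
apply: (hM 0%N 0%N); first exact/zdeg_ge_free/zfree_scst.
apply: zdeg_ge_prod_const => i _; apply: (hW 0%N (m i)) => //.
by apply: (filtration_exp (zdeg_filtration F k L (cur s))); apply: zdeg_ge_zv.
Qed.

Lemma zdeg_ge_zinvs m : zdeg_ge (cur s) (- (ks * m)%N%:Z) (zinvs m).
Proof.
have pow i e : zdeg_ge (cur s) (- e%:Z) (z' i ^+ e).
  elim: e => [|e IH]; first exact/zdeg_ge_free/zfree1.
  by rewrite exprS -add1n PoszD opprD; apply: zdeg_geM => //; apply: zdeg_ge_zinv.
rewrite /zinvs -[ks in (ks * m)%N]card_ord -sum_nat_const.
apply: (big_ind2 (fun f N => zdeg_ge (cur s) (- (Posz N)) f)) => //.
- exact/zdeg_ge_free/zfree1.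
- by move=> f N g N' hf hg; rewrite PoszD opprD; apply: zdeg_geM.
Qed.

Definition inv_poch_gen (i : 'I_ks) (j : 'I_ls) : S := \prod_(l < c) geom L i j (q ^+ l).

Definition gtrunc R (j : 'I_ls) : S := \sum_(r < R) w' j ^+ r * zpoly (gfun ks q c r).

Lemma zdeg_ge_geom (i : 'I_ks) (j : 'I_ls) (x : F) : zdeg_ge (cur s) 0 (geom L i j x).
Proof.
move=> e H; have [m _] := @fsbigN1 _ _ _ _ _ _
  (fun e m => ((cst x * (z i * w' j)) ^+ m) e) e H.
have [_ _ _ hM hW] := zdeg_filtration F k L (cur s).
apply: (hW 0%N m) => //; apply: (filtration_exp (zdeg_filtration F k L (cur s))).
apply: (hM 0%N 1%N); first exact/zdeg_ge_free/zfree_scst.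
by apply: (hM 1%N 0%N); [apply: zdeg_ge_zv | exact/zdeg_ge_free/zfree_w'].
Qed.

(* Truncating the expansion of the denominators only changes terms of positive
   degree in the variables of level [s]. *)
Lemma zdeg_ge_trunc R : zdeg_ge (cur s) R%:Z
  (\prod_(j < ls) \prod_(i < ks) inv_poch_gen i j - \prod_(j < ls) gtrunc R j).
Proof.
have filt := zdeg_filtration F k L (cur s); have [h0 h1 hB hM hW] := filt.
have free0 (f : S) : zfree lvl f -> zdeg_ge (cur s) 0 f.
  exact: (@zdeg_ge_free F n k L (cur s) f).
pose A j : S := \prod_(i < ks) \prod_(l < c) (1 - cst (q ^+ l) * (z i * w' j)).
have gtrunc0 j : zdeg_ge (cur s) 0 (gtrunc R j).
  apply: (@filtration_sum _ _ filt _ _ _ _ 0%N) => r _; apply: (hM 0%N 0%N).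
    exact/free0/zfreeX/zfree_w'.
  exact: zdeg_ge_zpoly.
apply: (filtration_inverse_unique filt (a := \prod_(j < ls) A j)).
- apply: zdeg_ge_prod_const => j _; apply: zdeg_ge_prod_const => i _.
  by apply: zdeg_ge_prod_const => l _; apply: zdeg_ge_geom.
- exact: zdeg_ge_prod_const.
- rewrite -big_split big1 => [|j _]; first by rewrite subrr; apply: h0.
  rewrite /A -big_split big1 // => i _ /=; rewrite -big_split big1 // => l _ /=.
  exact: geom_inverse.
apply: (filtration_inverse_prod filt) => j _.
have := hsym_inverse (s := [seq w' j * x | x <- map zpoly (letters ks q c)]) filt R.
have -> : \prod_(x <- [seq w' j * x | x <- map zpoly (letters ks q c)]) (1 - x) = A j.
  rewrite big_map big_map /letters big_allpairs_dep big_enum /=.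
  apply: eq_bigr => i _; rewrite big_iota0; apply: eq_bigr => l _.
  by rewrite zpolyZ zpolyX; congr (1 - _); ring.
have -> : \sum_(r < R) hsym [seq w' j * x | x <- map zpoly (letters ks q c)] r =
    gtrunc R j.
  by apply: eq_bigr => r _; rewrite hsym_scale -rmorph_hsym.
apply=> _ /mapP[_ /mapP[_ /allpairsP[[i l] /= [_ _ ->]] ->] ->].
apply: (hM 0%N 1%N); first exact/free0/zfree_w'.
rewrite zpolyZ zpolyX; apply: (hM 0%N 1%N); first exact/free0/zfree_scst.
exact: zdeg_ge_zv.
Qed.

Notation qS := (cst q).

(** The integrand of one level without the product of the [(1 / z_i)_a], which is supplied by the
    previous level except at the first one. *)
Definition level_kernel : S :=
  (\prod_(i < ks) qpoch qS (qS * z i) c.-1) *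
  (\prod_(i < ks) \prod_(j < ks | (i < j)%N)
     (qpoch qS (z i * z' j) c * qpoch qS (qS * (z j * z' i)) c)) *
  (\prod_(j < ls) \prod_(i < ks) inv_poch_gen i j).

(** Each of the [ks.-1] pairs containing [i] absorbs [c] of the inverse powers of [z i], and
    [(1 / z i)_a] absorbs the remaining [a]. *)
Lemma morris_weightE : morris_weight = (\prod_(i < ks) qpoch qS (z' i) a) *
  ((\prod_(i < ks) qpoch qS (qS * z i) c.-1) *
   (\prod_(i < ks) \prod_(j < ks | (i < j)%N)
     (qpoch qS (z i * z' j) c * qpoch qS (qS * (z j * z' i)) c))).
Proof.
have zz i : z' i * z i = 1 by rewrite mulrC zv_zinv.
have cstX m : cst (q ^+ m) = qS ^+ m by rewrite rmorphXn.
rewrite mulrA -big_split /= /morris_weight /morris_poly zpolyM.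
have -> : zinvs M = (\prod_(i < ks) z' i ^+ a) *
    \prod_(i < ks) \prod_(j < ks | (i < j)%N) (z' i * z' j) ^+ c.
  under [X in _ * X]eq_bigr => i _ do rewrite prodrXl.
  rewrite [X in _ * X]prodrXl prod_pairs_expr -prodrXl -big_split; apply: eq_bigr => i _ /=.
  by rewrite -exprM exprD mulnC.
rewrite mulrACA; congr (_ * _).
  rewrite zpoly_prod -big_split; apply: eq_bigr => i _ /=.
  rewrite /morris_factor zpolyM !zpoly_prod mulrA; congr (_ * _).
    rewrite /qpoch -[X in z' i ^+ X]card_ord -prodr_const -big_split.
    apply: eq_bigr => l _ /=; rewrite zpolyB zpolyX zpolyC cstX mulrBr zz.
    by [].
  apply: eq_bigr => l _; rewrite zpolyB zpoly1 zpolyZ zpolyX cstX exprS.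
  by congr (1 - _); ring.
rewrite /dyson_poly zpoly_prod -big_split; apply: eq_bigr => i _ /=.
rewrite zpoly_prod -big_split; apply: eq_bigr => j _ /=.
rewrite zpoly_prod -[X in _ ^+ X]card_ord -prodr_const -!big_split /=.
apply: eq_bigr => l _; rewrite zpolyM !zpolyB !zpolyZ !zpolyX !cstX exprS.
have -> : 1 - z i * z' j * qS ^+ l = z' j * (z j - qS ^+ l * z i).
  by rewrite mulrBr zz; congr (1 - _); ring.
have -> : 1 - qS * (z j * z' i) * qS ^+ l = z' i * (z i - qS * qS ^+ l * z j).
  by rewrite mulrBr zz; congr (1 - _); ring.
by ring.
Qed.

Lemma level_identity d f fbar : (d + ls <= ks)%N -> zdeg_ge (cur s) 0 f ->
  evaluates d f fbar ->
  ctA lvl (f * (\prod_(i < ks) qpoch qS (z' i) a) * level_kernel) =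
  fbar * cst I1 * \prod_(j < ls) qpoch qS (w' j) a.
Proof.
(* [R] exceeds [ks * M], so replacing [B] by [T] leaves an error of positive degree, and it exceeds
   [a], so the sum over [r < R] contains all of [(w' j)_a]. *)
move=> dk f0 hf; pose R := (a + ks * M).+1.
set B := \prod_(j < ls) \prod_(i < ks) inv_poch_gen i j.
set T := \prod_(j < ls) gtrunc R j.
have -> : f * (\prod_(i < ks) qpoch qS (z' i) a) * level_kernel =
    T * f * morris_weight + (f * morris_weight) * (B - T).
  by rewrite morris_weightE /level_kernel -/B; ring.
rewrite ctAD [X in _ + X](@ctA_zdeg_gt0 _ _ _ _ (cur s) 1) //; last first.
  have h := zdeg_geM (zdeg_geM f0 (zdeg_geM (@zdeg_ge_zinvs M)
    (@zdeg_ge_zpoly (morris_poly q c a ks)))) (@zdeg_ge_trunc R).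
  by move=> e /h; apply: le_trans; rewrite add0r addr0 /R; lia.
rewrite addr0 -/(level_ct _).
(* Each term has [ls] functions [g_r], within the limit of [evaluates] since [d + ls <= ks]. *)
have -> : T = \sum_(r : {ffun 'I_ls -> 'I_R}) (\prod_(j < ls) w' j ^+ r j) *
    zpoly (\prod_(e <- [seq (r j : nat) | j <- enum 'I_ls]) gfun ks q c e).
  rewrite /T /gtrunc bigA_distr_bigA /=; apply: eq_bigr => r _.
  by rewrite big_split /= big_map big_enum rmorph_prod.
rewrite mulr_suml /level_ct mulr_suml ctA_sum.
transitivity (\sum_(r : {ffun 'I_ls -> 'I_R}) fbar * cst I1 *
    \prod_(j < ls) (cst (qpoch_coef q a (r j)) * w' j ^+ r j)).
  apply: eq_bigr => r _; rewrite -/(level_ct _) -mulrA level_ct_free; last first.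
    by apply: zfree_prod => j _; apply/zfreeX/zfree_w'.
  rewrite [zpoly _ * f]mulrC hf; last by rewrite size_map size_enum_ord addnC.
  by rewrite big_map big_enum rmorphM rmorph_prod big_split /=; ring.
rewrite -mulr_sumr -(bigA_distr_bigA (fun (j : 'I_ls) (r : 'I_R) =>
  cst (qpoch_coef q a r) * w' j ^+ r)) /=; congr (_ * _); apply: eq_bigr => j _.
have aR : (a < R)%N by rewrite /R; lia.
transitivity (\sum_(r < R) esym_alt [seq qS ^+ m | m <- iota 0 a] r * w' j ^+ r).
  apply: eq_bigr => r _; congr (_ * _); rewrite rmorph_esym_alt -map_comp.
  by congr esym_alt; apply: eq_map => m /=; rewrite rmorphXn.
rewrite -prod_esym_alt ?size_map ?size_iota // big_map big_iota0.
by apply: eq_bigr => m _; rewrite mulrC.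
Qed.

End Level.

(** * Plethysm *)

Lemma fraction_repr (R : idomainType) (x : {fraction R}) :
  x * FracField.tofrac \d_(repr x) = FracField.tofrac \n_(repr x).
Proof.
have := reprK x; move: (repr x) => y <-.
unlock FracField.tofrac; rewrite -[LHS]FracField.pi_mul.
apply/eqmodP; rewrite /= FracField.equivfE /FracField.mulf.
by rewrite !numden_Ratio ?mulf_neq0 ?denom_ratioP ?oner_eq0 // !mulr1 mulrC.
Qed.

Section QAdams.

Variables (r : nat) (r_gt0 : (0 < r)%N).

Lemma comp_polyXr_neq0 (p : {poly rat}) : p != 0 -> tfrac (p \Po 'X^r) != 0.
Proof.
by move=> p0; rewrite /tfrac tofrac_eq0 comp_poly_eq0 // size_polyXn ltnS.
Qed.

(** Substituting [q^r] preserves cross-multiplied equalities and nonzero denominators, so the result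
    does not depend on the representative chosen by [repr]. *)
Lemma qadams_frac (p d : {poly rat}) : d != 0 ->
  qadams r (tfrac p / tfrac d) = tfrac (p \Po 'X^r) / tfrac (d \Po 'X^r).
Proof.
move=> d0; rewrite /qadams; set x := tfrac p / tfrac d.
have dx : \d_(repr x) != 0 by apply: denom_ratioP.
have td0 : tfrac d != 0 by rewrite /tfrac tofrac_eq0.
have e1 : \n_(repr x) * d = p * \d_(repr x).
  apply/eqP; rewrite -tofrac_eq !tofracM; apply/eqP.
  rewrite -(fraction_repr x) mulrAC; congr (_ * _).
  by rewrite /x mulfVK.
apply/eqP; rewrite eqr_div ?comp_polyXr_neq0 // /tfrac -!tofracM -!comp_polyM e1.
by rewrite mulrC.
Qed.

Lemma fraction_exists (x : Qq) : exists p d : {poly rat},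
  d != 0 /\ x = tfrac p / tfrac d.
Proof.
exists \n_(repr x), \d_(repr x); split; first exact: denom_ratioP.
rewrite /tfrac -fraction_repr mulfK // tofrac_eq0; exact: denom_ratioP.
Qed.

Lemma qadams1 : qadams r 1 = 1.
Proof.
have := @qadams_frac 1 1 (oner_neq0 _).
have -> : (1 : {poly rat}) \Po 'X^r = 1 by rewrite -polyC1 comp_polyC.
by rewrite /tfrac tofrac1 divr1.
Qed.

Lemma qadamsM x y : qadams r (x * y) = qadams r x * qadams r y.
Proof.
have [p [d [d0 ->]]] := fraction_exists x; have [p' [d' [d'0 ->]]] := fraction_exists y.
have -> : tfrac p / tfrac d * (tfrac p' / tfrac d') = tfrac (p * p') / tfrac (d * d').
  by rewrite mulf_div /tfrac !tofracM.
rewrite !qadams_frac ?mulf_neq0 // !comp_polyM mulf_div /tfrac.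
by rewrite !tofracM.
Qed.

Lemma qadamsB x y : qadams r (x - y) = qadams r x - qadams r y.
Proof.
have [p [d [d0 ->]]] := fraction_exists x; have [p' [d' [d'0 ->]]] := fraction_exists y.
have sub_div (u v u' v' : Qq) : v != 0 -> v' != 0 ->
    u / v - u' / v' = (u * v' - u' * v) / (v * v').
  by move=> v0 v'0; rewrite -mulNr addf_div // mulNr.
have t0 (e : {poly rat}) : e != 0 -> tfrac e != 0 by rewrite /tfrac tofrac_eq0.
rewrite sub_div ?t0 //.
have -> : (tfrac p * tfrac d' - tfrac p' * tfrac d) / (tfrac d * tfrac d') =
    tfrac (p * d' - p' * d) / tfrac (d * d').
  by rewrite /tfrac tofracB !tofracM.
rewrite !qadams_frac ?mulf_neq0 // sub_div ?comp_polyXr_neq0 //.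
by rewrite rmorphB /= !comp_polyM /tfrac tofracB !tofracM.
Qed.

End QAdams.

Lemma qvar_neq0 : qvar != 0.
Proof. by rewrite /qvar /tfrac tofrac_eq0 polyX_eq0. Qed.

Lemma qvar_expr_neq1 i : (0 < i)%N -> qvar ^+ i != 1.
Proof.
move=> i0; rewrite /qvar /tfrac -tofracXn -tofrac1 tofrac_eq.
apply/eqP => /(congr1 (fun p : {poly rat} => size p)).
by rewrite size_polyXn size_poly1 => -[i1]; rewrite i1 in i0.
Qed.

Lemma qadams_eps a c r : (0 < c)%N -> (0 < r)%N ->
  qadams r ((qvar ^+ a - 1) / (1 - qvar ^+ c)) = eps qvar a c r.
Proof.
move=> c0 r0.
have -> : (qvar ^+ a - 1) / (1 - qvar ^+ c) = tfrac ('X^a - 1) / tfrac (1 - 'X^c).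
  by rewrite /tfrac !tofracB !tofracXn tofrac1.
have d0 : 1 - 'X^c != 0 :> {poly rat}.
  rewrite subr_eq0 eq_sym; apply/eqP => /(congr1 (fun p : {poly rat} => size p)).
  by rewrite size_polyXn size_poly1 => -[c1]; rewrite c1 in c0.
have compX m : ('X^m : {poly rat}) \Po 'X^r = 'X^r ^+ m.
  by rewrite rmorphXn /= comp_polyX.
have comp1 : (1 : {poly rat}) \Po 'X^r = 1 by rewrite -polyC1 comp_polyC.
rewrite qadams_frac // !rmorphB /= !compX !comp1.
rewrite -!exprM /tfrac !tofracB !tofracXn tofrac1 /eps /qvar /tfrac.
by rewrite ![(r * _)%N]mulnC.
Qed.

(** * Raising all variables to a power *)

Section Raise.

Context (F : fieldType) (n : nat) (k : 'I_n.+1 -> nat) (L : countType).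
Context (phi : F -> F) (phi0 : phi 0 = 0) (phi1 : phi 1 = 1).
Hypothesis phiB : forall x y, phi (x - y) = phi x - phi y.
Hypothesis phiM : forall x y, phi (x * y) = phi x * phi y.
Context (r : nat) (r_gt0 : (0 < r)%N).
Notation S := (series F k L).
Notation expo := (expo k L).
Notation raise := (@raise_vars F n k L phi phi0 r).
Implicit Types (f g : S) (d e : expo).

Lemma phiD x y : phi (x + y) = phi x + phi y.
Proof.
have phiN : phi (- y) = - phi y by rewrite -sub0r phiB phi0 sub0r.
by rewrite -{1}[y]opprK phiB phiN opprK.
Qed.

Lemma phi_sum I (s : seq I) (G : I -> F) :
  phi (\sum_(i <- s) G i) = \sum_(i <- s) phi (G i).
Proof. exact: (big_morph phi phiD phi0). Qed.

Lemma expo_mulrn1 d m : (d *+ m).1 = d.1 *+ m.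
Proof. by elim: m => [//|m IH]; rewrite !mulrS -IH. Qed.

Lemma expo_mulrn2 d m : (d *+ m).2 = d.2 *+ m.
Proof. by elim: m => [//|m IH]; rewrite !mulrS -IH. Qed.

Lemma expo_mulrn_inj : injective (fun d : expo => d *+ r).
Proof.
have int_inj (x y : int) : x *+ r = y *+ r -> x = y.
  exact: (pmulrnI r_gt0).
move=> d e de; case: d de => d1 d2; case: e => e1 e2 de.
have := congr1 fst de; have := congr1 snd de.
rewrite !expo_mulrn1 !expo_mulrn2 /= => h2 h1; congr pair.
  by apply/ffunP => v; apply: int_inj; rewrite -!ffunMnE h1.
apply/eqP/freeg_eqP => l; apply: int_inj.
by rewrite -!(raddfMn (coeff l)) h2.
Qed.

(** Multiplication of exponents by [r > 0] is injective, so the defining sum has one term. *)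
Lemma raiseE f d : raise f (d *+ r) = phi (f d).
Proof.
rewrite /= (fsbigE [:: d]) //.
- by rewrite big_seq_cond big_mkcondr /= -big_seq big_seq1 ifT // inE.
- by move=> e; rewrite /= inE => /eqP ->.
by move=> e /= /(@expo_mulrn_inj _ _) ->; rewrite inE eqxx.
Qed.

Lemma raise_eq0 f e : (forall d, d *+ r != e) -> raise f e = 0.
Proof.
move=> h; rewrite /= ; apply: fsbig1 => d /= de.
by have := h d; rewrite de eqxx.
Qed.

Lemma raise_neq0 f e : raise f e != 0 -> exists2 d, e = d *+ r & f d != 0.
Proof.
have [[d ->]|ne] := pselect (exists d, e = d *+ r).
  by rewrite raiseE => h; exists d => //; apply: contra_neq h => ->.
rewrite raise_eq0 ?eqxx // => d; apply/eqP => de.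
by apply: ne; exists d.
Qed.

Lemma raise_zfree A f : zfree A f -> zfree A (raise f).
Proof.
move=> hf e /raise_neq0[d -> fd] v Av.
by rewrite expo_mulrn1 ffunMnE (hf _ fd _ Av) mul0rn.
Qed.

Lemma raise_eq f g : (forall d, phi (f d) = g (d *+ r)) ->
  (forall e, g e != 0 -> exists d, e = d *+ r) -> raise f = g.
Proof.
move=> h1 h2; apply: seriesP => e.
have [[d ->]|ne] := pselect (exists d, e = d *+ r); first by rewrite raiseE.
rewrite raise_eq0 => [|d]; last by apply/eqP => de; apply: ne; exists d.
by apply/esym/eqP/negPn/negP => /h2.
Qed.

Lemma raiseD f g : raise (f + g) = raise f + raise g.
Proof.
apply: raise_eq => [d|e]; first by rewrite !saddE !raiseE phiD.
rewrite saddE; have [->|/raise_neq0[d -> _]] := eqVneq (raise f e) 0.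
  by rewrite add0r => /raise_neq0[d -> _]; exists d.
by exists d.
Qed.

Lemma raise0 : raise 0 = 0.
Proof. by apply: raise_eq => [d|e]; rewrite !szeroE // eqxx. Qed.

Lemma raise_sum I (s : seq I) (P : pred I) (G : I -> S) :
  raise (\sum_(i <- s | P i) G i) = \sum_(i <- s | P i) raise (G i).
Proof. exact: (big_morph raise raiseD raise0). Qed.

Lemma raise_scst x : raise (scst k L x) = scst k L (phi x).
Proof.
apply: raise_eq => [d|e] /=; last first.
  case: ifP => [/eqP -> _|_]; last by rewrite eqxx.
  by exists 0; rewrite mul0rn.
have -> : (d *+ r == 0) = (d == 0).
  by rewrite -[X in _ == X](@mul0rn _ r) (inj_eq expo_mulrn_inj).
by case: ifP.
Qed.

Lemma raise_zmono u : raise (zmono F L u) = zmono F L (u *+ r).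
Proof.
have uE : ((u *+ r, 0) : expo) = ((u, 0) : expo) *+ r.
  by apply/eqP; rewrite -pair_eqE /= expo_mulrn1 expo_mulrn2 mul0rn !eqxx.
apply: raise_eq => [d|e] /=; last first.
  by move/natr_bool_neq0/eqP => ->; exists (u, 0).
by rewrite uE (inj_eq expo_mulrn_inj); case: eqP; rewrite ?phi0 ?phi1.
Qed.

Lemma raiseM f g : raise (f * g) = raise f * raise g.
Proof.
apply: raise_eq => [d|e]; last first.
  move=> /smul_neq0[d [/raise_neq0[d1 -> _] /raise_neq0[d2 e2 _]]].
  by exists (d1 + d2); rewrite mulrnDl -e2 addrC subrK.
have [X [uX HX]] := series_finite f g d.
rewrite (smulE uX HX) phi_sum (@smulE _ _ _ _ _ _ _ [seq x *+ r | x <- X]).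
- by rewrite big_map; apply: eq_bigr => x _; rewrite phiM -mulrnBl !raiseE.
- by rewrite map_inj_uniq //; apply: expo_mulrn_inj.
move=> e /raise_neq0[d1 -> fd]; rewrite -mulrnBl => /raise_neq0[d2 /expo_mulrn_inj <- gd].
by apply: map_f; apply: HX.
Qed.

End Raise.

(** * Independence of the power sums *)

Section PowerSums.

Variable b : nat.
Implicit Types (P Q : {mpoly rat[b]}).

Lemma mderiv_comp_mpoly m (t : b.-tuple {mpoly rat[m]}) P j :
  (P \mPo t)^`M(j) = \sum_(i < b) (P^`M(i) \mPo t) * (tnth t i)^`M(j).
Proof.
pose C P := (P \mPo t)^`M(j) = \sum_(i < b) (P^`M(i) \mPo t) * (tnth t i)^`M(j).
have CC x : C x%:MP.
  rewrite /C comp_mpolyC mderivC big1 // => i _.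
  by rewrite mderivC comp_mpoly0 mul0r.
have CX i : C 'X_i.
  rewrite /C comp_mpolyXU -tnth_nth (bigD1 i) //= big1 ?addr0.
    have -> : ('X_i : {mpoly rat[b]})^`M(i) = 1.
      rewrite mderivX mnm1E eqxx scale1r -mpolyX0; congr mpolyX.
      by apply/mnmP => l; rewrite mnmBE subnn mnm0E.
    by rewrite comp_mpoly1 mul1r.
  move=> l li; rewrite mderivX mnm1E eq_sym (negPf li) scale0r comp_mpoly0.
  by rewrite mul0r.
have compM P1 P2 : (P1 * P2) \mPo t = (P1 \mPo t) * (P2 \mPo t) := rmorphM _ P1 P2.
have CM P1 P2 : C P1 -> C P2 -> C (P1 * P2).
  rewrite /C compM mderivM => -> ->; rewrite mulr_suml mulr_sumr -big_split.
  apply: eq_bigr => i _ /=; rewrite mderivM comp_mpolyD !compM mulrDl.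
  by rewrite mulrAC mulrA.
have CD P1 P2 : C P1 -> C P2 -> C (P1 + P2).
  rewrite /C comp_mpolyD mderivD => -> ->; rewrite -big_split.
  by apply: eq_bigr => i _ /=; rewrite mderivD comp_mpolyD mulrDl.
rewrite -/(C P) [P]mpolyE; apply: (big_ind C) => //; first exact: (CC 0).
move=> l _; rewrite -mul_mpolyC; apply: (CM) => //.
rewrite mpolyXE_id; apply: (big_ind C) => [||i _]; [exact: (CC 1) | exact: CM |].
elim: (l i) => [|e IH]; first exact: (CC 1).
by rewrite exprS; apply: CM.
Qed.

Lemma mderiv_eq0_const P : (forall i, P^`M(i) = 0) -> P = (P@_0%MM)%:MP.
Proof.
move=> dP; apply/mpolyP => m; rewrite mcoeffC.
have [->|m0] := eqVneq m 0%MM; first by rewrite mulr1.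
have [i mi] : exists i, m i != 0%N.
  apply/existsP; apply: contraR m0 => /existsPn h; apply/eqP/mnmP => i.
  by rewrite mnm0E; have := h i; rewrite negbK => /eqP.
have := mcoeff_deriv i (m - U_(i))%MM P; rewrite dP mcoeff0 submK ?lep1mP //.
by move/esym/eqP; rewrite mulrn_eq0 /= => /eqP ->; rewrite mulr0.
Qed.

Lemma mderiv_psum m (j : 'I_m) i :
  (psum m i.+1)^`M(j) = i.+1%:R * 'X_j ^+ i.
Proof.
rewrite /psum raddf_sum (bigD1 j) //= big1 ?addr0 => [|l lj]; last first.
  by rewrite mpolyXn mderivX mulmnE mnm1E (negPf lj) mul0n scale0r.
rewrite mpolyXn mderivX mulmnE mnm1E eqxx mul1n scaler_nat mulr_natl.
by congr (_ *+ _); rewrite mulmSr addmK -mpolyXn.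
Qed.

(* If [P] is a relation of minimal degree, so are its derivatives [P_i], by the
   chain rule: [\sum_i (i + 1) P_i x ^ i] vanishes at the [b] variables. *)
Lemma psum_independent P : P \mPo [tuple psum b i.+1 | i < b] = 0 -> P = 0.
Proof.
set t := [tuple _ | _ < _]; have [N sP] := ubnP (msize P); elim: N P sP => // N IH P sP Pt.
have dP i : P^`M(i) = 0.
  have [->|P0] := eqVneq P 0; first by rewrite mderiv0.
  apply: IH.
    have: (msize P^`M(i) <= (msize P).-1)%N.
      rewrite msizeE; apply/bigmax_leqP_seq => m mP _.
      have : (m + U_(i))%MM \in msupp P.
        move: mP; rewrite !mcoeff_msupp mcoeff_deriv; apply: contra => /eqP ->.
        by rewrite mul0rn.
      by move/msize_mdeg_lt; rewrite mdegD mdeg1 addn1; lia.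
    have : (0 < msize P)%N by rewrite lt0n msize_poly_eq0.
    by lia.
  (* By the chain rule [p] vanishes at the [b] distinct variables, while its size is at most [b].
     Here [insub] turns an exponent [e < b] into an index. *)
  pose p : {poly {mpoly rat[b]}} := \poly_(e < b)
    (if insub e is Some e' then (P^`M(e') \mPo t) * e.+1%:R else 0).
  have p0 : p = 0.
    apply/eqP/negPn/negP => pn0.
    have uX : uniq [seq ('X_j : {mpoly rat[b]}) | j <- enum 'I_b].
      rewrite map_inj_uniq ?enum_uniq // => j l /(congr1 (fun p => p@_U_(j))).
      rewrite !mcoeffXU eqxx; case: eqP => [->//|_ /eqP].
      by rewrite oner_eq0.
    have rX : all (root p) [seq ('X_j : {mpoly rat[b]}) | j <- enum 'I_b].
      apply/allP => _ /mapP[j _ ->]; rewrite /root horner_poly.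
      have := mderiv_comp_mpoly t P j; rewrite Pt mderiv0 => /esym h.
      rewrite -[X in _ == X]h; apply/eqP/eq_bigr => e _; rewrite valK tnth_mktuple.
      by rewrite mderiv_psum mulrA.
    have := max_poly_roots pn0 rX uX; rewrite size_map size_enum_ord ltnNge.
    by rewrite size_poly.
  have := congr1 (fun p : {poly {mpoly rat[b]}} => p`_i) p0.
  rewrite coef0 coef_poly ltn_ord valK => /eqP; rewrite mulf_eq0 => /orP[/eqP //|].
  by rewrite -mpolyC_nat mpolyC_eq0 Num.Theory.pnatr_eq0.
have PC := mderiv_eq0_const dP; move: Pt; rewrite PC comp_mpolyC => /eqP.
by rewrite mpolyC_eq0 => /eqP ->; rewrite mpolyC0.
Qed.

Lemma comp_psum_homog m :
  'X_[m] \mPo [tuple psum b i.+1 | i < b] \is (mnmwgt m).-homog.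
Proof.
rewrite comp_mpolyX /mnmwgt.
have psum_homog N r : psum N r \is r.-homog.
  apply: rpred_sum => i _; suff : 'X_i ^+ r \is [in rat[N], (1 * r).-homog].
    by rewrite mul1n.
  by apply: dhomogMn; rewrite dhomogX; apply/eqP/mdeg1.
elim/big_ind2: _ => [|x d y e|i _]; first exact: dhomog1.
  exact: dhomogM.
by rewrite tnth_mktuple mulnC; apply: dhomogMn.
Qed.

(** The part [Q2] of [P] of weight other than [d] maps to a polynomial with no component of degree
    [d] and, by homogeneity, none of any other degree. Independence then gives [Q2 = 0]. *)
Lemma psum_weight P d : P \mPo [tuple psum b i.+1 | i < b] \is d.-homog ->
  forall m, m \in msupp P -> mnmwgt m = d.
Proof.
set t := [tuple _ | _ < _] => Ph m mP; apply/eqP/negPn/negP => md.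
pose Q1 := \sum_(l <- msupp P | mnmwgt l == d) P@_l *: 'X_[l].
pose Q2 := \sum_(l <- msupp P | mnmwgt l != d) P@_l *: 'X_[l].
have PQ : P = Q1 + Q2 by rewrite {1}[P]mpolyE (bigID (fun l => mnmwgt l == d)).
have comp_sum (p : pred 'X_{1..b}) : (\sum_(l <- msupp P | p l) P@_l *: 'X_[l]) \mPo t =
    \sum_(l <- msupp P | p l) ((P@_l *: 'X_[l]) \mPo t).
  exact: (big_morph _ (comp_mpolyD t) (comp_mpoly0 t)).
have Q20 : Q2 = 0.
  apply: psum_independent; apply/mpolyP => nu; rewrite mcoeff0.
  have [nud|nud] := eqVneq (mdeg nu) d.
    rewrite -/t /Q2 comp_sum raddf_sum /= big1 // => l ld; rewrite comp_mpolyZ mcoeffZ.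
    have nul : mdeg nu != mnmwgt l by rewrite nud eq_sym.
    by rewrite (dhomog_nemf_coeff (comp_psum_homog l) nul) mulr0.
  have -> : Q2 = P - Q1 by rewrite PQ addrAC subrr add0r.
  rewrite comp_mpolyB mcoeffB (dhomog_nemf_coeff Ph) // sub0r.
  rewrite /Q1 comp_sum raddf_sum /= big1 ?oppr0 // => l /eqP ld.
  have nul : mdeg nu != mnmwgt l by rewrite ld.
  by rewrite comp_mpolyZ mcoeffZ (dhomog_nemf_coeff (comp_psum_homog l) nul) mulr0.
have := congr1 (mcoeff m) Q20; rewrite mcoeff0 /Q2 raddf_sum big_mkcond /=.
rewrite (bigD1_seq m) ?msupp_uniq //= md mcoeffZ mcoeffX eqxx mulr1 big1 ?addr0.
  by move/eqP; rewrite mcoeff_eq0 mP.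
move=> l lm; case: ifP => // _.
by rewrite mcoeffZ mcoeffX (negPf lm) mulr0.
Qed.

End PowerSums.

Lemma to_psums_weight d f : sf_homog d f ->
  forall m, m \in msupp (tagged (to_psums f)) -> mnmwgt m = d.
Proof.
move=> fd; have [fP|f0] := pselect (exists P, in_psums f P); last first.
  (* Without an expression in the power sums, [xget] returns its default [0], whose support is
     empty. *)
  have -> : to_psums f = existT (fun b => {mpoly rat[b]}) 0%N 0.
    by rewrite /to_psums; apply: xgetPN => P fP; apply: f0; exists P.
  by move=> m /=; rewrite msupp0.
have {}fP : in_psums f (to_psums f) by case: fP => P fP; exact: (xgetI _ fP).
by apply: psum_weight; rewrite -fP.
Qed.

Section Plethysm.

Context (n : nat) (k : 'I_n.+1 -> nat) (L : countType).
Context (a c : nat) (c_gt0 : (0 < c)%N) (s : 'I_n).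

Notation S := (series Qq k L).
Notation cst := (@scst Qq n k L).
Notation lvl := (pred1 (s : nat)).
Notation zpsum := (@zpsum Qq n k L s).

Lemma padamsD r (f g : S) : padams r.+1 (f + g) = padams r.+1 f + padams r.+1 g.
Proof. by apply: raiseD => //; exact: qadamsB. Qed.

Lemma padamsM r (f g : S) : padams r.+1 (f * g) = padams r.+1 f * padams r.+1 g.
Proof. by apply: raiseM => //; [exact: qadamsB | exact: qadamsM]. Qed.

Lemma padams_sum r I (t : seq I) (P : pred I) (G : I -> S) :
  padams r.+1 (\sum_(i <- t | P i) G i) = \sum_(i <- t | P i) padams r.+1 (G i).
Proof. by apply: raise_sum => //; exact: qadamsB. Qed.

Lemma padams_scst r x : padams r.+1 (cst x) = cst (qadams r.+1 x).
Proof. exact: raise_scst. Qed.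

Lemma padams_zv r t (i : 'I_(k t)) : padams r.+1 (zv Qq L i) = zv Qq L i ^+ r.+1.
Proof.
rewrite /padams /zv raise_zmono; [exact: zmonoMn | exact: qadams1 | by []].
Qed.

Lemma padams_linear r (X Y : pred L) :
  padams r.+1 (zsum k L (cur s) * alph Qq k Y + alph Qq k X) =
  zpsum r.+1 * padams r.+1 (alph Qq k Y) + padams r.+1 (alph Qq k X).
Proof.
have -> : zpsum r.+1 = padams r.+1 (zsum k L (cur s)).
  by rewrite /zsum padams_sum; apply: eq_bigr => i _; rewrite padams_zv.
by rewrite padamsD padamsM.
Qed.

Lemma padams_linear_bar r (X Y : pred L) :
  padams r.+1 (cst ((qvar ^+ a - 1) / (1 - qvar ^+ c)) * alph Qq k Y + alph Qq k X) =
  cst (eps qvar a c r.+1) * padams r.+1 (alph Qq k Y) + padams r.+1 (alph Qq k X).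
Proof. by rewrite padamsD padamsM padams_scst qadams_eps. Qed.

End Plethysm.

Section PlethysmClosure.

Context (n : nat) (k : 'I_n.+1 -> nat) (L : countType).
Notation S := (series Qq k L).
Implicit Types (f : symfun) (h : S).

Lemma zfree_pleth A f h : zfree A h -> zfree A (pleth f h).
Proof.
move=> hh; apply: zfree_sum => m _; apply: zfreeM; first exact: zfree_scst.
by apply: zfree_prod => i _; apply/zfreeX/raise_zfree.
Qed.

Lemma zdeg_ge_pleth s f h : zdeg_ge s 0 h -> zdeg_ge s 0 (pleth f h).
Proof.
move=> hh; have filt := zdeg_filtration Qq k L s; have [h0 h1 hB hM hW] := filt.
have padams0 r : zdeg_ge s 0 (padams r.+1 h).
  move=> e /raise_neq0[//|d -> /hh d0].
  by elim: r => [//|r IH]; rewrite mulrS zdegD addr_ge0.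
apply: (@filtration_sum _ _ filt _ _ _ _ 0%N) => m _; apply: (hM 0%N 0%N).
  exact/zdeg_ge_free/zfree_scst.
rewrite /mmap1; apply: (big_ind (zdeg_ge s 0)) => [|f1 f2|i _].
  exact/zdeg_ge_free/zfree1.
  exact: (hM 0%N 0%N).
elim: (m i) => [|e IH]; first exact/zdeg_ge_free/zfree1.
rewrite exprS; apply: (hM 0%N 0%N); [exact: padams0 | exact: IH].
Qed.

Lemma zfree_linear A (h : S) (X Y : pred L) :
  zfree A h -> zfree A (h * alph Qq k Y + alph Qq k X).
Proof.
move=> hh; apply: zfreeD; last exact: zfree_alph.
by apply: zfreeM; [exact: hh | exact: zfree_alph].
Qed.

Lemma zdeg_ge_linear s (X Y : pred L) :
  zdeg_ge s 0 (zsum k L s * alph Qq k Y + alph Qq k X).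
Proof.
have filt := zdeg_filtration Qq k L s; have [h0 h1 hB hM hW] := filt.
have free0 (g : S) : zfree (pred1 (s : nat)) g -> zdeg_ge s 0 g by apply: zdeg_ge_free.
apply: zdeg_geD; last exact/free0/zfree_alph.
apply: (hM 0%N 0%N); last exact/free0/zfree_alph.
apply: (@filtration_sum _ _ filt _ _ _ _ 0%N) => i _; apply: (hW 0%N 1%N _ isT).
by have := @zdeg_ge_zmono Qq n k L s (zexp i); rewrite zdeg_zexp.
Qed.

End PlethysmClosure.

Section EvaluatesPleth.

Context (n : nat) (k : 'I_n.+1 -> nat) (L : countType).
Context (a c : nat) (c_gt0 : (0 < c)%N) (s : 'I_n).

Notation S := (series Qq k L).
Notation lvl := (pred1 (s : nat)).
Notation evaluates := (@evaluates Qq qvar n k L a c s).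
Notation zsum := (zsum k L (cur s)).
Notation zbar := (@scst Qq n k L ((qvar ^+ a - 1) / (1 - qvar ^+ c))).
Notation alph := (alph Qq k).

(** Every monomial of [f] in the power sums has weight [e], so multiplying by its factors one after
    the other costs [e] in total. *)
Lemma evaluates_pleth d e (f : symfun) (X Y : pred L) (g gbar : S) :
  sf_homog e f -> evaluates d g gbar ->
  evaluates (d + e) (g * pleth f (zsum * alph Y + alph X))
    (gbar * pleth f (zbar * alph Y + alph X)).
Proof.
move=> fe hg; rewrite /pleth /mmap !mulr_sumr big_seq [X in evaluates _ _ X]big_seq.
apply: evaluates_sum => m mP; rewrite mulrCA [X in evaluates _ _ X]mulrCA.
apply: evaluates_scst; rewrite -(to_psums_weight fe mP) /mnmwgt /mmap1.
elim: (index_enum _) => [|i r IH]; first by rewrite !big_nil addn0 !mulr1.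
rewrite !big_cons [(m i * _ + _)%N]addnC addnA.
rewrite [g * _]mulrA [g * _ * _]mulrAC [gbar * _]mulrA [gbar * _ * _]mulrAC.
rewrite padams_linear padams_linear_bar //.
apply: (evaluates_linearX qvar_neq0 qvar_expr_neq1 c_gt0 _ _ _ IH) => //; exact/raise_zfree/zfree_alph.
Qed.

Lemma evaluates_prod_pleth m (e : 'I_m -> nat) (f : 'I_m -> symfun) (X Y : 'I_m -> pred L) :
  (forall j, sf_homog (e j) (f j)) ->
  evaluates (\sum_(j < m) e j)
    (\prod_(j < m) pleth (f j) (zsum * alph (Y j) + alph (X j)))
    (\prod_(j < m) pleth (f j) (zbar * alph (Y j) + alph (X j))).
Proof.
move=> fe; elim: (index_enum _) => [|j r IH].
  by rewrite !big_nil; apply: evaluates1 => //; [exact: qvar_neq0 | exact: qvar_expr_neq1].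
rewrite !big_cons [(e j + _)%N]addnC [pleth _ _ * _]mulrC [X in evaluates _ _ X]mulrC.
exact: evaluates_pleth.
Qed.

End EvaluatesPleth.

(** * All levels *)

Section Levels.

Context (F : fieldType) (n : nat) (k : 'I_n.+1 -> nat) (L : countType).
Notation S := (series F k L).
Variables (W : 'I_n.+1 -> S) (Phi K R : 'I_n -> S).
Hypothesis K_free : forall (s : 'I_n) (A : pred nat), ~~ A s -> ~~ A s.+1 -> zfree A (K s).
Hypothesis Phi_free : forall (s : 'I_n) (A : pred nat), ~~ A s -> zfree A (Phi s).
Hypothesis R_free : forall (s : 'I_n) (A : pred nat), zfree A (R s).
Hypothesis level : forall s : 'I_n,
  ctA (pred1 (s : nat)) (Phi s * W (cur s) * K s) = R s * W (nxt s).

(** Induction on [t]: the levels already eliminated leave factors [R] free of all variables [z], and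
    the single factor [W] at level [t]. *)
Lemma ctA_levels t : (t <= n)%N ->
  ctA (fun i => i < t)%N (W ord0 * \prod_(s < n) (Phi s * K s)) =
  (\prod_(s < n | (s < t)%N) R s) * W (inord t) *
  \prod_(s < n | (t <= s)%N) (Phi s * K s).
Proof.
elim: t => [_|t IH tn].
  rewrite [X in X * _ * _]big1 // mul1r.
  have -> : inord 0 = ord0 :> 'I_n.+1 by apply: val_inj; rewrite /= inordK.
  apply: seriesP => e; rewrite ctAE; case: ifP => // /negP[].
  by apply/forallP.
have <- : ctA (pred1 t) (ctA (fun i => i < t)%N (W ord0 * \prod_(s < n) (Phi s * K s))) =
    ctA (fun i => i < t.+1)%N (W ord0 * \prod_(s < n) (Phi s * K s)).
  by apply: ctA_comp => i; rewrite /= ltnS leq_eqVlt.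
rewrite IH ?(ltnW tn) //; pose s0 := Ordinal tn.
have -> : inord t = cur s0 by apply: val_inj; rewrite /= inordK // ltnW.
have -> : inord t.+1 = nxt s0 by apply: val_inj; rewrite /= inordK.
have -> : \prod_(s < n | (t <= s)%N) (Phi s * K s) =
    Phi s0 * K s0 * \prod_(s < n | (t < s)%N) (Phi s * K s).
  rewrite (bigD1 s0) //=; congr (_ * _); apply: eq_bigl => s.
  by rewrite ltn_neqAle -val_eqE /= andbC eq_sym.
have -> : \prod_(s < n | (s < t.+1)%N) R s = R s0 * \prod_(s < n | (s < t)%N) R s.
  rewrite (bigD1 s0) ?ltnSn //=; congr (_ * _); apply: eq_bigl => s.
  by rewrite ltnS -val_eqE /= [RHS]ltn_neqAle andbC.
set P := \prod_(s < n | (t < s)%N) _; set Q := \prod_(s < n | (s < t)%N) R s.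
have -> : Q * W (cur s0) * (Phi s0 * K s0 * P) =
    (Q * P) * (Phi s0 * W (cur s0) * K s0) by ring.
(* The kernels of the levels above [t] involve only levels above [t], so they leave the constant
   term at level [t] together with the factors [R]. *)
rewrite ctA_mulfree; last first.
  apply: zfreeM; first by apply: zfree_prod => s _; apply: R_free.
  apply: zfree_prod => s ts; apply: zfreeM; first by apply: Phi_free => /=; rewrite gtn_eqF.
  by apply: K_free; rewrite /= gtn_eqF // ltnW.
have -> : ctA (pred1 t) (Phi s0 * W (cur s0) * K s0) = R s0 * W (nxt s0) := level s0.
by ring.
Qed.

End Levels.

(** The parameter [a_s] is [0] beyond the first level, where the corresponding factors are empty
    products. *)
Lemma morris_kernelE n (k : 'I_n.+1 -> nat) (L : countType) a c s :
  morris_kernel k L a c s =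
  (if s == 0%N :> nat then \prod_(i < k (cur s)) qpoch (scst k L qvar) (zinv Qq L i) a
   else 1) * @level_kernel Qq qvar n k L c s.
Proof.
rewrite /morris_kernel big_split /= /level_kernel -!mulrA; congr (_ * _).
by case: eqP => // _; rewrite big1 // => i _; rewrite /qpoch big_ord0.
Qed.

Lemma morris_valueE k a c : (0 < c)%N -> morris_value qvar k a c = Morris k a c.-1 c.
Proof.
move=> c0; have qfE m : qfac qvar m = qfact m by apply: eq_bigr => l _; rewrite exprS.
by apply: eq_bigr => i _; rewrite !qfE.
Qed.

Lemma prod_morris_kernel n (k : 'I_n.+1 -> nat) (L : countType) a c : (1 <= n)%N ->
  \prod_(s < n) morris_kernel k L a c s =
  \prod_(i < k ord0) qpoch (scst k L qvar) (zinv Qq L i) a *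
  \prod_(s < n) @level_kernel Qq qvar n k L c s.
Proof.
move=> n0; under eq_bigr => s _ do rewrite morris_kernelE.
rewrite big_split /=; congr (_ * _).
pose W t : series Qq k L := \prod_(i < k t) qpoch (scst k L qvar) (zinv Qq L i) a.
rewrite (bigD1 (Ordinal n0)) //= -/(W _) big1 ?mulr1 => [|s].
  by congr W; apply: val_inj.
by rewrite -val_eqE /= => /negPf ->.
Qed.

Lemma zfree_level_kernel n (k : 'I_n.+1 -> nat) (L : countType) c (s : 'I_n)
    (A : pred nat) : ~~ A s -> ~~ A s.+1 -> zfree A (@level_kernel Qq qvar n k L c s).
Proof.
move=> As As1; have fq := @zfree_scst Qq n k L A qvar.
have fz (i : 'I_(k (cur s))) : zfree A (zv Qq L i) by apply: zfree_zv.
have fz' (i : 'I_(k (cur s))) : zfree A (zinv Qq L i) by apply: zfree_zinv.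
apply: zfreeM; first apply: zfreeM.
- apply: zfree_prod => i _; apply: zfree_qpoch; first exact: fq.
  by apply: zfreeM; [exact: fq | exact: fz].
- apply: zfree_prod => i _; apply: zfree_prod => j _; apply: zfreeM.
    by apply: zfree_qpoch; [exact: fq | apply: zfreeM; [exact: fz | exact: fz']].
  apply: zfree_qpoch; first exact: fq.
  by apply: zfreeM; [exact: fq | apply: zfreeM; [exact: fz | exact: fz']].
apply: zfree_prod => j _; apply: zfree_prod => i _; apply: zfree_prod => l _.
exact: zfree_geom.
Qed.

Theorem theorem5p8
  (n : nat) (hn : (1 <= n)%N)
  (c : nat) (hc : (0 < c)%N)
  (k : 'I_n.+1 -> nat)
  (hk : forall s : 'I_n, (k (nxt s) <= k (cur s))%N)
  (m : 'I_n -> nat) (a : nat)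
  (lam : forall s : 'I_n, 'I_(m s) -> seq nat)
  (hlam : forall (s : 'I_n) (j : 'I_(m s)), is_partition (lam s j))
  (f : forall s : 'I_n, 'I_(m s) -> symfun)
  (hf : forall (s : 'I_n) (j : 'I_(m s)), sf_homog (sumn (lam s j)) (f s j))
  (hdeg : forall s : 'I_n,
     (\sum_(j < m s) sumn (lam s j) <= k (cur s) - k (nxt s))%N)
  (L : countType)
  (X Y : forall s : 'I_n, 'I_(m s) -> pred L) :
  ct ((\prod_(s < n) \prod_(j < m s)
         pleth (f s j)
           (zsum k L (cur s) * alph Qq k (Y s j) + alph Qq k (X s j)))
      * \prod_(s < n) morris_kernel k L a c s)
  = (\prod_(s < n) \prod_(j < m s)
       pleth (f s j)
         (scst k L ((qvar ^+ a - 1) / (1 - qvar ^+ c)) * alph Qq k (Y s j)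
          + alph Qq k (X s j)))
    * (\prod_(s < n) scst k L (Morris (k (cur s)) a c.-1 c))
    * \prod_(j < k ord_max) qpoch (scst k L qvar) (zinv Qq L j) a.
Proof.
pose W t : series Qq k L := \prod_(i < k t) qpoch (scst k L qvar) (zinv Qq L i) a.
pose K s : series Qq k L := @level_kernel Qq qvar n k L c s.
pose Phi s : series Qq k L := \prod_(j < m s)
  pleth (f s j) (zsum k L (cur s) * alph Qq k (Y s j) + alph Qq k (X s j)).
pose Phi' s : series Qq k L := \prod_(j < m s)
  pleth (f s j) (scst k L ((qvar ^+ a - 1) / (1 - qvar ^+ c)) * alph Qq k (Y s j)
                 + alph Qq k (X s j)).
pose R s : series Qq k L := Phi' s * scst k L (Morris (k (cur s)) a c.-1 c).
rewrite prod_morris_kernel // -big_split /= -/(W _) -/(W ord_max).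
transitivity (ctA (fun i => i < n)%N (W ord0 * \prod_(s < n) (Phi s * K s))).
  have -> : \prod_(s < n) (Phi s * K s) = \prod_(s < n) Phi s * \prod_(s < n) K s.
    exact: big_split.
  by rewrite mulrCA; apply: seriesP.
have K_free s (A : pred nat) : ~~ A (s : 'I_n) -> ~~ A s.+1 -> zfree A (K s).
  exact: zfree_level_kernel.
have Phi_free s (A : pred nat) : ~~ A (s : 'I_n) -> zfree A (Phi s).
  move=> As; apply: zfree_prod => j _; apply/zfree_pleth/zfree_linear.
  by apply: zfree_sum => i _; apply: zfree_zv.
have R_free s (A : pred nat) : zfree A (R s).
  apply: zfreeM; last exact: zfree_scst.
  by apply: zfree_prod => j _; apply/zfree_pleth/zfree_linear/zfree_scst.
have level (s : 'I_n) : ctA (pred1 (s : nat)) (Phi s * W (cur s) * K s) = R s * W (nxt s).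
  have Phi_ge0 : zdeg_ge (cur s) 0 (Phi s).
    apply: (big_ind (zdeg_ge (cur s) 0)) => [|f1 f2 h1 h2|j _].
    - exact/zdeg_ge_free/zfree1.
    - by rewrite -[0]addr0; apply: (zdeg_geM h1 h2).
    exact/zdeg_ge_pleth/zdeg_ge_linear.
  (* The plethysms and the denominators together use at most [k (cur s)] functions [g_r]; [hk] makes
     the subtraction in [hdeg] exact. *)
  have deg_le : (\sum_(j < m s) sumn (lam s j) + k (nxt s) <= k (cur s))%N.
    by have := hdeg s; have := hk s; lia.
  have ev := @evaluates_prod_pleth n k L a c hc s _ _ _ (X s) (Y s) (hf s).
  rewrite (level_identity qvar_neq0 hc deg_le Phi_ge0 ev).
  by rewrite (morris_identity qvar_neq0 qvar_expr_neq1) // morris_valueE.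
rewrite (ctA_levels K_free Phi_free R_free level (leqnn n)).
rewrite [X in _ * X]big1 ?mulr1 => [|s]; last by rewrite leqNgt ltn_ord.
have -> : inord n = ord_max :> 'I_n.+1 by apply: val_inj; rewrite /= inordK.
by congr (_ * _); apply: eq_bigl => s; rewrite ltn_ord.
Qed.
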